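(* Let $B\in\mathbb Z_{\ge 1}$. For fixed $r>1$, with $H^*$ a minimizer of the functional $G$ associated with $(r,t)$, $$\mathcal R_B(\hat S^{(H^* )}_{t,T},S_{t,T})\lesssim B^2\,\log^{-2+\frac1{1+r}}(t)\;t^{-\frac{2}{1+r}},$$ where the implicit constant depends on $r$.
   Context: Setting (Poissonized generalized unseen species problem). $\mathcal{S}$ is an at most countable set of species and $\mu$ is a probability measure on $2^{\mathcal S}$ supported on finite sets. $t,t'>0$, $r=t'/t$, $T=t+t'=(1+r)t$. Let $X_1,X_2,\dots$ be i.i.d. from $\mu$, and let $n\sim\mathrm{Poisson}(t)$, $m\sim\mathrm{Poisson}(t')$ be independent of each other and of the $X_i$. The first expedition observes $X_1,\dots,X_n$, the second $X_{n+1},\dots,X_{n+m}$. For $s\in\mathcal S$, $N_s$ (resp. $N_s'$) is the number of sets observed in the first (resp. second) expedition that contain $s$. $S_t=|\{s:N_s>0\}|$, $S_T=|\{s:N_s+N_s'>0\}|$, $S_{t,T}=S_T-S_t$. $\mu\prec B$ means $\mu(A)=0$ whenever $|A|>B$. The normalized risk is $$\mathcal R_B(\hat S_{t,T},S_{t,T})=\sup_{\mu\prec B}\frac{\mathbb E[|\hat S_{t,T}-S_{t,T}|^2]}{r^2t^2},$$ the supremum ranging over all such $\mu$ on all at most countable $\mathcal S$. A linear estimator is one of the form $\hat S^{(H)}_{t,T}=\sum_{s\in\mathcal S}H(N_s)$ for a function $H:\mathbb Z_{\ge0}\to\mathbb R$ with $H(0)=0$ (which may depend on $r$ and $t$); write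 $H_i=H(i)$. Let $g_H(x)=\sum_{i=1}^\infty\frac{H_i}{i!}x^i$, and let $H^2$ be the element-wise square of $H$. Define $$Y_b=\Big(\max_{p\in[0,1]}\frac{e^{-pt}}{p}\big|1-e^{-rpt}-g_H(pt)\big|\Big)^2,\qquad Y_v=\max_{q\in[0,1]}\frac{e^{-qt}}{q}\big(1-e^{-rqt}+g_{H^2}(qt)\big),\qquad G(H)=Y_b+Y_v,$$ where both expressions are extended continuously at zero (values $t|r-H_1|$ at $p=0$ and $t(r+H_1^2)$ at $q=0$), and $G(H)=+\infty$ if $\sum_{i\ge1}H_i^2t^i/i!=\infty$. A minimizer of $G$ over all real sequences exists for all $r,t>0$. $a(t)\lesssim b(t)$ means there is a constant $C$ (not depending on $t$ or $B$) with $a(t)\le C\,b(t)$ for all sufficiently large $t$. *)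

(* Defs.v *)
From mathcomp Require Import all_boot all_order all_algebra finmap.
From mathcomp Require Import all_classical all_reals all_analysis.

Set Implicit Arguments.
Unset Strict Implicit.
Unset Printing Implicit Defensive.

Import Order.TTheory GRing.Theory Num.Theory.
Import numFieldNormedType.Exports.

Local Open Scope classical_set_scope.
Local Open Scope ring_scope.

Section Species.
Variable S : countType.

Definition cylinders : set (set (set S)) :=
  [set [set A : set S | A s] | s in [set: S]].

(* [2^S] with the product sigma-algebra.  As [S] is countable, all singletons
   and the set of all finite subsets are measurable. *)
Definition subsets := g_sigma_algebraType cylinders.

Definition finitely_supported (R : realType) (mu : probability subsets R) :=
  mu [set A : set S | finite_set A] = 1%E.

(* [mu] gives mass zero to each set of more than [B] species; infinite sets
   count as having more than [B] elements. *)
Definition size_bounded (R : realType) (mu : probability subsets R) (B : nat) :=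
  forall A : set S, ~~ (A #<= `I_B)%card -> mu [set A] = 0%E.

End Species.

Definition mutually_independent (d : measure_display) (T : measurableType d)
    (R : realType) (P : probability T R) (I : choiceType)
    (F : I -> set (set T)) :=
  forall (J : {fset I}) (E : I -> set T),
    (forall i, i \in J -> F i (E i)) ->
    (P (\bigcap_(i in [set` J]) E i) = \prod_(i <- J) P (E i))%E.

Section Expeditions.
Variables (S : countType) (R : realType) (d : measure_display).
Variables (Omega : measurableType d) (P : probability Omega R).
Variables (X : nat -> {RV P >-> subsets S}) (n m : {RV P >-> nat}).

Definition sampling_events (i : (bool + nat)%type) : set (set Omega) :=
  match i with
  | inl true => preimage_set_system setT n measurable
  | inl false => preimage_set_system setT m measurable
  | inr k => preimage_set_system setT (X k) measurable
  end.

(* The observed sets are indexed from 0: [X 0, ..., X (n - 1)] form the first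
   expedition and [X n, ..., X (n + m - 1)] the second. *)
Record poissonized_sampling (mu : probability (subsets S) R) (t t' : R) : Prop :=
  PoissonizedSampling {
    sample_law : forall (i : nat) (A : set (subsets S)),
      measurable A -> distribution P (X i) A = mu A ;
    first_size_law : forall k : nat,
      distribution P n [set k] = (poisson_pmf t k)%:E ;
    second_size_law : forall k : nat,
      distribution P m [set k] = (poisson_pmf t' k)%:E ;
    sampling_independent : mutually_independent P sampling_events
  }.

Definition occurrences (k l : nat) (w : Omega) (s : S) : nat :=
  (\sum_(k <= i < l) (`[< (X i w : set S) s >] : nat))%N.

Definition N1 (w : Omega) (s : S) : nat := occurrences 0 (n w) w s.
Definition N2 (w : Omega) (s : S) : nat := occurrences (n w) (n w + m w) w s.

(* [fset_set] and the finitely supported sum below are meaningful on the event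
   that only finitely many species are observed, which has probability one when
   [mu] is finitely supported. *)
Definition seen_first (w : Omega) : R :=
  (#|` fset_set [set s | (0 < N1 w s)%N] |)%:R.
Definition seen_total (w : Omega) : R :=
  (#|` fset_set [set s | (0 < N1 w s + N2 w s)%N] |)%:R.
Definition unseen (w : Omega) : R := seen_total w - seen_first w.

Definition linear_estimator (H : nat -> R) (w : Omega) : R :=
  \sum_(s \in [set: S]) H (N1 w s).

Definition sq_error (H : nat -> R) (w : Omega) : R :=
  `| linear_estimator H w - unseen w | ^+ 2.

End Expeditions.

(* The law of the sample is determined by [mu], [t] and [r], so ranging over
   all its realizations ranges over the laws [mu]. *)
Definition normalized_risk (R : realType) (B : nat) (r t : R) (H : nat -> R) :
    \bar R :=
  ereal_sup [set x : \bar R |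
    exists (S : countType) (mu : probability (subsets S) R)
      (d : measure_display) (Omega : measurableType d)
      (P : probability Omega R) (X : nat -> {RV P >-> subsets S})
      (n m : {RV P >-> nat}),
    [/\ finitely_supported mu, size_bounded mu B,
        poissonized_sampling X n m mu t (r * t) &
        x = ('E_P[sq_error X n m H] * ((r ^+ 2 * t ^+ 2)^-1)%:E)%E]].

Section Functional.
Variables (R : realType) (r t : R).

Definition egf (H : nat -> R) (x : R) : R :=
  \big[+%R/0]_(1 <= i <oo) (H i / i`!%:R * x ^+ i).

(* The values at zero are the continuous extensions. *)
Definition bias_fun (H : nat -> R) (p : R) : R :=
  if p == 0 then t * `| r - H 1%N |
  else expR (- (p * t)) / p * `| 1 - expR (- (r * p * t)) - egf H (p * t) |.

Definition var_fun (H : nat -> R) (q : R) : R :=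
  if q == 0 then t * (r + H 1%N ^+ 2)
  else expR (- (q * t)) / q *
       (1 - expR (- (r * q * t)) + egf (fun i => H i ^+ 2) (q * t)).

Definition Yb (H : nat -> R) : \bar R :=
  (ereal_sup [set (bias_fun H p)%:E | p in `[0%R, 1%R]] ^+ 2)%E.

Definition Yv (H : nat -> R) : \bar R :=
  ereal_sup [set (var_fun H q)%:E | q in `[0%R, 1%R]].

(* When the series converges, both functions above are continuous on [0, 1],
   so the suprema are maxima. *)
Definition G (H : nat -> R) : \bar R :=
  if (\sum_(1 <= i <oo) (H i ^+ 2 * t ^+ i / i`!%:R)%:E == +oo)%E then +oo%E
  else (Yb H + Yv H)%E.

(* [G] does not depend on [H 0]. *)
Definition is_minimizer (H : nat -> R) : Prop :=
  H 0%N = 0 /\ forall H' : nat -> R, (G H <= G H')%E.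

End Functional.

(* Main.v *)
Require Import Defs.
From mathcomp Require Import all_boot all_order all_algebra finmap.
From mathcomp Require Import all_classical all_reals all_analysis.
From mathcomp Require Import measurable_realfun ring lra.

Import Order.TTheory GRing.Theory Num.Theory.
Import numFieldNormedType.Exports.

Local Open Scope classical_set_scope.
Local Open Scope ring_scope.

(** The minimizer of [G] does at least as well as any explicit sequence, so the
    theorem splits into a bound of the risk by [G] and the construction of one
    sequence for which [G] is small.

    Risk.  Over the two expeditions the error is a sum, over the species, of a
    function of the two counts of that species.  As a sampled set has at most
    [B] elements, the inclusion probabilities of the species sum to at most
    [B], which bounds the mean of the error by [B] times the square root of
    [Yb].  For the variance, Poisson sampling is approximated by many
    independent steps, each of which draws a set with a small probability.
    One step changes at most [B] terms of the sum, so by Cauchy-Schwarz its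
    variance is at most a multiple of [B] of the variance that independent
    species would have ([lazy_var_step]); the total variance follows by
    conditioning step after step, and in the limit the counts of one species
    become Poisson variables ([poisop_var]).  Hence the second moment is at
    most [B ^+ 2 * Yb + 2 * B ^+ 2 * Yv].  This is shown for finitely many
    species and finitely many nonzero [H i], and extended by Fatou's lemma
    ([risk_le]).

    Explicit coefficients.  [1 - expR (- (r * y))] has the exponential
    coefficients [- (- r) ^+ k], whose squares are far too large.  They are
    damped by the normalized remainders of a series in powers of [- r^-1],
    which makes them grow like the square root of [k] ([Hopt_sqr_le]).  The
    terms of this series are built from the values at a point [c] of the
    Laguerre polynomials and of their derivatives.
    - The sum of the series is of order [expR (c / (1 + r))], by the generating
      function of the Laguerre polynomials ([psum_cvg]).
    - The terms are of order [expR (c / 2)] times [c] to the power [-3/4] and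
      the square root of the index, by an energy estimate for the differential
      equation of the Laguerre functions ([lag_diff_sqr_le]).
    - The bias solves a linear differential equation of order one, whose
      right-hand side comes from the exponential generating function of the
      Laguerre polynomials.  This is [expR y] times the Bessel function
      [J_0] at twice the square root of [c * y], so that oscillation keeps the
      solution of the order of [y / c] ([Hopt_bias_le]).

    Up to constants, [G / t ^+ 2] is then at most
    [expR (- (2 * c / (1 + r)))] times the sum of [c ^- 2] and of [expR c / t]
    times [c] to the power [-3/2], plus the smaller term [t^-1].  The first two
    terms are equal when [expR c] times the square root of [c] is [t], that is,
    for [c] close to [ln t - ln (ln t) / 2], and this choice gives the rate
    ([G_rate]). *)

(** * Derivatives and exponential generating functions *)

Lemma ler0_is_derive_le (R : realType) (f df : R -> R) (a b : R) : a <= b ->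
  (forall x, a <= x <= b -> is_derive x 1 f (df x)) ->
  (forall x, a < x < b -> df x <= 0) -> f b <= f a.
Proof.
move=> ab dfE df0; have [->//|ltab] := eqVneq a b.
have {}ltab : a < b by rewrite lt_neqAle ltab.
have [c /[!in_itv]/= cab fE] : exists2 c, c \in `]a, b[ & f b - f a = df c * (b - a).
  apply: MVT => //.
    by move=> x /[!in_itv]/= /andP[ax xb]; apply: dfE; rewrite !ltW.
  apply: derivable_within_continuous => x /[!in_itv]/= /dfE h.
  by have [] := h.
by rewrite -subr_le0 fE mulr_le0_ge0 ?df0// subr_ge0.
Qed.

Section EGF.
Context {R : realType}.
Implicit Types a : nat -> R.

Definition egsum a (y : R) : R := limn (pseries (fun k => a k / k`!%:R) y).

(** The class of sequences used with [egsum]: their exponential generating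
    functions are entire, and the class is closed under the operations that
    correspond to derivation, sum and multiplication by the variable. *)
Definition expbd a := exists M, exists rho, forall k, `|a k| <= M * rho ^+ k.

Lemma expbd_shift a : expbd a -> expbd (fun k => a k.+1).
Proof.
move=> [M [rho H]]; exists (M * rho), rho => k.
by rewrite -mulrA -exprS.
Qed.

Lemma egsum_cvg a y : expbd a -> cvgn (pseries (fun k => a k / k`!%:R) y).
Proof.
move=> [M [rho H]]; apply: normed_cvg.
apply: (@series_le_cvg _ _ (fun k => M * exp_coeff (rho * `|y|) k)) => [k|k|k|].
- exact: normr_ge0.
- rewrite /exp_coeff/= exprMn.
  have := le_trans (normr_ge0 _) (H k).
  rewrite mulrA mulrA => h; rewrite divr_ge0// mulr_ge0// exprn_ge0//.
- rewrite /exp_coeff/= !normrM normfV normr_nat exprMn normrX.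
  rewrite [leRHS](_ : _ = M * rho ^+ k / k`!%:R * `|y| ^+ k); last by rewrite !mulrA; ring.
  by rewrite ler_wpM2r ?exprn_ge0// ler_wpM2r.
- by apply: is_cvg_seriesZ; exact: is_cvg_series_exp_coeff.
Qed.

Lemma pseries_diffs_egf a :
  pseries_diffs (fun k => a k / k`!%:R) = (fun k => a k.+1 / k`!%:R).
Proof.
apply/funext => k; rewrite /pseries_diffs factS natrM invfM.
have : k.+1%:R != 0 :> R by rewrite pnatr_eq0.
have : k`!%:R != 0 :> R by rewrite pnatr_eq0 -lt0n fact_gt0.
by move=> h1 h2; field; rewrite h1 /= addrC natr1 h2.
Qed.

(** Derivation shifts the coefficients, which turns recurrences between the
    coefficients into differential equations. *)
Lemma is_derive_egsum a (y : R) : expbd a ->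
  is_derive y (1 : R) (egsum a) (egsum (fun k => a k.+1) y).
Proof.
move=> aM; rewrite /egsum -pseries_diffs_egf.
apply: (@pseries_snd_diffs _ _ (`|y| + 1)).
- exact: egsum_cvg.
- by rewrite pseries_diffs_egf; apply: egsum_cvg; exact: expbd_shift.
- have := expbd_shift _ (expbd_shift _ aM) => /egsum_cvg; rewrite pseries_diffs_egf (pseries_diffs_egf (fun k => a k.+1)); exact.
- by rewrite [ltRHS]ger0_norm ?addr_ge0// ltrDl.
Qed.

Lemma egsum0 a : egsum a 0 = a 0%N.
Proof.
rewrite /egsum; apply/cvg_lim => //; rewrite -(cvg_shiftn 1)/=.
rewrite (_ : (fun n => _) = cst (a 0%N)); first exact: cvg_cst.
apply/funext => n; rewrite /pseries/= addn1 /series/= big_nat_recl//= expr0 mulr1 fact0 divr1.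
by rewrite big1 ?addr0// => i _; rewrite expr0n mulr0.
Qed.

Lemma egsumD a b y : expbd a -> expbd b ->
  egsum (fun k => a k + b k) y = egsum a y + egsum b y.
Proof.
move=> /(egsum_cvg _ y) ha /(egsum_cvg _ y) hb; rewrite /egsum -limD//; congr (limn _).
apply/funext => n; rewrite /pseries /series/=.
by under eq_bigr do rewrite 2!mulrDl; rewrite big_split.
Qed.

Lemma egsumZ a c y : expbd a -> egsum (fun k => c * a k) y = c * egsum a y.
Proof.
move=> /(egsum_cvg _ y) ha; rewrite /egsum; apply/cvg_lim => //.
rewrite (_ : pseries _ _ = (fun n => c * pseries (fun k => a k / k`!%:R) y n)).
  exact: cvgMl_tmp.
apply/funext => n; rewrite /pseries /series/=.
by rewrite mulr_sumr; apply: eq_bigr => i _; rewrite !mulrA.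
Qed.

Lemma egsum_mulk a y : expbd a ->
  egsum (fun k => k%:R * a k.-1) y = y * egsum a y.
Proof.
move=> /(egsum_cvg _ y) ha; rewrite /egsum; apply/cvg_lim => //.
rewrite -(cvg_shiftn 1)/= (_ : (fun n => _) =
  (fun n => y * pseries (fun k => a k / k`!%:R) y n)); last first.
  apply/funext => n; rewrite /pseries addn1 /series/= big_nat_recl//= mul0r mul0r mul0r add0r.
  rewrite mulr_sumr; apply: eq_bigr => i _.
  have : i.+1%:R != 0 :> R by rewrite pnatr_eq0.
  have : i`!%:R != 0 :> R by rewrite pnatr_eq0 -lt0n fact_gt0.
  rewrite factS natrM exprS => h1 h2; field; rewrite h1 /= addrC natr1 h2//.
exact: cvgMl_tmp.
Qed.

Lemma expbdD a b : expbd a -> expbd b -> expbd (fun k => a k + b k).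
Proof.
move=> [M [r Ha]] [M' [r' Hb]]; exists (`|M| + `|M'|), (`|r| + `|r'|) => k.
rewrite (le_trans (ler_normD _ _))// mulrDl lerD//.
  rewrite (le_trans (Ha k))// (le_trans (ler_norm _))// normrM ler_wpM2l//.
  by rewrite normrX lerXn2r ?nnegrE ?addr_ge0// lerDl.
rewrite (le_trans (Hb k))// (le_trans (ler_norm _))// normrM ler_wpM2l//.
by rewrite normrX lerXn2r ?nnegrE ?addr_ge0// lerDr.
Qed.

Lemma expbdZ a c : expbd a -> expbd (fun k => c * a k).
Proof.
move=> [M [r Ha]]; exists (`|c| * M), r => k.
by rewrite normrM -mulrA ler_wpM2l.
Qed.

Lemma expbdMn a : expbd a -> expbd (fun k => k%:R * a k.-1).
Proof.
move=> [M [r Ha]]; exists (`|M|), (2 * (1 + `|r|)) => k.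
rewrite normrM normr_nat exprMn mulrCA ler_pM//.
  by rewrite -natrX ler_nat ltnW// ltn_expl.
rewrite (le_trans (Ha _))// (le_trans (ler_norm _))// normrM ler_wpM2l//.
rewrite normrX; case: k => [|k]/=; first by rewrite !expr0.
rewrite exprS (le_trans (_ : _ <= (1 + `|r|) ^+ k))//.
  by rewrite lerXn2r ?nnegrE ?addr_ge0// lerDr.
by rewrite ler_peMl ?exprn_ge0 ?addr_ge0// lerDl.
Qed.
End EGF.

(** * Rules of derivation for explicit expressions *)
Section DerivationRules.
Context {R : realType}.
Implicit Types (f g : R -> R) (x df dg : R).

Lemma is_derive_feq f x df dg : is_derive x (1 : R) f df -> df = dg ->
  is_derive x (1 : R) f dg.
Proof. by move=> ? <-. Qed.

Lemma is_derive_fD f g x df dg : is_derive x (1 : R) f df ->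
  is_derive x (1 : R) g dg -> is_derive x (1 : R) (fun y => f y + g y) (df + dg).
Proof. by move=> *; exact: is_deriveD. Qed.

Lemma is_derive_fN f x df : is_derive x (1 : R) f df ->
  is_derive x (1 : R) (fun y => - f y) (- df).
Proof. by move=> *; exact: is_deriveN. Qed.

Lemma is_derive_fM f g x df dg : is_derive x (1 : R) f df ->
  is_derive x (1 : R) g dg ->
  is_derive x (1 : R) (fun y => f y * g y) (f x * dg + g x * df).
Proof. by move=> *; exact: is_deriveM. Qed.

Lemma is_derive_fX f n x df : is_derive x (1 : R) f df ->
  is_derive x (1 : R) (fun y => f y ^+ n) (n%:R * f x ^+ n.-1 * df).
Proof.
move=> h; rewrite (_ : (fun y => _) = f ^+ n); first exact: is_deriveX.
by apply/funext => y; rewrite exprfctE.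
Qed.

Lemma is_derive_fexp f x df : is_derive x (1 : R) f df ->
  is_derive x (1 : R) (fun y => expR (f y)) (expR (f x) * df).
Proof.
by move=> h; exact: (is_derive1_comp (is_derive_expR (f x)) h).
Qed.

Lemma is_derive_fc (c : R) x : is_derive x (1 : R) (fun=> c) 0.
Proof. exact: is_derive_cst. Qed.

Lemma is_derive_fid x : is_derive x (1 : R) (fun y => y) 1.
Proof. exact: is_derive_id. Qed.

Lemma is_derive_mull (c : R) x : is_derive x (1 : R) ( *%R c) c.
Proof.
rewrite -[X in is_derive _ _ _ X]mulr1 -[X in is_derive _ _ _ X]addr0 -[0](mulr0 x).
exact: (is_derive_fM (fun=> c) id x 0 1 (is_derive_fc c x) (is_derive_fid x)).
Qed.
End DerivationRules.

(** Applies the rules above along the syntax of the function; the leaves are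
    derivatives found in the context. *)
Ltac derive_rules :=
  lazymatch goal with
  | |- is_derive _ _ (fun y => y) _ => exact: is_derive_fid
  | |- is_derive _ _ (GRing.mul ?c) _ => exact: (is_derive_mull c)
  | |- is_derive _ _ -%R _ => exact: is_deriveNid
  | |- is_derive _ _ (fun _ => ?c) _ => exact: is_derive_fc
  | |- is_derive _ _ (fun y => @?f y + @?g y) _ => notypeclasses refine (is_derive_fD _ _ _ _ _ _ _); derive_rules
  | |- is_derive _ _ (fun y => - @?f y) _ => notypeclasses refine (is_derive_fN _ _ _ _); derive_rules
  | |- is_derive _ _ (fun y => @?f y ^+ _) _ => notypeclasses refine (is_derive_fX _ _ _ _ _); derive_rules
  | |- is_derive _ _ (fun y => @?f y * @?g y) _ => notypeclasses refine (is_derive_fM _ _ _ _ _ _ _); derive_rules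
  | |- is_derive _ _ (fun y => expR (@?f y)) _ => notypeclasses refine (is_derive_fexp _ _ _ _); derive_rules
  | |- _ => try eassumption; try (by eauto)
  end.

(** Leaves the equation between the computed derivative and the expected one. *)
Ltac derive_tac :=
  notypeclasses refine (is_derive_feq _ _ _ _ _ _); [derive_rules|cbv beta].

(** * Laguerre polynomials *)
Section Laguerre.
Context {R : realType}.
Implicit Types (x y : R) (n k : nat).

(** The value and the first two derivatives of the Laguerre polynomial [L_n],
    computed together from [L_(n+1)' = L_n' - L_n] and
    [(n + 1) (L_(n+1) - L_n) = x L_(n+1)']. *)
Fixpoint lag_jet x n : R * R * R :=
  if n is k.+1 then
    let: (l, d, e) := lag_jet x k in (l + x * (d - l) / k.+1%:R, d - l, e - d)
  else (1, 0, 0).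

Definition lag n x := (lag_jet x n).1.1.
Definition dlag n x := (lag_jet x n).1.2.
Definition ddlag n x := (lag_jet x n).2.

Lemma lag0 x : lag 0 x = 1. Proof. by []. Qed.
Lemma dlag0 x : dlag 0 x = 0. Proof. by []. Qed.

Lemma dlagS n x : dlag n.+1 x = dlag n x - lag n x.
Proof. by rewrite /dlag /lag /=; case: (lag_jet x n) => [[]]. Qed.

Lemma ddlagS n x : ddlag n.+1 x = ddlag n x - dlag n x.
Proof. by rewrite /dlag /ddlag /=; case: (lag_jet x n) => [[]]. Qed.

Lemma lagS n x : lag n.+1 x = lag n x + x * dlag n.+1 x / n.+1%:R.
Proof. by rewrite /dlag /lag /=; case: (lag_jet x n) => [[]]. Qed.

Lemma x_dlagS n x : x * dlag n.+1 x = n.+1%:R * (lag n.+1 x - lag n x).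
Proof. by rewrite lagS addrC addKr mulrCA divff ?mulr1// pnatr_eq0. Qed.

Lemma x_dlag n x : x * dlag n x = n%:R * (lag n x - lag n.-1 x).
Proof. by case: n => [|n]; [rewrite dlag0 mulr0 mul0r|rewrite x_dlagS]. Qed.

Lemma lag_rec n x :
  n.+1%:R * lag n.+1 x = (2 * n%:R + 1 - x) * lag n x - n%:R * lag n.-1 x.
Proof.
have h1 := x_dlagS n x; have h2 := x_dlag n x; move: h1; rewrite dlagS mulrBr h2 -natr1 => h1.
by apply/eqP; rewrite -subr_eq0; apply/eqP; lra.
Qed.

Lemma lag_ode n x : x * ddlag n x + (1 - x) * dlag n x + n%:R * lag n x = 0.
Proof.
elim: n => [|n IH]; first by rewrite /ddlag /dlag /= !mulr0 mul0r !addr0.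
have := x_dlagS n x; rewrite mulrBr => /eqP; rewrite eq_sym subr_eq => /eqP ->.
rewrite ddlagS dlagS -natr1.
transitivity (x * ddlag n x + (1 - x) * dlag n x + n%:R * lag n x); last by [].
ring.
Qed.

(** By induction: the derivative of the recursive expression of [L_(n+1)] is
    the second component only by virtue of the differential equation. *)
Lemma is_derive_lag_dlag n x :
  is_derive x (1 : R) (lag n) (dlag n x) /\ is_derive x (1 : R) (dlag n) (ddlag n x).
Proof.
elim: n => [|n [IH1 IH2]].
  by split; [apply: (is_derive_fc 1)|apply: (is_derive_fc 0)].
have dS : is_derive x (1 : R) (dlag n.+1) (ddlag n.+1 x).
  rewrite (_ : dlag n.+1 = fun y => dlag n y - lag n y); last first.
    by apply/funext => y; exact: dlagS.
  by rewrite ddlagS; derive_rules.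
split=> //; rewrite (_ : lag n.+1 = fun y => lag n y + y * dlag n.+1 y / n.+1%:R); last first.
  by apply/funext => y; exact: lagS.
derive_tac.
have := lag_ode n.+1 x.
set D := ddlag n.+1 x; set d := dlag n.+1 x => /eqP.
rewrite -addrA addr_eq0 => /eqP E.
have -> : dlag n x = d + lag n x by rewrite /d dlagS subrK.
rewrite E lagS -/d.
have : n.+1%:R != 0 :> R by rewrite pnatr_eq0.
rewrite -natr1 => h; field; lra.
Qed.

Lemma is_derive_lag n x : is_derive x (1 : R) (lag n) (dlag n x).
Proof. by have [] := is_derive_lag_dlag n x. Qed.

Lemma is_derive_dlag n x : is_derive x (1 : R) (dlag n) (ddlag n x).
Proof. by have [] := is_derive_lag_dlag n x. Qed.

(** Crude bounds, sufficient for the convergence of exponential generating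
    functions and for the region [x <= 1 / (4 n + 2)]. *)
Lemma lag_dlag_le n x : 0 <= x ->
  `|lag n x| <= (1 + x) ^+ n /\ `|dlag n x| <= n%:R * (1 + x) ^+ n.
Proof.
move=> x0; elim: n => [|n [IH1 IH2]].
  by rewrite lag0 dlag0 normr1 normr0 mul0r.
have g0 : 0 <= (1 + x) ^+ n by rewrite exprn_ge0 ?addr_ge0.
have D : `|dlag n.+1 x| <= n.+1%:R * (1 + x) ^+ n.
  by rewrite dlagS (le_trans (ler_normB _ _))// -natr1 mulrDl mul1r lerD.
split; last first.
  by rewrite (le_trans D)// ler_wpM2l// exprS ler_peMl// lerDl.
rewrite lagS (le_trans (ler_normD _ _))// exprS mulrDl mul1r lerD//.
rewrite normrM normrM normfV normr_nat (ger0_norm x0) -mulrA ler_wpM2l//.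
by rewrite ler_pdivrMr ?ltr0n// mulrC.
Qed.
End Laguerre.

(** * Energy estimates for Laguerre functions *)
Section LaguerreEnergy.
Context {R : realType}.
Implicit Types (x y : R) (n k : nat).

(** The derivative of [expR (- x) * F x / Num.sqrt x] is a positive factor
    times the expression that is assumed to be nonpositive. *)
Lemma sqrt_weight_nincr (F dF : R -> R) a b : 0 < a -> a <= b ->
  (forall x, a <= x <= b -> is_derive x (1 : R) F (dF x)) ->
  (forall x, a < x < b -> x * (dF x - F x) - F x / 2 <= 0) ->
  expR (- b) * F b / Num.sqrt b <= expR (- a) * F a / Num.sqrt a.
Proof.
move=> a0 ab dFE dF0.
pose f := fun x : R => expR (- x) * F x * Num.sqrt x * x^-1.
have fE x : 0 < x -> expR (- x) * F x / Num.sqrt x = f x.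
  move=> x0; rewrite /f -!mulrA; congr (_ * (_ * _)).
  have s0 : Num.sqrt x != 0 by rewrite gt_eqF ?sqrtr_gt0.
  by apply: (mulfI s0); rewrite divff// mulrA -expr2 sqr_sqrtr ?ltW// divff ?gt_eqF.
rewrite !fE//; last exact: lt_le_trans ab.
pose df := fun x : R => expR (- x) * Num.sqrt x / x ^+ 2 * (x * (dF x - F x) - F x / 2).
apply: (@ler0_is_derive_le _ f df) => // x.
  move=> /andP[ax xb]; have x0 : 0 < x by exact: lt_le_trans ax.
  have h1 := is_derive1_sqrt x0; have h2 : is_derive x (1 : R) F (dF x) by apply: dFE; rewrite ax.
  have h3 : is_derive x (1 : R) (fun y => y^-1) (- x ^- 2).
    by apply: is_derive_eq; [apply: is_deriveV; rewrite gt_eqF|rewrite /GRing.scale/= mulr1].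
  rewrite /f; derive_tac; rewrite /df.
  have s0 : Num.sqrt x != 0 by rewrite gt_eqF ?sqrtr_gt0.
  have sE : x = Num.sqrt x ^+ 2 by rewrite sqr_sqrtr// ltW.
  set s := Num.sqrt x in sE s0 *.
  set e := expR _; rewrite [x in LHS]sE [x in RHS]sE.
  by field.
move=> /andP[ax xb]; have x0 : 0 < x by exact: lt_trans ax.
rewrite /df mulr_ge0_le0//; last by rewrite dF0// ax.
by rewrite divr_ge0 ?exprn_ge0 ?(ltW x0)// mulr_ge0 ?expR_ge0 ?sqrtr_ge0.
Qed.

(** In the variable [s] with [x = s ^ 2], the function
    [w = s ^ (1/2) exp(- s ^ 2 / 2) L_n(s ^ 2)] satisfies
    [w'' + (4 N - s ^ 2 + 1 / (4 s ^ 2)) w = 0] with [N = n + 1/2].  Here is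
    [w'], up to the factor [s ^ (- 1/2) exp(- s ^ 2 / 2) / 2]. *)
Definition lag_mom n x : R := lag n x + 4 * x * dlag n x - 2 * x * lag n x.

Lemma is_derive_lag_mom n x : is_derive x (1 : R) (lag_mom n)
  (dlag n x + 2 * x * dlag n x - 4 * (n%:R + 1/2) * lag n x).
Proof.
have h1 := is_derive_lag n x; have h2 := is_derive_dlag n x.
rewrite /lag_mom; derive_tac.
have := lag_ode n x => /eqP; rewrite -addrA addr_eq0 => /eqP E.
transitivity (5 * dlag n x + 4 * (x * ddlag n x) - 2 * lag n x - 2 * x * dlag n x); first ring.
by rewrite E; field.
Qed.

(** The energy [w' ^ 2 + (4 N - s ^ 2 + 1 / (4 s ^ 2)) w ^ 2], up to the weight
    [expR (- x) / Num.sqrt x]. *)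
Definition lag_energy n x : R :=
  lag_mom n x ^+ 2 / 4 + (4 * (n%:R + 1/2) * x - x ^+ 2 + 1/4) * lag n x ^+ 2.

(** The energy decreases since the potential [4 N - s ^ 2 + 1 / (4 s ^ 2)]
    does. *)
Lemma lag_energy_nincr n x y : 0 < x -> x <= y ->
  expR (- y) * lag_energy n y / Num.sqrt y <= expR (- x) * lag_energy n x / Num.sqrt x.
Proof.
move=> x0 xy.
(* [dF] is the derivative of the energy with the second derivative eliminated by the
   differential equation. *)
pose dF z := lag_mom n z / 2 *
    (dlag n z + 2 * z * dlag n z - 4 * (n%:R + 1/2) * lag n z) +
  (4 * (n%:R + 1/2) - 2 * z) * lag n z ^+ 2 +
  (4 * (n%:R + 1/2) * z - z ^+ 2 + 1/4) * (2 * lag n z * dlag n z).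
apply: (sqrt_weight_nincr (lag_energy n) dF) => // z _.
  have h1 := is_derive_lag n z; have h2 := is_derive_lag_mom n z.
  rewrite /lag_energy; derive_tac; rewrite /dF; by field.
rewrite (_ : _ - _ = - ((z ^+ 2 + 1/4) * lag n z ^+ 2)); last first.
  by rewrite /dF /lag_energy /lag_mom; field.
by rewrite oppr_le0 mulr_ge0 ?sqr_ge0// addr_ge0 ?sqr_ge0// divr_ge0.
Qed.

(** [w' ^ 2 + w ^ 2 / (4 s ^ 2)], up to the same weight.  It is below the energy
    as long as [x <= 4 N].  Beyond this point the potential loses its sign and
    the energy no longer controls [w]. *)
Definition lag_late_energy n x : R := lag_mom n x ^+ 2 / 4 + lag n x ^+ 2 / 4.

(** Beyond [4 n + 2] the values [L_0, ..., L_(n+1)] alternate in sign and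
    increase in absolute value, by induction on the three-term recurrence. *)
Lemma lag_alternate n x : 4 * n%:R + 2 <= x ->
  lag n x ^+ 2 <= - (lag n.+1 x * lag n x).
Proof.
elim: n => [|n IH] nx.
  rewrite lagS dlagS lag0 dlag0; lra.
have {}IH := IH (le_trans _ nx).
have {IH} : lag n x ^+ 2 <= - (lag n.+1 x * lag n x).
  by apply: IH; move: nx; rewrite -[n.+1%:R]natr1; lra.
have := lag_rec n.+1 x; rewrite /=.
move: (lag n x) (lag n.+1 x) (lag n.+2 x) => a b c E H.
have ab : - (b * a) <= b ^+ 2.
  rewrite -subr_ge0 (_ : _ - _ = (a + b) ^+ 2 + (- (b * a) - a ^+ 2)); last by ring.
  by rewrite addr_ge0 ?sqr_ge0// subr_ge0.
have n0 : 0 < n.+2%:R :> R by rewrite ltr0n.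
rewrite -(ler_pM2l n0) (_ : n.+2%:R * - (c * b) = - ((n.+2%:R * c) * b)); last by ring.
rewrite E.
have e1 : n.+1%:R = n%:R + 1 :> R by rewrite natr1.
have e2 : n.+2%:R = n%:R + 2 :> R by rewrite -addn2 natrD.
rewrite e2 ?e1 in nx E n0 *; have n0' : 0 <= n%:R :> R by [].
have : n%:R * (- (b * a)) <= n%:R * b ^+ 2 by rewrite ler_wpM2l.
have : (4 * (n%:R + 1) + 2) * b ^+ 2 <= x * b ^+ 2 by rewrite ler_wpM2r ?sqr_ge0.
nra.
Qed.

(** [w w' <= 0] beyond [x = 4 N]: there [w] decays, as
    [x L_n' = n (L_n - L_(n-1))], where [L_(n-1)] has the opposite sign and a
    smaller absolute value. *)
Lemma lag_mom_lag_le0 n x : 4 * n%:R + 2 <= x -> lag_mom n x * lag n x <= 0.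
Proof.
move=> nx; have xd := x_dlag n x.
have H : lag n x * (lag n x - lag n.-1 x) <= 2 * lag n x ^+ 2.
  case: n nx {xd} => [|n] nx /=; first by rewrite subrr mulr0 mulr_ge0 ?sqr_ge0.
  have : 4 * n%:R + 2 <= x by move: nx; rewrite -[n.+1%:R]natr1; lra.
  move=> /lag_alternate; move: (lag n x) (lag n.+1 x) => a b H.
  have ab : - (b * a) <= b ^+ 2.
    rewrite -subr_ge0 (_ : _ - _ = (a + b) ^+ 2 + (- (b * a) - a ^+ 2)); last by ring.
    by rewrite addr_ge0 ?sqr_ge0// subr_ge0.
  nra.
rewrite /lag_mom (_ : _ * _ = (1 - 2 * x) * lag n x ^+ 2 + 4 * (x * dlag n x) * lag n x); last by ring.
rewrite xd (_ : 4 * _ * _ = 4 * (n%:R * (lag n x * (lag n x - lag n.-1 x)))); last by ring.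
have : n%:R * (lag n x * (lag n x - lag n.-1 x)) <= n%:R * (2 * lag n x ^+ 2) by rewrite ler_wpM2l.
have : (4 * n%:R + 2) * lag n x ^+ 2 <= x * lag n x ^+ 2 by rewrite ler_wpM2r ?sqr_ge0.
have := sqr_ge0 (lag n x).
nra.
Qed.

(** The derivative in [s] is [2 w w'] times a nonnegative factor, up to a
    nonpositive term. *)
Lemma lag_late_energy_nincr n x y : 4 * n%:R + 2 <= x -> x <= y ->
  expR (- y) * lag_late_energy n y / Num.sqrt y <= expR (- x) * lag_late_energy n x / Num.sqrt x.
Proof.
move=> nx xy.
have n0 : 0 <= n%:R :> R by [].
pose dF z := lag_mom n z / 2 *
    (dlag n z + 2 * z * dlag n z - 4 * (n%:R + 1/2) * lag n z) +
  lag n z * dlag n z / 2.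
apply: (sqrt_weight_nincr (lag_late_energy n) dF) => // [|z _|z /andP[xz zy]].
- lra.
- have h1 := is_derive_lag n z; have h2 := is_derive_lag_mom n z.
  rewrite /lag_late_energy; derive_tac; rewrite /dF; by field.
- have -> : z * (dF z - lag_late_energy n z) - lag_late_energy n z / 2 =
    z * (z - (4 * n%:R + 2)) / 2 * (lag_mom n z * lag n z) - lag n z ^+ 2 / 4.
    by rewrite /dF /lag_late_energy /lag_mom; field.
  have : lag_mom n z * lag n z <= 0 by apply: lag_mom_lag_le0; rewrite (le_trans nx)// ltW.
  have := sqr_ge0 (lag n z).
  have : 0 <= z * (z - (4 * n%:R + 2)) / 2.
    by rewrite divr_ge0// mulr_ge0//; lra.
  nra.
Qed.

(** Up to [1 / (4 N)] the polynomial has not left a neighbourhood of its value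
    1 at zero. *)
Lemma lag_near0 n x : 0 <= x -> x * (4 * (n%:R + 1/2)) <= 1 ->
  `|lag n x| <= 2 /\ `|dlag n x| <= 2 * n%:R.
Proof.
move=> x0 xn; have n0 : 0 <= n%:R :> R by [].
have nx : n%:R * x <= 1/4 by nra.
have [] := lag_dlag_le n x x0.
have : (1 + x) ^+ n <= 4/3.
  rewrite (@le_trans _ _ (expR (x * n%:R)))//.
    by rewrite expRM_natr lerXn2r ?nnegrE ?expR_ge0 ?expR_ge1Dx//; lra.
  rewrite -[X in expR X]opprK expRN (_ : 4/3 = (3/4)^-1); last by field.
  rewrite lef_pV2 ?posrE ?expR_gt0//.
  by rewrite (le_trans _ (expR_ge1Dx _))//; lra.
have : 0 <= (1 + x) ^+ n by rewrite exprn_ge0//; lra.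
move: ((1 + x) ^+ n) => g g0 g1 lg dg; split; first by lra.
by nra.
Qed.

(** The energy is bounded from this starting point on: without its weight
    it is at most [6 ^ 2 / 4 + (5 / 4) 2 ^ 2 = 14] there, and [1 / Num.sqrt x] is
    [2 * Num.sqrt N]. *)
Lemma lag_energy_start n x : x = (4 * (n%:R + 1/2))^-1 ->
  expR (- x) * lag_energy n x / Num.sqrt x <= 28 * Num.sqrt (n%:R + 1/2).
Proof.
move=> xE; have n0 : 0 <= n%:R :> R by [].
have x0 : 0 < x by rewrite xE invr_gt0; lra.
have xN : x * (4 * (n%:R + 1/2)) = 1 by rewrite xE mulVf//; lra.
have nx : n%:R * x <= 1/4.
  have : 0 <= x by lra.
  nra.
have x2 : x <= 1/2 by nra.
have [|l2 d2] := lag_near0 n x (ltW x0); first by rewrite xN.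
have q6 : `|lag_mom n x| <= 6.
  rewrite /lag_mom (le_trans (ler_normB _ _))// (le_trans (lerD (ler_normD _ _) (lexx _)))//.
  rewrite !normrM !(ger0_norm (ltW x0)) !normr_nat.
  have : x * `|dlag n x| <= x * (2 * n%:R) by rewrite ler_wpM2l// ltW.
  have : x * `|lag n x| <= x * 2 by rewrite ler_wpM2l// ltW.
  nra.
have E14 : lag_energy n x <= 14.
  rewrite /lag_energy (_ : _ - _ + _ = 5/4 - x ^+ 2); last first.
    have := xN; nra.
  have : lag_mom n x ^+ 2 <= 36.
    by rewrite -real_normK ?num_real// (_ : 36 = 6 ^+ 2) ?lerXn2r ?nnegrE//; lra.
  have : lag n x ^+ 2 <= 4.
    by rewrite -real_normK ?num_real// (_ : 4 = 2 ^+ 2) ?lerXn2r ?nnegrE//; lra.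
  have := sqr_ge0 (lag n x); have := sqr_ge0 x; nra.
have sx : (Num.sqrt x)^-1 = 2 * Num.sqrt (n%:R + 1/2).
  rewrite xE sqrtrV; last by lra.
  rewrite invrK (_ : 4 = 2 ^+ 2); last by ring.
  by rewrite sqrtrM ?exprn_ge0// sqrtr_sqr normr_nat.
rewrite sx (_ : 28 * _ = 14 * (2 * Num.sqrt (n%:R + 1/2))); last by ring.
rewrite ler_wpM2r ?mulr_ge0 ?sqrtr_ge0//.
have e1 : expR (- x) <= 1 by rewrite expR_le1; lra.
have := expR_ge0 (- x); nra.
Qed.

(** From [1 / (4 N)] to [4 N] by the first energy, and by the second one
    afterwards. *)
Lemma lag_late_energy_le n x : (4 * (n%:R + 1/2))^-1 <= x ->
  expR (- x) * lag_late_energy n x / Num.sqrt x <= 28 * Num.sqrt (n%:R + 1/2).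
Proof.
move=> xx; have n0 : 0 <= n%:R :> R by [].
have x0 : 0 < (4 * (n%:R + 1/2))^-1 :> R by rewrite invr_gt0; lra.
have E'E z : 0 < z -> z <= 4 * n%:R + 2 -> expR (- z) * lag_late_energy n z / Num.sqrt z <=
    expR (- z) * lag_energy n z / Num.sqrt z.
  move=> z0 zn; rewrite ler_wpM2r ?invr_ge0 ?sqrtr_ge0// ler_wpM2l ?expR_ge0//.
  rewrite /lag_late_energy /lag_energy lerD2l mulrC ler_wpM2r ?sqr_ge0//; nra.
have [xn|/ltW nx] := leP x (4 * n%:R + 2).
  rewrite (le_trans (E'E _ _ _))// ?(lt_le_trans x0)//.
  exact: le_trans (lag_energy_nincr _ _ _ x0 xx) (lag_energy_start n _ erefl).
rewrite (le_trans (lag_late_energy_nincr _ _ _ _ nx))//.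
rewrite (le_trans (E'E _ _ _))//.
apply: le_trans (lag_energy_nincr _ _ _ x0 _) (lag_energy_start n _ erefl).
rewrite (@le_trans _ _ 1)//; last by lra.
by rewrite invf_le1; lra.
Qed.

Lemma lag_sqr_le n x : (4 * (n%:R + 1/2))^-1 <= x ->
  lag_mom n x ^+ 2 + lag n x ^+ 2 <=
    112 * expR x * Num.sqrt x * Num.sqrt (n%:R + 1/2).
Proof.
move=> xx; have n0 : 0 <= n%:R :> R by [].
have x0 : 0 < x by apply: lt_le_trans xx; rewrite invr_gt0; lra.
have := lag_late_energy_le _ _ xx; rewrite ler_pdivrMr ?sqrtr_gt0//.
rewrite expRN mulrC ler_pdivrMr ?expR_gt0// /lag_late_energy.
lra.
Qed.

(** [2 x (L_n - 2 L_n')] is the difference of [L_n] and [lag_mom n], and both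
    are of the size given by the energy.  Compared with this size, the
    combination [L_n - 2 L_n'] gains a whole power of [x]. *)
Lemma lag_diff_sqr_le n x : (4 * (n%:R + 1/2))^-1 <= x ->
  (lag n x - 2 * dlag n x) ^+ 2 <=
    56 * expR x * Num.sqrt x / x ^+ 2 * Num.sqrt (n%:R + 1/2).
Proof.
move=> xx; have n0 : 0 <= n%:R :> R by [].
have x0 : 0 < x by apply: lt_le_trans xx; rewrite invr_gt0; lra.
rewrite [leRHS]mulrAC ler_pdivlMr ?exprn_gt0//.
have := lag_sqr_le _ _ xx.
have -> : (lag n x - 2 * dlag n x) ^+ 2 * x ^+ 2 = (lag_mom n x - lag n x) ^+ 2 / 4.
  by rewrite /lag_mom; field.
move: (lag_mom n x) (lag n x) => a b; have := sqr_ge0 (a + b).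
rewrite [56 * _ * _ * _](_ : _ = 112 * expR x * Num.sqrt x * Num.sqrt (n%:R + 1/2) / 2); last by field.
nra.
Qed.
End LaguerreEnergy.

(** * The generating function of the Laguerre polynomials *)
Section GeneratingFunction.
Context {R : realType}.
Implicit Types (x y c r z : R) (n k : nat).

Lemma lag_at0 n : lag n (0 : R) = 1.
Proof. by elim: n => [//|n IH]; rewrite lagS IH mul0r mul0r addr0. Qed.

(** Summation by parts, since [L_(n+1)' = L_n' - L_n]. *)
Lemma sum_dlag z n x : (1 - z) * (\sum_(k < n) z ^+ k * dlag k x) =
  - z * (\sum_(k < n) z ^+ k * lag k x) - z ^+ n * dlag n x.
Proof.
elim: n => [|n IH]; first by rewrite !big_ord0 dlag0 !mulr0 subr0.
by rewrite !big_ord_recr /= mulrDr IH dlagS exprS; ring.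
Qed.

(** Polynomial growth in [n], uniformly for [x] between 0 and [c]: the energy
    bounds [L_n] and [L_n - 2 L_n'] outside a neighbourhood of zero. *)
Lemma dlag_sqr_le n c x : 0 <= x <= c ->
  dlag n x ^+ 2 <= 448 * expR c * (1 + c) * (n%:R + 1) ^+ 2.
Proof.
move=> /andP[x0 xc]; have n0 : 0 <= n%:R :> R by [].
have c0 : 0 <= c := le_trans x0 xc.
have ec : 1 <= expR c by rewrite -expR0 ler_expR.
have a0 : 0 < 4 * (n%:R + 1/2) :> R by lra.
have [xs|xs] := leP x (4 * (n%:R + 1/2))^-1.
  have [//||_ d2] := lag_near0 n x.
    by rewrite (le_trans (ler_wpM2r (ltW a0) xs))// mulVf// gt_eqF.
  have : dlag n x ^+ 2 <= (2 * n%:R) ^+ 2.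
    by rewrite -real_normK ?num_real// lerXn2r ?nnegrE// mulr_ge0.
  move=> /le_trans; apply; rewrite exprMn.
  have h : 4 <= 448 * expR c * (1 + c) by nra.
  apply: ler_pM; rewrite ?exprn_ge0//; first by rewrite (le_trans _ h)//; lra.
  by rewrite lerXn2r ?nnegrE//; lra.
have x1 : 0 < x by apply: lt_trans xs; rewrite invr_gt0; lra.
have xN : 1/4 <= x * (n%:R + 1/2).
  by have := ler_wpM2r (ltW a0) (ltW xs); rewrite mulVf ?gt_eqF//; lra.
have s2 : Num.sqrt x * Num.sqrt (n%:R + 1/2) <= 2 * (x * (n%:R + 1/2)).
  rewrite -sqrtrM ?(ltW x1)// -[leRHS]ger0_norm; last by lra.
  rewrite -sqrtr_sqr ler_sqrt; last by rewrite sqr_ge0.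
  by nra.
have h1 := lag_sqr_le n x (ltW xs); have h2 := lag_diff_sqr_le n x (ltW xs).
have exc : expR x <= expR c by rewrite ler_expR.
set N := n%:R + 1 / 2 in xN s2 h1 h2 *; set S := Num.sqrt x * _ in s2 *.
have S0 : 0 <= S by rewrite mulr_ge0 ?sqrtr_ge0.
have l2 : lag n x ^+ 2 <= 448 * expR c * c * (n%:R + 1) ^+ 2.
  have : lag n x ^+ 2 <= 112 * expR x * S.
    by rewrite /S mulrA (le_trans _ h1)// lerDr sqr_ge0.
  move=> /le_trans; apply.
  have h : expR x * S <= expR c * (2 * (c * N)).
    rewrite ler_pM ?expR_ge0// (le_trans s2)// ler_wpM2l// ler_wpM2r// /N; lra.
  have h3 : expR c * (c * N) <= expR c * (c * (n%:R + 1) ^+ 2).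
    by rewrite ler_wpM2l ?expR_ge0// ler_wpM2l// /N; nra.
  have h4 : 0 <= expR c * (c * N).
    by rewrite mulr_ge0 ?expR_ge0// mulr_ge0// /N; lra.
  by lra.
have d2 : (lag n x - 2 * dlag n x) ^+ 2 <= 448 * expR c * (n%:R + 1) ^+ 2.
  apply: (le_trans h2).
  rewrite -(mulrA _ (x ^- 2)) (mulrC (x ^- 2)) mulrA -[X in X / _]mulrA -/S.
  rewrite ler_pdivrMr ?exprn_gt0//.
  have : expR x * S <= expR c * (2 * (x * N)) by rewrite ler_pM ?expR_ge0.
  have h3 : x * N <= 4 * (x * N) ^+ 2 by nra.
  have h4 : (x * N) ^+ 2 <= (x * (n%:R + 1)) ^+ 2.
    by rewrite lerXn2r ?nnegrE ?mulr_ge0// ?ler_wpM2l// /N; lra.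
  have h5 : expR c * (x * N) <= expR c * (4 * (x * (n%:R + 1)) ^+ 2).
    by rewrite ler_wpM2l ?expR_ge0//; lra.
  lra.
have : dlag n x ^+ 2 <= (lag n x ^+ 2 + (lag n x - 2 * dlag n x) ^+ 2) / 2.
  have := sqr_ge0 (lag n x - dlag n x); lra.
have : 0 <= expR c * (1 + c) * (n%:R + 1) ^+ 2.
  by rewrite mulr_ge0 ?sqr_ge0// mulr_ge0 ?expR_ge0//; lra.
lra.
Qed.

(** A form that is convenient for series in powers of [- r^-1]: the ratio
    [(1 + r) / 2] is less than [r]. *)
Lemma dlag_geom_le r c : 1 < r -> exists C, forall n x, 0 <= x <= c ->
  `|dlag n x| <= C * ((1 + r) / 2) ^+ n.
Proof.
move=> r1; exists (Num.sqrt (448 * expR c * (1 + c)) * (2 / (r - 1) + 1)) => n x xc.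
have c0 : 0 <= c by have /andP[? ?] := xc; lra.
have n0 : 0 <= n%:R :> R by [].
have bern : 1 + n%:R * ((r - 1) / 2) <= ((1 + r) / 2) ^+ n.
  have -> : (1 + r) / 2 = 1 + (r - 1) / 2 by field.
  elim: n {n0} => [|n IH]; first by rewrite mul0r addr0 expr0.
  rewrite exprS -natr1; have : 0 <= n%:R * ((r - 1) / 2 * ((r - 1) / 2)) by rewrite mulr_ge0// mulr_ge0//; lra.
  nra.
have nb : n%:R + 1 <= (2 / (r - 1) + 1) * ((1 + r) / 2) ^+ n.
  apply: le_trans (ler_wpM2l _ bern); last by rewrite addr_ge0// divr_ge0//; lra.
  rewrite mulrDl mul1r mulrDr mulr1 (_ : _ * (n%:R * _) = n%:R); last first.
    by field; rewrite subr_eq0 gt_eqF.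
  have : 0 <= 2 / (r - 1) by rewrite divr_ge0//; lra.
  have : 0 <= n%:R * ((r - 1) / 2) by rewrite mulr_ge0//; lra.
  lra.
rewrite -[leRHS]mulrA; apply: le_trans (ler_wpM2l (sqrtr_ge0 _) nb).
rewrite -[X in _ * X]ger0_norm; last by lra.
rewrite -!sqrtr_sqr -sqrtrM; last by rewrite !mulr_ge0 ?expR_ge0//; lra.
by rewrite ler_wsqrtr// dlag_sqr_le.
Qed.

Lemma is_derive_sum_lag z n x : is_derive x (1 : R)
  (fun y => \sum_(k < n) z ^+ k * lag k y) (\sum_(k < n) z ^+ k * dlag k x).
Proof.
elim: n => [|n IH].
  rewrite big_ord0 (_ : (fun y => _) = fun=> 0); first exact: is_derive_fc.
  by apply/funext => y; rewrite big_ord0.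
rewrite big_ord_recr /= (_ : (fun y => _) =
  fun y => \sum_(k < n) z ^+ k * lag k y + z ^+ n * lag n y); last first.
  by apply/funext => y; rewrite big_ord_recr.
have h := is_derive_lag n x.
notypeclasses refine (is_derive_feq _ _ _ _ _ _).
  by notypeclasses refine (is_derive_fD _ _ _ _ _ IH _); derive_rules.
by rewrite mulr0 addr0.
Qed.

(** By summation by parts, the partial sums [S_n] satisfy
    [S_n' = S_n / (1 + r)] up to a term that tends to zero geometrically, and
    at zero they are those of a geometric series. *)
Lemma sum_lag_cvg r c : 0 <= c -> 1 < r ->
  \sum_(k < n) (- r^-1) ^+ k * lag k c @[n --> \oo] -->
    expR (c / (1 + r)) * (r / (1 + r)).
Proof.
move=> c0 r1; pose z := - r^-1; have r0 : 0 < r by lra.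
have [C HC] := dlag_geom_le r c r1.
pose S n y := \sum_(k < n) z ^+ k * lag k y.
pose f n y := expR (- (1 + r)^-1 * y) * S n y.
have fc n : `|f n c - f n 0| <= c * C * ((1 + r) / (2 * r)) ^+ n.
  pose df y := expR (- (1 + r)^-1 * y) *
    (\sum_(k < n) z ^+ k * dlag k y - (1 + r)^-1 * S n y).
  have [||x /[!in_itv]/= xc ->] := @MVT_segment R (f n) df 0 c c0.
  - move=> x _; have h := is_derive_sum_lag z n x; rewrite -/(S n) in h.
    by rewrite /f; derive_tac; rewrite /df; ring.
  - apply: derivable_within_continuous => x _.
    have h := is_derive_sum_lag z n x; rewrite -/(S n) in h.
    have : is_derive x (1 : R) (f n) (df x) by rewrite /f; derive_tac; rewrite /df; ring.
    by case.
  have -> : df x = - (expR (- (1 + r)^-1 * x) * (r / (1 + r)) * z ^+ n * dlag n x).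
    have := sum_dlag z n x; rewrite -/(S n x).
    move=> /(congr1 (fun u => u * (r / (1 + r)))).
    rewrite mulrAC (_ : (1 - z) * _ = 1); last by rewrite /z; field; lra.
    rewrite mul1r /df => ->; rewrite /z; field; lra.
  have /andP[x0 _] := xc.
  rewrite subr0 normrM normrN (ger0_norm c0) mulrC -[leRHS]mulrA ler_wpM2l//.
  rewrite normrM normrM normrX normrN normfV (ger0_norm (ltW r0)).
  rewrite ger0_norm; last by rewrite mulr_ge0 ?expR_ge0// divr_ge0//; lra.
  have k0 : 0 <= r / (1 + r) by rewrite divr_ge0//; lra.
  have k1 : r / (1 + r) <= 1 by rewrite ler_pdivrMr; lra.
  have e1 : expR (- (1 + r)^-1 * x) <= 1.
    by rewrite expR_le1 mulNr oppr_le0 mulr_ge0// invr_ge0; lra.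
  have ek1 : expR (- (1 + r)^-1 * x) * (r / (1 + r)) <= 1.
    by rewrite -[leRHS]mul1r ler_pM ?expR_ge0.
  have v0 : 0 <= r^-1 ^+ n by rewrite exprn_ge0// invr_ge0 ltW.
  have -> : (1 + r) / (2 * r) = r^-1 * ((1 + r) / 2) by field; lra.
  rewrite -[_ * r^-1 ^+ n * _]mulrA -[leRHS]mul1r ler_pM//.
  - by rewrite mulr_ge0 ?expR_ge0.
  - by rewrite mulr_ge0.
  - by rewrite exprMn mulrCA ler_wpM2l ?HC.
have f0 : f n 0 @[n --> \oo] --> (r / (1 + r)).
  have -> : (fun n => f n 0) = series (geometric 1 z).
    apply/funext => n; rewrite /f mulr0 expR0 mul1r /S /series/= big_mkord.
    by apply: eq_bigr => k _; rewrite lag_at0 mulr1 mul1r.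
  rewrite (_ : r / (1 + r) = 1 / (1 - z)); last by rewrite /z; field; lra.
  apply: cvg_geometric_series.
  by rewrite /z normrN normfV gtr0_norm// invf_lt1.
have fd : f n c - f n 0 @[n --> \oo] --> 0.
  apply: norm_cvg0; apply: (squeeze_cvgr _ (cvg_cst 0)); last first.
    apply: (@cvg_geometric _ (c * C) ((1 + r) / (2 * r))).
    by rewrite ger0_norm ?divr_ge0 ?ltr_pdivrMr//; lra.
  by apply: nearW => n; rewrite normr_ge0/= fc.
have {f0 fd} fcvg : f n c @[n --> \oo] --> (r / (1 + r)).
  have -> : (fun n => f n c) = (fun n => (f n c - f n 0) + f n 0).
    by apply/funext => n; rewrite subrK.
  by rewrite -[X in _ --> X]add0r; exact: cvgD fd f0.
have -> : (fun n => \sum_(k < n) (- r^-1) ^+ k * lag k c) =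
    (fun n => expR (c / (1 + r)) * f n c).
  apply/funext => n; rewrite /f mulrA -expRD mulNr (mulrC c) subrr.
  by rewrite expR0 mul1r.
exact: cvgMl_tmp.
Qed.
End GeneratingFunction.

(** * The explicit coefficients *)
Section Coefficients.
Context {R : realType}.
Variables (r c : R).
Hypotheses (hr : 1 < r) (hc : 1 <= c).

(** [L_n - 2 L_n'] is chosen since it is smaller than [L_n] by a power of [c],
    while its generating function is the one of [L_n] times
    [(1 + z) / (1 - z)], a constant factor at [z = - r^-1]. *)
Definition lagb n : R := lag n c - 2 * dlag n c.
Definition psum n : R := \sum_(k < n) (- r^-1) ^+ k * lagb k.
Definition plim : R := expR (c / (1 + r)) * ((r - 1) * r / (1 + r) ^+ 2).

Lemma psum_cvg : psum n @[n --> \oo] --> plim.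
Proof.
have r1 := hr; have c1 := hc.
have c0 : 0 <= c by lra.
have r0 : 0 < r by lra.
have [C HC] := dlag_geom_le r c r1.
pose S n := \sum_(k < n) (- r^-1) ^+ k * lag k c.
pose e n := (- r^-1) ^+ n * dlag n c.
have psumE n : psum n = (r - 1) / (1 + r) * S n + 2 * r / (1 + r) * e n.
  have := sum_dlag (- r^-1) n c; rewrite -/(S n) -/(e n).
  have -> : psum n = S n - 2 * (\sum_(k < n) (- r^-1) ^+ k * dlag k c).
    rewrite /psum /S mulr_sumr -sumrB; apply: eq_bigr => k _.
    by rewrite /lagb mulrBr mulrCA.
  move=> /(congr1 (fun u => u * (r / (1 + r)))).
  rewrite mulrAC (_ : (1 - - r^-1) * _ = 1); last by field; lra.
  by rewrite mul1r => ->; field; lra.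
have e0 : e n @[n --> \oo] --> 0.
  apply: norm_cvg0; apply: (squeeze_cvgr _ (cvg_cst 0)); last first.
    apply: (@cvg_geometric _ C ((1 + r) / (2 * r))).
    by rewrite ger0_norm ?divr_ge0 ?ltr_pdivrMr//; lra.
  apply: nearW => n; rewrite normr_ge0/= /e normrM normrX normrN normfV (ger0_norm (ltW r0)).
  rewrite /geometric/= (_ : (1 + r) / (2 * r) = r^-1 * ((1 + r) / 2)); last by field; lra.
  by rewrite exprMn mulrCA ler_wpM2l ?exprn_ge0 ?invr_ge0 ?(ltW r0)// HC// lexx c0.
have -> : psum = (fun n => (r - 1) / (1 + r) * S n + 2 * r / (1 + r) * e n).
  exact/funext.
have -> : plim = (r - 1) / (1 + r) * (expR (c / (1 + r)) * (r / (1 + r))) + 2 * r / (1 + r) * 0.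
  by rewrite /plim; field; lra.
apply: cvgD; apply: cvgMl_tmp => //.
exact: sum_lag_cvg.
Qed.

Lemma plim_gt0 : 0 < plim.
Proof.
have r1 := hr.
by rewrite /plim mulr_gt0 ?expR_gt0// divr_gt0 ?exprn_gt0 ?mulr_gt0//; lra.
Qed.

Definition lagb_amp : R := Num.sqrt (56 * expR c * Num.sqrt c / c ^+ 2).

Lemma lagb_le n : `|lagb n| <= lagb_amp * Num.sqrt n.+1%:R.
Proof.
have c1 := hc.
have n0 : 0 <= n%:R :> R by [].
have c0 : 0 < c by lra.
have A0 : 0 <= 56 * expR c * Num.sqrt c / c ^+ 2.
  by rewrite divr_ge0 ?sqr_ge0// mulr_ge0 ?sqrtr_ge0// mulr_ge0 ?expR_ge0.
rewrite -sqrtr_sqr /lagb_amp -sqrtrM// ler_wsqrtr// (le_trans (lag_diff_sqr_le n c _))//.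
  by rewrite (le_trans _ c1)// invf_le1; lra.
rewrite ler_wpM2l// -[n.+1%:R]natr1 -[leRHS]ger0_norm; last by lra.
by rewrite -sqrtr_sqr ler_wsqrtr//; nra.
Qed.

Definition geo2 : R := (r / (r - 1)) ^+ 2.

(** The tail is compared with the series of [(1 + i) r ^ (- i)], whose sum is
    [(r / (r - 1)) ^ 2]; subtracting its remainder makes the induction on the
    number of terms work. *)
Lemma psum_tail_le j M : `|psum (j + M)%N - psum j| <=
  lagb_amp * Num.sqrt j.+1%:R * r^-1 ^+ j *
    (geo2 - r^-1 ^+ M * (r / (r - 1) * M%:R + geo2)).
Proof.
have r1 := hr; have c1 := hc.
have r0 : 0 < r by lra.
elim: M => [|M IH].
  by rewrite addn0 subrr normr0 expr0 mulr0 add0r mul1r subrr mulr0.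
rewrite addnS {1}/psum big_ord_recr/= -/(psum _) addrAC (le_trans (ler_normD _ _))//.
have v0 k : 0 <= r^-1 ^+ k by rewrite exprn_ge0// invr_ge0 ltW.
have a0 : 0 <= lagb_amp by exact: sqrtr_ge0.
have T : `|(- r^-1) ^+ (j + M) * lagb (j + M)| <=
    lagb_amp * Num.sqrt j.+1%:R * r^-1 ^+ j * (r^-1 ^+ M * (1 + M%:R)).
  rewrite normrM normrX normrN normfV (ger0_norm (ltW r0)) exprD.
  have h : Num.sqrt (j + M).+1%:R <= Num.sqrt j.+1%:R * (1 + M%:R) :> R.
    rewrite -[X in _ * X]ger0_norm ?addr_ge0// -sqrtr_sqr -sqrtrM// ler_wsqrtr//.
    rewrite -addSn natrD; have : 1 <= j.+1%:R :> R by rewrite ler1n.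
    have : 0 <= M%:R :> R by []. nra.
  rewrite [leRHS](_ : _ = r^-1 ^+ j * r^-1 ^+ M * (lagb_amp * (Num.sqrt j.+1%:R * (1 + M%:R)))); last by ring.
  by rewrite ler_wpM2l ?mulr_ge0// (le_trans (lagb_le _))// ler_wpM2l.
rewrite (le_trans (lerD IH T))// -mulrDr.
rewrite le_eqVlt; apply/orP; left; apply/eqP; congr (_ * _).
rewrite exprS -natr1 /geo2; field; lra.
Qed.

Lemma psum_dist_le j :
  `|plim - psum j| <= lagb_amp * Num.sqrt j.+1%:R * r^-1 ^+ j * geo2.
Proof.
have r1 := hr; have c1 := hc.
have r0 : 0 < r by lra.
have h : `|psum (j + M)%N - psum j| @[M --> \oo] --> `|plim - psum j|.
  apply: cvg_norm; apply: cvgB; last exact: cvg_cst.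
  have := psum_cvg; rewrite -(cvg_shiftn j).
  by rewrite (_ : (fun n => psum (n + j)%N) = fun M => psum (j + M)%N)//; apply/funext => n; rewrite addnC.
rewrite -(cvg_lim _ h)//; apply: limr_le; first by apply/cvg_ex; exists `|plim - psum j|.
apply: nearW => M; rewrite (le_trans (psum_tail_le j M))// ler_wpM2l//.
  by rewrite mulr_ge0 ?mulr_ge0 ?sqrtr_ge0// exprn_ge0// invr_ge0 ltW.
rewrite gerBl mulr_ge0 ?exprn_ge0 ?invr_ge0 ?(ltW r0)// addr_ge0 ?sqr_ge0// mulr_ge0//.
by rewrite divr_ge0//; lra.
Qed.

(** The exponential coefficients of [1 - expR (- (r * y))], damped by factors
    that start at 1, so that there is no bias at first order in [y], and that
    decay like [r ^ (- k)] times the size of [lagb]. *)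
Definition Hopt (k : nat) : R :=
  if k is j.+1 then - (- r) ^+ k * (plim - psum j) / plim else 0.

Definition Hamp : R := r * lagb_amp * geo2 / plim.

Lemma Hopt_sqr_le k : Hopt k ^+ 2 <= Hamp ^+ 2 * k%:R.
Proof.
have r1 := hr; have c1 := hc.
have r0 : 0 < r by lra.
have p0 := plim_gt0.
case: k => [|j]; first by rewrite /Hopt expr0n mulr0.
rewrite -[k in _ * k]sqr_sqrtr// -exprMn -[leLHS]real_normK ?num_real//.
have g0 : 0 <= geo2 by rewrite sqr_ge0.
have a0 : 0 <= lagb_amp by exact: sqrtr_ge0.
rewrite lerXn2r ?nnegrE//.
  rewrite mulr_ge0 ?sqrtr_ge0// /Hamp divr_ge0 ?(ltW p0)// mulr_ge0// mulr_ge0//.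
  exact: ltW.
rewrite /Hopt/= normrM normrM normrN normrX normrN normfV (gtr0_norm p0) (gtr0_norm r0).
rewrite ler_pdivrMr// /Hamp.
rewrite [leRHS](_ : _ = r ^+ j.+1 * (lagb_amp * Num.sqrt j.+1%:R * r^-1 ^+ j * geo2)).
  by rewrite ler_wpM2l ?exprn_ge0 ?(ltW r0)// psum_dist_le.
by rewrite exprS exprVn; field; rewrite expf_neq0 ?gt_eqF.
Qed.
End Coefficients.

(** * Differential inequalities and the Bessel function *)
Section LinearComparison.
Context {R : realType}.

(** [M / a * y] is a supersolution: its own value of [h' + a h] is at least
    [M * y]. *)
Lemma linear_ode_le (h dh : R -> R) (a M y : R) : 0 < a -> 0 <= y ->
  (forall x, is_derive x (1 : R) h (dh x)) -> h 0 = 0 ->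
  (forall x, 0 <= x -> `|dh x + a * h x| <= M * x) ->
  `|h y| <= M / a * y.
Proof.
move=> a0 y0 hE h0 hM.
have M0 : 0 <= M by have := hM 1 ler01; rewrite mulr1; exact: le_trans.
suff H (s : R) : s ^+ 2 = 1 -> s * h y <= M / a * y.
  rewrite ler_norml; have := H 1; have := H (-1); rewrite sqrrN expr1n mulN1r mul1r.
  by move=> /(_ erefl) ? /(_ erefl) ?; rewrite lerNl; apply/andP.
move=> s1.
have ns : `|s| = 1 by apply/eqP; rewrite -(@eqrXn2 _ 2)// real_normK ?num_real// expr1n s1.
(* The integrating factor [expR (a * x)] makes this function nonincreasing. *)
pose f x := expR (a * x) * (s * h x - M / a * x).
pose df x := expR (a * x) * (s * (dh x + a * h x) - M * x - M / a).
have : f y <= f 0.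
  apply: (@ler0_is_derive_le _ f df) => // x.
    move=> _; have h1 := hE x.
    by rewrite /f; derive_tac; rewrite /df; field; lra.
  move=> /andP[x0 _]; rewrite /df mulr_ge0_le0 ?expR_ge0//.
  have := hM x (ltW x0); have := ler_norm (s * (dh x + a * h x)).
  rewrite normrM ns mul1r; have : 0 <= M / a by rewrite divr_ge0// ltW.
  lra.
rewrite /f h0 !mulr0 subrr mulr0 pmulr_rle0 ?expR_gt0//.
by rewrite subr_le0.
Qed.
End LinearComparison.

Ltac expbd_tac := repeat first [assumption | apply: expbdD | apply: expbdZ].

(** With the Laguerre polynomials taken at [c], the function
    [expR (- y) * egsum (fun k => lag k c) y] is the Bessel function [J_0] at
    [2 * Num.sqrt (c * y)].  The estimates come from its differential
    equation [y j'' + j' + c j = 0]. *)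
Section Bessel.
Context {R : realType}.
Variable (c : R).
Hypothesis (hc : 1 <= c).

Let P0 := @egsum R (fun k => lag k c).
Let P1 := @egsum R (fun k => lag k.+1 c).
Let P2 := @egsum R (fun k => lag k.+2 c).

Lemma expbd_lag : expbd (fun k => lag k c).
Proof.
have c1 := hc.
exists 1, (1 + c) => k; rewrite mul1r.
have c0 : 0 <= c by lra.
by have [] := lag_dlag_le k c c0.
Qed.

Lemma expbd_dlag : expbd (fun k => dlag k c).
Proof.
have c1 := hc.
exists 1, (2 * (1 + c)) => k; rewrite mul1r.
have c0 : 0 <= c by lra.
have [_ h] := lag_dlag_le k c c0.
rewrite (le_trans h)// exprMn ler_wpM2r ?exprn_ge0//; first lra.
by rewrite -natrX ler_nat ltnW// ltn_expl.
Qed.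

Let b0 := expbd_lag.
Let b1 := expbd_shift _ b0.
Let b2 := expbd_shift _ b1.

(** The three-term recurrence of the Laguerre polynomials, read on generating
    functions. *)
Lemma egsum_lag_ode (y : R) : y * P2 y + P1 y = 2 * (y * P1 y) + (1 - c) * P0 y - y * P0 y.
Proof.
have m0 : expbd (fun k => k%:R * lag k.-1 c) := expbdMn _ b0.
have m1 : expbd (fun k => k%:R * lag k.-1.+1 c) := expbdMn _ b1.
have m2 : expbd (fun k => k%:R * lag k.-1.+2 c) := expbdMn _ b2.
have E0 : egsum (fun k => k%:R * lag k.-1 c) y = y * P0 y := egsum_mulk _ y b0.
have E1 : egsum (fun k => k%:R * lag k.-1.+1 c) y = y * P1 y := egsum_mulk _ y b1.
have E2 : egsum (fun k => k%:R * lag k.-1.+2 c) y = y * P2 y := egsum_mulk _ y b2.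
rewrite -E0 -E1 -E2 -[- egsum _ y]mulN1r /P1 /P0 -!egsumZ; try by expbd_tac.
rewrite -!egsumD; try by expbd_tac.
congr (egsum _ y); apply/funext => k.
have := lag_rec k c; case: k => [|k] /=.
  by rewrite !mul0r; lra.
rewrite -[k.+2%:R]natr1; lra.
Qed.

Lemma egsum_dlag (y : R) : c * egsum (fun k => dlag k c) y = y * (P1 y - P0 y).
Proof.
have m0 : expbd (fun k => k%:R * lag k.-1 c) := expbdMn _ b0.
have m1 : expbd (fun k => k%:R * lag k.-1.+1 c) := expbdMn _ b1.
have E0 : egsum (fun k => k%:R * lag k.-1 c) y = y * P0 y := egsum_mulk _ y b0.
have E1 : egsum (fun k => k%:R * lag k.-1.+1 c) y = y * P1 y := egsum_mulk _ y b1.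
have md := expbd_dlag.
rewrite mulrBr -E0 -E1 -[- egsum _ y]mulN1r -!egsumZ; try by expbd_tac.
rewrite -!egsumD; try by expbd_tac.
congr (egsum _ y); apply/funext => k.
have := x_dlag k c; case: k => [|k] /=; lra.
Qed.

Let J0 (y : R) := expR (- y) * P0 y.
Let J1 (y : R) := expR (- y) * (P1 y - P0 y).
Let J2 (y : R) := expR (- y) * (P2 y - 2 * P1 y + P0 y).

Let is_derive_J0 y : is_derive y (1 : R) J0 (J1 y).
Proof.
have h := is_derive_egsum _ y b0; rewrite /J0; derive_tac.
by rewrite /J1 /P1 /P0; ring.
Qed.

Let is_derive_J1 y : is_derive y (1 : R) J1 (J2 y).
Proof.
have h := is_derive_egsum _ y b0; have h1 := is_derive_egsum _ y b1.
rewrite /J1 /P1 /P0; derive_tac.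
by rewrite /J2 /P2 /P1 /P0; ring.
Qed.

Let J_ode y : y * J2 y + J1 y + c * J0 y = 0.
Proof.
rewrite /J2 /J1 /J0.
transitivity (expR (- y) * ((y * P2 y + P1 y) -
  (2 * (y * P1 y) + (1 - c) * P0 y - y * P0 y))); first by ring.
by rewrite egsum_lag_ode subrr mulr0.
Qed.

Let J0_0 : J0 0 = 1.
Proof. by rewrite /J0 oppr0 expR0 mul1r /P0 egsum0. Qed.

(** The energy [c j ^ 2 + y j' ^ 2] has derivative [- j' ^ 2]. *)
Lemma bessel_le1 y : 0 <= y -> `|J0 y| <= 1.
Proof.
have c1 := hc; move=> y0.
pose f x := c * J0 x ^+ 2 + x * J1 x ^+ 2.
have : f y <= f 0.
  apply: (@ler0_is_derive_le _ f (fun x => - J1 x ^+ 2)) => // [x _|x _]; last first.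
    by rewrite oppr_le0 sqr_ge0.
  have h0 := is_derive_J0 x; have h1 := is_derive_J1 x.
  rewrite /f; derive_tac.
  have := J_ode x; move: (J0 x) (J1 x) (J2 x) => a b d.
  move=> /(congr1 (fun u => 2 * b * u)); rewrite mulr0 => E.
  by apply/eqP; rewrite -subr_eq0; apply/eqP; rewrite -[RHS]E; ring.
rewrite /f J0_0 mul0r addr0 expr1n mulr1 => fy.
have : c * J0 y ^+ 2 <= c * 1.
  by rewrite mulr1 (le_trans _ fy)// lerDl mulr_ge0 ?sqr_ge0.
rewrite ler_pM2l; last by lra.
by rewrite -[leRHS](expr1n _ 2%N) -[leLHS]real_normK ?num_real// ler_pXn2r ?nnegrE.
Qed.

(** [(y j')' = - c j], which is bounded by [c]. *)
Lemma bessel_dlt y : 0 <= y -> `|y * J1 y| <= c * y.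
Proof.
have c1 := hc; move=> y0.
suff H (s : R) : `|s| = 1 -> s * (y * J1 y) <= c * y.
  rewrite ler_norml; have := H 1; have := H (-1); rewrite normrN normr1 mulN1r mul1r.
  by move=> /(_ erefl) ? /(_ erefl) ?; rewrite lerNl; apply/andP.
move=> s1; pose f x := s * (x * J1 x) - c * x.
have : f y <= f 0.
  apply: (@ler0_is_derive_le _ f (fun x => c * (- (s * J0 x) - 1))) => // x.
    move=> _; have h1 := is_derive_J1 x; rewrite /f; derive_tac.
    have := J_ode x; move: (J0 x) (J1 x) (J2 x) => a b d.
    move=> /(congr1 (fun u => s * u)); rewrite mulr0 => E.
    by apply/eqP; rewrite -subr_eq0; apply/eqP; rewrite -[RHS]E; ring.
  move=> /andP[x0 _]; have := bessel_le1 _ (ltW x0); have := ler_norm (- (s * J0 x)).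
  rewrite normrN normrM s1 mul1r => ? ?.
  by rewrite pmulr_rle0 ?subr_le0; lra.
by rewrite /f mul0r !mulr0 subrr subr_le0.
Qed.

(** The primitive of [- expR (- y) * egsum (fun k => dlag k c) y] that vanishes
    at zero.  The integrand is bounded by [y], and its oscillation makes the
    primitive of size [y / c] only. *)
Definition bessel2 (y : R) := - (y / c) * (J0 y + J1 y / c).

Lemma bessel2_le y : 0 <= y -> `|bessel2 y| <= 2 / c * y.
Proof.
have c1 := hc; move=> y0; have c0 : 0 < c by lra.
have -> : bessel2 y = - ((y * J0 y + (y * J1 y) / c) / c).
  by rewrite /bessel2; field; lra.
rewrite normrN normrM normfV (gtr0_norm c0) [leRHS]mulrAC ler_pM2r ?invr_gt0//.
have h1 : `|y * J0 y| <= y by rewrite normrM ger0_norm// ler_piMr// bessel_le1.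
have h2 : `|y * J1 y / c| <= y.
  by rewrite normrM normfV (gtr0_norm c0) ler_pdivrMr// [leRHS]mulrC bessel_dlt.
by rewrite (le_trans (ler_normD _ _))//; lra.
Qed.

Lemma is_derive_bessel2 y :
  is_derive y (1 : R) bessel2 (- expR (- y) * egsum (fun k => dlag k c) y).
Proof.
have c1 := hc; have c0 : c != 0 by rewrite gt_eqF//; lra.
have h0 := is_derive_J0 y; have h1 := is_derive_J1 y.
rewrite /bessel2; derive_tac.
have -> : egsum (fun k => dlag k c) y = y * (P1 y - P0 y) / c.
  by rewrite -egsum_dlag mulrC mulKf.
have -> : - expR (- y) * (y * (P1 y - P0 y) / c) = - (y * J1 y) / c.
  by rewrite /J1; ring.
have := J_ode y; move: (J0 y) (J1 y) (J2 y) => a b d.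
move=> /(congr1 (fun u => - u / c / c)); rewrite oppr0 !mul0r => E.
by apply/eqP; rewrite -subr_eq0; apply/eqP; rewrite -[RHS]E; field.
Qed.
End Bessel.

(** * The bias of the explicit coefficients *)

Lemma egsum_expR {R : realType} (a y : R) : egsum (fun k => a ^+ k) y = expR (a * y).
Proof.
rewrite /egsum /pseries /expR; congr (limn _); apply/funext => n.
by rewrite /series/=; apply: eq_bigr => k _; rewrite /exp_coeff/= exprMn mulrAC.
Qed.

Lemma expbdX {R : realType} (a : R) : expbd (fun k => a ^+ k).
Proof. by exists 1, `|a| => k; rewrite mul1r normrX. Qed.

Lemma egf_egsum {R : realType} (H : nat -> R) (y : R) : H 0%N = 0 -> egf H y = egsum H y.
Proof.
move=> H0; rewrite /egf /egsum /pseries; congr (limn _); apply/funext => n.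
rewrite /series/=; case: n => [|n]; first by rewrite !big_geq.
by rewrite [RHS]big_ltn// H0 !mul0r add0r.
Qed.

Section Bias.
Context {R : realType}.
Variables (r c : R).
Hypotheses (hr : 1 < r) (hc : 1 <= c).

(** The exponential coefficients of [1 - expR (- (r * y))] minus those of
    [Hopt]. *)
Definition err k : R := - (- r) ^+ k * psum r c k.-1 / plim r c.

Lemma expbd_err : expbd err.
Proof.
have r1 := hr; have p0 := plim_gt0 r c hr; have r0 : 0 < r by lra.
exists (lagb_amp c * geo2 r / plim r c), r => k.
have psle n : `|psum r c n| <= lagb_amp c * geo2 r.
  have := psum_tail_le r c hr hc 0 n; rewrite add0n {2}/psum big_ord0 subr0.
  rewrite expr0 mulr1 sqrtr1 mulr1 => /le_trans; apply.
  rewrite ler_wpM2l ?sqrtr_ge0// gerBl mulr_ge0 ?exprn_ge0 ?invr_ge0//; first lra.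
  by rewrite addr_ge0 ?sqr_ge0// mulr_ge0// divr_ge0//; lra.
rewrite /err normrM normrM normrN normrX normrN normfV (gtr0_norm p0) (gtr0_norm r0).
rewrite [leRHS]mulrAC ler_pM2r ?invr_gt0// [leRHS]mulrC ler_wpM2l ?psle// exprn_ge0//; lra.
Qed.

Let Ed := @egsum R (fun k => dlag k c).
(* Shifted coefficients, so that the derivative of [Es] is [Ed]. *)
Let sdlag k : R := if k is j.+1 then dlag j c else 0.
Let Es := @egsum R sdlag.
Let Ee := @egsum R err.
Let A := - (r ^+ 2 / plim r c).

Let expbd_sdlag : expbd sdlag.
Proof.
have [M [rho H]] := expbd_dlag c hc; exists `|M|, (1 + `|rho|) => -[|k].
  by rewrite normr0 expr0 mulr1.
rewrite (le_trans (H k))// (le_trans (ler_norm _))// normrM ler_wpM2l// normrX.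
rewrite exprS (@le_trans _ _ ((1 + `|rho|) ^+ k))//.
  by rewrite lerXn2r ?nnegrE ?addr_ge0// lerDr.
by rewrite ler_peMl ?exprn_ge0 ?addr_ge0// lerDl.
Qed.

(** The weights [(- r) ^+ k] and the powers of [- r^-1] in the partial sums
    cancel, and for positive [k] the sum [err k.+1 + r * err k] is a constant
    times the single term [lagb k.-1].  As
    [L_n - 2 L_n' = - (L_(n+1)' + L_n')], only derivatives are left. *)
Let err_ode y : egsum (fun k => err k.+1) y = - A * (Ed y + Es y) - r * Ee y.
Proof.
have p0 := plim_gt0 r c hr; have be := expbd_err; have bs := expbd_shift _ be.
have bd := expbd_dlag c hc; have b1 := expbd_sdlag.
apply/eqP; rewrite eq_sym subr_eq eq_sym /Ed /Es /Ee -!egsumZ; try by expbd_tac.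
rewrite -!egsumD -?egsumZ; try by expbd_tac.
apply/eqP; congr (egsum _ y); apply/funext => -[|k].
  by rewrite /sdlag dlag0 /err /psum /= big_ord0; rewrite !mulr0 !mul0r addr0 mulr0 addr0 mulr0.
rewrite /sdlag /err /= {1}/psum big_ord_recr/= -/(psum r c k) dlagS /lagb /A.
have r1 := hr; have r0 : r != 0 by rewrite gt_eqF//; lra.
have -> : (- r) ^+ k.+2 = r ^+ 2 * (- r) ^+ k by rewrite !exprS; ring.
have -> : (- r) ^+ k.+1 = - r * (- r) ^+ k by rewrite !exprS; ring.
have -> : (- r^-1) ^+ k = ((- r) ^+ k)^-1 by rewrite -exprVn invrN.
by field; rewrite expf_neq0 ?oppr_eq0// gt_eqF.
Qed.

(** After multiplication by [expR (- y)], the right-hand side of the equation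
    is small only in the mean.  So a multiple of its primitive [bessel2] is
    subtracted before the comparison lemma is applied: once for the part [Es],
    which is itself a primitive of [Ed], and once for the error. *)
Lemma egsum_err_le y : 0 <= y -> expR (- y) * `|Ee y| <= r ^+ 2 / plim r c * (4 / c) * y.
Proof.
have r1 := hr; have c1 := hc; move=> y0; have p0 := plim_gt0 r c hr.
have be := expbd_err; have bs := expbd_sdlag; have bd := expbd_dlag c hc.
have b00 : bessel2 c 0 = 0 by rewrite /bessel2 mul0r oppr0 mul0r.
have dEe x := is_derive_egsum _ x be.
have dEs x : is_derive x (1 : R) Es (Ed x) := is_derive_egsum _ x bs.
have dB x := is_derive_bessel2 c hc x.
pose k x := - (expR (- x) * Es x); pose h1 x := k x - bessel2 c x.
have dk x : is_derive x (1 : R) k (expR (- x) * Es x - expR (- x) * Ed x).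
  have h := dEs x; rewrite /k; derive_tac; ring.
have h1le x : 0 <= x -> `|h1 x| <= 2 / c * x.
  move=> x0; rewrite -[2 / c]divr1.
  apply: (linear_ode_le h1 (fun x => expR (- x) * Es x)) => //.
  - move=> z; have hk := dk z; have hB := dB z; rewrite /h1; derive_tac; rewrite /Ed; ring.
  - by rewrite /h1 b00 /k /Es egsum0 /sdlag mulr0 oppr0 addr0.
  - move=> z z0; rewrite mul1r /h1 /k (_ : _ + _ = - bessel2 c z); last by ring.
    by rewrite normrN bessel2_le.
pose F x := expR (- x) * Ee x; pose h2 x := F x - A * bessel2 c x.
have A0 : A <= 0 by rewrite oppr_le0 divr_ge0 ?sqr_ge0// ltW.
have h2le : `|h2 y| <= - A * (2 / c) * y.
  have -> : - A * (2 / c) = (- A * (2 / c) * (1 + r)) / (1 + r) by rewrite mulfK// gt_eqF//; lra.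
  apply: (linear_ode_le h2 (fun x => A * (h1 x - r * bessel2 c x) - (1 + r) * h2 x)) => //; first lra.
  - move=> z; have hB := dB z; have he := dEe z.
    rewrite /h2 /F /Ee; derive_tac; rewrite err_ode /h1 /k -/Ed -/Ee.
    ring.
  - by rewrite /h2 b00 /F /Ee egsum0 /err /psum big_ord0 !mulr0 mul0r mulr0 subrr.
  - move=> z z0; rewrite subrK normrM ler0_norm// -!mulrA ler_wpM2l ?oppr_ge0//.
    have e1 := h1le z z0; have e2 := bessel2_le c hc z z0.
    rewrite (le_trans (ler_normB _ _))// normrM (ger0_norm (_ : 0 <= r)); last lra.
    have : r * `|bessel2 c z| <= r * (2 / c * z) by rewrite ler_wpM2l//; lra.
    lra.
have -> : expR (- y) * `|Ee y| = `|h2 y + A * bessel2 c y|.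
  by rewrite /h2 subrK /F normrM ger0_norm ?expR_ge0.
rewrite (le_trans (ler_normD _ _))// normrM (ler0_norm A0).
have : - A * `|bessel2 c y| <= - A * (2 / c * y) by rewrite ler_wpM2l ?oppr_ge0// bessel2_le.
rewrite /A opprK in h2le *; lra.
Qed.

Lemma Hopt_bias_le y : 0 <= y ->
  expR (- y) * `|1 - expR (- (r * y)) - egf (Hopt r c) y| <= r ^+ 2 / plim r c * (4 / c) * y.
Proof.
move=> y0; apply: le_trans (egsum_err_le _ y0); rewrite le_eqVlt; apply/orP; left; apply/eqP.
have p0 := plim_gt0 r c hr; have be := expbd_err.
have bx := expbdX (- r); have b0 := expbdX (0 : R).
congr (_ * `|_|); rewrite egf_egsum// -mulNr -egsum_expR.
have -> : Hopt r c = fun k => (0 ^+ k + (-1) * (- r) ^+ k) + (-1) * err k.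
  apply/funext => -[|k]; rewrite /Hopt /err/=.
    by rewrite /psum big_ord0 mulr0 mul0r mulr0 addr0 !expr0 mulr1 subrr.
  by rewrite expr0n/= add0r; field; rewrite gt_eqF.
rewrite !egsumD ?egsumZ; try by expbd_tac.
by rewrite !egsum_expR mul0r expR0 /Ee; ring.
Qed.
End Bias.

(** * The functional at the explicit coefficients *)
Section EgfBounds.
Context {R : realType}.
Implicit Types (a b : nat -> R) (y : R).

Lemma egsum_le a b y : expbd a -> expbd b -> (forall k, a k <= b k) -> 0 <= y ->
  egsum a y <= egsum b y.
Proof.
move=> ea eb ab y0; apply: ler_lim; [exact: egsum_cvg|exact: egsum_cvg|].
apply: nearW => n; rewrite /pseries /series/=; apply: ler_sum => k _.
by rewrite ler_wpM2r ?exprn_ge0// ler_wpM2r.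
Qed.

Lemma egsum_nat y : egsum (fun k => k%:R) y = y * expR y.
Proof.
have e1 := @expbdX R 1.
have := egsum_mulk _ y e1; rewrite egsum_expR mul1r => <-.
by congr (egsum _ y); apply/funext => k; rewrite expr1n mulr1.
Qed.

Lemma expbd_nat : expbd (fun k => k%:R : R).
Proof.
exists 1, 2 => k; rewrite mul1r normr_nat -natrX ler_nat.
by rewrite ltnW// ltn_expl.
Qed.

Lemma expbd_le a b : expbd b -> (forall k, `|a k| <= b k) -> expbd a.
Proof.
move=> [M [rho H]] ab; exists M, rho => k.
by rewrite (le_trans (ab k))// (le_trans (ler_norm _)).
Qed.

Lemma expR_ge_part a y n : expbd a -> (forall k, 0 <= a k) -> 0 <= y ->
  \sum_(0 <= k < n) a k / k`!%:R * y ^+ k <= egsum a y.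
Proof.
move=> ea a0 y0; rewrite /egsum.
have := nondecreasing_cvgn_le _ (egsum_cvg _ y ea) n; apply.
apply/nondecreasing_seqP => k; rewrite /pseries /series/= big_nat_recr//= lerDl.
by rewrite mulr_ge0 ?exprn_ge0// divr_ge0.
Qed.
End EgfBounds.

Section Functional.
Context {R : realType}.
Variables (r c t : R).
Hypotheses (hr : 1 < r) (hc : 1 <= c) (ht : 0 < t).

Definition Hbias : R := r ^+ 2 / plim r c * (4 / c).

Lemma bias_fun_Hopt p : 0 <= p -> bias_fun r t (Hopt r c) p <= t * Hbias.
Proof.
have r1 := hr; have c1 := hc; have t0 := ht; move=> p0; have pl0 := plim_gt0 r c hr.
have B0 : 0 <= Hbias by rewrite mulr_ge0// divr_ge0 ?sqr_ge0// ?(ltW pl0)//; lra.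
rewrite /bias_fun; case: eqVneq => [_|pn0].
  rewrite /Hopt/psum big_ord0 subr0 expr1 opprK mulfK ?gt_eqF// subrr normr0 mulr0.
  by rewrite mulr_ge0// ltW.
have p1 : 0 < p by rewrite lt_neqAle eq_sym pn0.
have pt0 : 0 <= p * t by rewrite mulr_ge0// ltW.
have := Hopt_bias_le r c hr hc (p * t) pt0; rewrite mulrA => h.
rewrite mulrAC ler_pdivrMr// (le_trans h)// /Hbias.
by rewrite le_eqVlt; apply/orP; left; apply/eqP; ring.
Qed.

Lemma expbd_Hopt_sqr : expbd (fun k => Hopt r c k ^+ 2).
Proof.
apply: (expbd_le _ (fun k => Hamp r c ^+ 2 * k%:R)).
  by apply: expbdZ; exact: expbd_nat.
by move=> k; rewrite ger0_norm ?sqr_ge0// Hopt_sqr_le.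
Qed.

Lemma egsum_Hopt_sqr y : 0 <= y ->
  egsum (fun k => Hopt r c k ^+ 2) y <= Hamp r c ^+ 2 * (y * expR y).
Proof.
move=> y0; rewrite -egsum_nat -egsumZ; last exact: expbd_nat.
apply: egsum_le => //; [exact: expbd_Hopt_sqr|by apply: expbdZ; exact: expbd_nat|].
by move=> k; exact: Hopt_sqr_le.
Qed.

Lemma var_fun_Hopt q : 0 <= q -> var_fun r t (Hopt r c) q <= t * (r + Hamp r c ^+ 2).
Proof.
have r1 := hr; have c1 := hc; have t0 := ht; move=> q0.
rewrite /var_fun; case: eqVneq => [_|qn0].
  rewrite ler_pM2l// lerD2l; have := Hopt_sqr_le r c hr hc 1; rewrite mulr1; exact.
have q1 : 0 < q by rewrite lt_neqAle eq_sym qn0.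
have qt0 : 0 <= q * t by rewrite mulr_ge0// ltW.
rewrite mulrAC ler_pdivrMr// mulrDr.
rewrite egf_egsum; last by rewrite /Hopt expr0n.
have h1 : expR (- (q * t)) * (1 - expR (- (r * q * t))) <= r * q * t.
  have e1 : expR (- (q * t)) <= 1 by rewrite expR_le1 oppr_le0.
  have e2 : 1 - expR (- (r * q * t)) <= r * q * t.
    by have := expR_ge1Dx (- (r * q * t)); lra.
  have e3 : 0 <= 1 - expR (- (r * q * t)).
    by rewrite subr_ge0 expR_le1 oppr_le0 -mulrA mulr_ge0//; lra.
  by rewrite (le_trans (ler_wpM2r e3 e1))// mul1r.
have h2 : expR (- (q * t)) * egsum (fun k => Hopt r c k ^+ 2) (q * t) <=
    Hamp r c ^+ 2 * (q * t).
  apply: le_trans (ler_wpM2l (expR_ge0 _) (egsum_Hopt_sqr _ qt0)) _.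
  rewrite [leLHS](_ : _ = Hamp r c ^+ 2 * (q * t) * (expR (- (q * t)) * expR (q * t))); last by ring.
  by rewrite -expRD addNr expR0 mulr1.
lra.
Qed.

Lemma G_Hopt_le :
  (G r t (Hopt r c) <= ((t * Hbias) ^+ 2 + t * (r + Hamp r c ^+ 2))%:E)%E.
Proof.
have t0 := ht; have pl0 := plim_gt0 r c hr.
rewrite /G ifF; last first.
  apply/negbTE; rewrite -ltey.
  apply: (@le_lt_trans _ _ (Hamp r c ^+ 2 * (t * expR t))%:E); last exact: ltry.
  apply: lime_le.
    by apply: is_cvg_nneseries => n _ _; rewrite lee_fin divr_ge0// mulr_ge0 ?sqr_ge0// exprn_ge0// ltW.
  apply: nearW => n; rewrite sumEFin lee_fin.
  apply: le_trans (egsum_Hopt_sqr _ (ltW t0)).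
  apply: le_trans (expR_ge_part _ t n expbd_Hopt_sqr _ (ltW t0)); last first.
    by move=> k; rewrite sqr_ge0.
  case: n => [|n]; first by rewrite !big_geq.
  rewrite [leRHS]big_ltn//= {1}/Hopt expr0n/= !mul0r add0r.
  by apply: ler_sum => i _; rewrite mulrAC.
rewrite EFinD; apply: leeD.
  have b0 p : 0 <= p -> 0 <= bias_fun r t (Hopt r c) p.
    move=> p0; rewrite /bias_fun; case: ifP => _.
      by rewrite mulr_ge0// ltW.
    by rewrite mulr_ge0// divr_ge0 ?expR_ge0.
  rewrite /Yb; set s := ereal_sup _.
  have s1 : (s <= (t * Hbias)%:E)%E.
    apply: ub_ereal_sup => x /= [p]; rewrite in_itv/= => /andP[p0 _] <-.
    by rewrite lee_fin bias_fun_Hopt.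
  have s0 : (0 <= s)%E.
    apply: (@le_trans _ _ (bias_fun r t (Hopt r c) 0)%:E); first by rewrite lee_fin b0.
    by apply: ereal_sup_ubound; exists 0 => //=; rewrite in_itv/= lexx ler01.
  by rewrite expe2 expr2 EFinM; apply: lee_pmul.
apply: ub_ereal_sup => x /= [q]; rewrite in_itv/= => /andP[q0 _] <-.
by rewrite lee_fin var_fun_Hopt.
Qed.
End Functional.

(** * The Poisson limit of binomial averages *)
Section PoissonLimit.
Context {R : realType}.
Implicit Types (t h M : R) (b : nat -> R) (K k n : nat).

Definition binw K h k : R := 'C(K, k)%:R * h ^+ k * (1 - h) ^+ (K - k).

Definition binsum K h b : R := \sum_(k < K.+1) binw K h k * b k.

(** The mean of [b] at a Poisson variable of parameter [t]. *)
Definition pois t b : R := expR (- t) * egsum b t.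

(** Conditioning on one trial. *)
Lemma binsumS K h b :
  binsum K.+1 h b = binsum K h (fun k => (1 - h) * b k + h * b k.+1).
Proof.
rewrite /binsum.
have -> : \sum_(k < K.+1) binw K h k * ((1 - h) * b k + h * b k.+1) =
  \sum_(k < K.+1) binw K h k * (1 - h) * b k + \sum_(k < K.+1) binw K h k * h * b k.+1.
  by rewrite -big_split/=; apply: eq_bigr => k _; ring.
rewrite big_ord_recl [in RHS]big_ord_recl/= -addrA; congr (_ + _).
  by rewrite /binw !bin0 !subn0 exprS; ring.
have -> : \sum_(i < K) binw K h (lift ord0 i) * (1 - h) * b (lift ord0 i) =
    \sum_(i < K.+1) 'C(K, i.+1)%:R * h ^+ i.+1 * (1 - h) ^+ (K - i) * b i.+1.
  rewrite [in RHS]big_ord_recr/= bin_small// !mul0r addr0.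
  apply: eq_bigr => i _; rewrite /binw /bump/= add1n.
  by rewrite -[(K - i)%N](subnSK (ltn_ord i)) !exprS; ring.
rewrite -big_split/=; apply: eq_bigr => i _.
rewrite /binw /bump/= add1n binS natrD subSS exprS; ring.
Qed.

Lemma binw_ge0 K h k : 0 <= h <= 1 -> 0 <= binw K h k.
Proof.
by move=> /andP[h0 h1]; rewrite /binw mulr_ge0// ?exprn_ge0 ?subr_ge0// mulr_ge0// exprn_ge0.
Qed.

(** Domination by the terms of the exponential series, for passing to the limit
    under the sum. *)
Lemma binw_le t n k : 0 <= t <= n.+1%:R -> binw n.+1 (t / n.+1%:R) k <= t ^+ k / k`!%:R.
Proof.
move=> /andP[t0 tn]; have n0 : 0 < n.+1%:R :> R by rewrite ltr0n.
have k0 : 0 < k`!%:R :> R by rewrite ltr0n fact_gt0.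
have h0 : 0 <= t / n.+1%:R by rewrite divr_ge0.
have h1 : t / n.+1%:R <= 1 by rewrite ler_pdivrMr// mul1r.
rewrite /binw -[leRHS]mulr1 ler_pM ?exprn_ge0 ?subr_ge0 ?mulr_ge0 ?exprn_ge0//; last first.
  by rewrite exprn_ile1 ?subr_ge0// gerBl.
rewrite expr_div_n mulrA ler_pdivrMr ?exprn_gt0//.
rewrite [leRHS](_ : _ = n.+1%:R ^+ k / k`!%:R * t ^+ k); last by ring.
rewrite ler_wpM2r ?exprn_ge0// ler_pdivlMr// -natrX -natrM ler_nat bin_ffact.
elim: k {k0} => [|k IH]; first by rewrite ffactn0 expn0.
by rewrite ffactnSr expnSr leq_mul// leq_subr.
Qed.

Lemma cvg_t_harmonic t : t / n.+1%:R @[n --> \oo] --> (0 : R).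
Proof. by rewrite -[X in _ --> X](mulr0 t); apply: cvgMl_tmp; exact: cvg_harmonic. Qed.

Lemma near_natS t : \forall n \near \oo, t < n.+1%:R :> R.
Proof.
have /cvgrPdist_lt/(_ _ ltr01) := cvg_t_harmonic t.
apply: filterS => n; rewrite sub0r normrN => /(le_lt_trans (ler_norm _)).
by rewrite ltr_pdivrMr ?ltr0n// mul1r.
Qed.

Lemma exp_limit t : 0 <= t ->
  (1 - t / n.+1%:R) ^+ n.+1 @[n --> \oo] --> expR (- t).
Proof.
move=> t0.
have hcvg := cvg_t_harmonic t.
have lcvg : expR (- t / (1 - t / n.+1%:R)) @[n --> \oo] --> expR (- t).
  rewrite -[X in expR X]divr1 -[X in _ / X](subr0 1).
  apply: (continuous_cvg _ (@continuous_expR R _)).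
  apply: cvgMl_tmp; apply: cvgV; first by rewrite subr0 oner_eq0.
  by apply: cvgB => //; exact: cvg_cst.
(* Both bounds come from [1 + x <= expR x], at [- h] and at [h / (1 - h)]. *)
apply: (squeeze_cvgr _ lcvg (cvg_cst (expR (- t)))).
near=> n; have tn : t < n.+1%:R by near: n; exact: near_natS.
have n0 : 0 < n.+1%:R :> R by rewrite ltr0n.
set h := t / n.+1%:R; have h1 : h < 1 by rewrite ltr_pdivrMr// mul1r.
have tE : t = h * n.+1%:R by rewrite /h mulfVK// gt_eqF.
apply/andP; split => /=.
  rewrite [in leLHS]tE -mulNr mulrAC expRM_natr lerXn2r ?nnegrE ?expR_ge0//; first lra.
  rewrite mulNr expRN invf_ple ?posrE ?expR_gt0//; last by lra.
  apply: le_trans (expR_ge1Dx _); rewrite le_eqVlt; apply/orP; left; apply/eqP.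
  by field; lra.
rewrite (_ : expR (- t) = expR (- h) ^+ n.+1); last by rewrite [in LHS]tE -mulNr expRM_natr.
rewrite -/h lerXn2r ?nnegrE ?expR_ge0//; first lra.
exact: expR_ge1Dx.
Unshelve. all: by end_near. Qed.

Lemma binw_cvg t k : 0 <= t ->
  binw n.+1 (t / n.+1%:R) k @[n --> \oo] --> expR (- t) * (t ^+ k / k`!%:R).
Proof.
move=> t0; have hcvg := cvg_t_harmonic t.
elim: k => [|k IH].
  rewrite expr0 fact0 divr1 mulr1.
  have := exp_limit t t0; rewrite (_ : (fun n => binw _ _ _) = fun n => (1 - t / n.+1%:R) ^+ n.+1)//.
  by apply/funext => n; rewrite /binw bin0 expr0 !mul1r subn0.
(* The ratio of the weights at [k.+1] and [k]. *)
pose g n : R := (1 - k%:R / n.+1%:R) * (t / k.+1%:R) / (1 - t / n.+1%:R).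
have gcvg : g n @[n --> \oo] --> t / k.+1%:R.
  rewrite (_ : t / _ = (1 - 0) * (t / k.+1%:R) / (1 - 0)); last by rewrite subr0 divr1 mul1r.
  apply: cvgM.
    by apply: cvgMr_tmp; apply: cvgB; [exact: cvg_cst|exact: cvg_t_harmonic].
  apply: cvgV; first by rewrite subr0 oner_eq0.
  by apply: cvgB => //; exact: cvg_cst.
have -> : expR (- t) * (t ^+ k.+1 / k.+1`!%:R) = expR (- t) * (t ^+ k / k`!%:R) * (t / k.+1%:R).
  rewrite factS natrM exprS invfM; ring.
apply: cvg_trans (cvgM IH gcvg); apply: near_eq_cvg.
near=> n; have tn : t < n.+1%:R by near: n; exact: near_natS.
have kn : (k < n)%N by near: n; exact: nbhs_infty_gt.
have n0 : 0 < n.+1%:R :> R by rewrite ltr0n.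
have h1 : t / n.+1%:R < 1 by rewrite ltr_pdivrMr// mul1r.
rewrite /= /g /binw.
have -> : 'C(n.+1, k.+1)%:R = 'C(n.+1, k)%:R * (n.+1%:R - k%:R) / k.+1%:R :> R.
  apply: (@mulIf _ k.+1%:R); first by rewrite pnatr_eq0.
  rewrite mulfVK ?pnatr_eq0// -natrB; last by rewrite ltnW// ltnS ltnW.
  by rewrite -!natrM mulnC mul_bin_left mulnC.
have -> : (n.+1 - k = (n.+1 - k.+1).+1)%N by rewrite subSS subSn// ltnW.
rewrite !exprS.
have : k.+1%:R != 0 :> R by rewrite pnatr_eq0.
move: (n.+1%:R) n0 tn ((1 - _) ^+ _) ('C(_, _)%:R) => m m0 tm P Cn.
have mt : m - t != 0 by rewrite subr_eq0 gt_eqF.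
move: (k.+1%:R) => kk k1; field.
by rewrite gt_eqF// k1 mt.
Unshelve. all: by end_near. Qed.

Lemma expbd_bounded b M : (forall k, `|b k| <= M) -> expbd b.
Proof. by move=> bM; exists M, 1 => k; rewrite expr1n mulr1. Qed.

(** Dominated convergence for series, with the three-epsilon argument: the
    first [N] terms converge one by one, and the remainders of both sums are at
    most a remainder of the exponential series. *)
Lemma binsum_cvg t b M : 0 <= t -> (forall k, `|b k| <= M) ->
  binsum n.+1 (t / n.+1%:R) b @[n --> \oo] --> pois t b.
Proof.
move=> t0 bM; have M0 : 0 <= M := le_trans (normr_ge0 _) (bM 0%N).
pose e k : R := t ^+ k / k`!%:R.
have e0 k : 0 <= e k by rewrite divr_ge0// exprn_ge0.
have ecvg : \sum_(0 <= k < n) e k @[n --> \oo] --> expR t.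
  exact: (is_cvg_series_exp_coeff t).
have ele m n : (m <= n)%N -> \sum_(m <= k < n) e k <= expR t - \sum_(0 <= k < m) e k.
  move=> mn; rewrite lerBrDl -big_cat_nat//=.
  rewrite -(cvg_lim _ ecvg)//; apply: nondecreasing_cvgn_le.
    by apply/nondecreasing_seqP => k; rewrite big_nat_recr//= lerDl.
  by apply/cvg_ex; exists (expR t).
have eb : expbd b := expbd_bounded b M bM.
have pcvg : expR (- t) * \sum_(0 <= k < n) b k * e k @[n --> \oo] --> pois t b.
  apply: cvgMl_tmp; rewrite (_ : (fun n => _) = pseries (fun k => b k / k`!%:R) t).
    exact: egsum_cvg.
  apply/funext => n; apply: eq_bigr => k _; rewrite /e /=; ring.
have head N : \sum_(0 <= k < N) binw n.+1 (t / n.+1%:R) k * b k @[n --> \oo] -->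
    expR (- t) * \sum_(0 <= k < N) b k * e k.
  elim: N => [|N IH].
    rewrite big_geq// mulr0 (_ : (fun n => _) = fun=> 0); first exact: cvg_cst.
    by apply/funext => n; rewrite big_geq.
  rewrite big_nat_recr//= mulrDr (_ : (fun n => _) = fun n =>
    \sum_(0 <= k < N) binw n.+1 (t / n.+1%:R) k * b k + binw n.+1 (t / n.+1%:R) N * b N).
    apply: cvgD => //; rewrite (_ : expR _ * _ = expR (- t) * e N * b N); last by ring.
    by apply: cvgMr_tmp; exact: binw_cvg.
  by apply/funext => n; rewrite big_nat_recr.
apply/cvgrPdist_le => eps eps0.
have tail : (expR t - \sum_(0 <= k < n) e k) @[n --> \oo] --> 0.
  by rewrite -[X in _ --> X](subrr (expR t)); apply: cvgB => //; exact: cvg_cst.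
have d0 : 0 < eps / (3 * (M + 1)) by rewrite divr_gt0// mulr_gt0//; lra.
have /cvgrPdist_le/(_ _ d0)[N _ HN] := tail.
have {HN} tailN : M * (expR t - \sum_(0 <= k < N) e k) <= eps / 3.
  have /= := HN N (leqnn N); rewrite sub0r normrN => /(le_trans (ler_norm _)).
  rewrite ler_pdivlMr; last by rewrite mulr_gt0//; lra.
  have := ele N N (leqnn N); rewrite (big_geq (leqnn N)) => ? ?.
  rewrite ler_pdivlMr//; nra.
have dist1 : `|pois t b - expR (- t) * \sum_(0 <= k < N) b k * e k| <= eps / 3.
  have h : `|expR (- t) * \sum_(0 <= k < n) b k * e k -
      expR (- t) * \sum_(0 <= k < N) b k * e k| @[n --> \oo] -->
      `|pois t b - expR (- t) * \sum_(0 <= k < N) b k * e k|.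
    by apply: cvg_norm; apply: cvgB => //; exact: cvg_cst.
  rewrite -(cvg_lim _ h)//; apply: limr_le; first by apply/cvg_ex; eexists; exact: h.
  near=> n; have Nn : (N <= n)%N by near: n; exact: nbhs_infty_ge.
  rewrite -mulrBr (big_cat_nat _ Nn)//= [X in _ * (X - _)]addrC addrK normrM ger0_norm ?expR_ge0//.
  apply: le_trans tailN; rewrite -[leRHS]mul1r ler_pM ?expR_ge0//.
    by rewrite expR_le1 oppr_le0.
  rewrite (le_trans (ler_norm_sum _ _ _))//.
  apply: le_trans (ler_wpM2l M0 (ele _ _ Nn)); rewrite mulr_sumr.
  by apply: ler_sum => k _; rewrite normrM (ger0_norm (e0 _)) ler_wpM2r.
have eps3 : 0 < eps / 3 by rewrite divr_gt0.
have /cvgrPdist_le/(_ _ eps3) hN := head N.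
near=> n.
have tn : t < n.+1%:R by near: n; exact: near_natS.
have Nn : (N <= n)%N by near: n; exact: nbhs_infty_ge.
have dist2 : `|expR (- t) * \sum_(0 <= k < N) b k * e k -
   \sum_(0 <= k < N) binw n.+1 (t / n.+1%:R) k * b k| <= eps / 3.
  by near: n; exact: hN.
have dist3 : `|binsum n.+1 (t / n.+1%:R) b -
    \sum_(0 <= k < N) binw n.+1 (t / n.+1%:R) k * b k| <= eps / 3.
  have Nn2 : (N <= n.+2)%N by rewrite (leq_trans Nn)// ltnW.
  rewrite /binsum -(big_mkord xpredT (fun k => binw n.+1 (t / n.+1%:R) k * b k)).
  rewrite (big_cat_nat _ Nn2)//= [X in X - _]addrC addrK.
  rewrite (le_trans (ler_norm_sum _ _ _))//; apply: le_trans tailN.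
  apply: le_trans (ler_wpM2l M0 (ele _ _ Nn2)); rewrite mulr_sumr.
  apply: ler_sum => k _; rewrite normrM mulrC.
  have n0 : 0 < n.+1%:R :> R by rewrite ltr0n.
  have w0 : 0 <= binw n.+1 (t / n.+1%:R) k.
    by rewrite binw_ge0// divr_ge0//= ler_pdivrMr// mul1r ltW.
  by rewrite (ger0_norm w0) ler_pM// binw_le// t0 ltW.
set B := binsum _ _ _ in dist3 *; set p := pois t b in dist1 *.
move: dist1 dist2 dist3.
set X1 := expR _ * _; set X2 := \sum_(_ <= _ < _) _ * _.
move=> d1 d2 d3; rewrite (_ : p - B = (p - X1) + (X1 - X2) - (B - X2)); last by ring.
rewrite (le_trans (ler_normB _ _))// (le_trans (lerD (ler_normD _ _) (lexx _)))//.
lra.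
Unshelve. all: by end_near. Qed.
End PoissonLimit.

(** * Lazy Markov operators *)
Section LazyOperators.
Context {R : realType} {Y : Type}.
Implicit Types (T : (Y -> R) -> Y -> R) (psi phi : Y -> R).

Definition linop T := forall a b psi phi y,
  T (fun z => a * psi z + b * phi z) y = a * T psi y + b * T phi y.

Definition posop T := forall psi phi,
  (forall y, psi y <= phi y) -> forall y, T psi y <= T phi y.

(** One step that applies [T] with probability [h] only.  With [T] a Markov
    operator, [K] lazy steps amount to a binomial number of applications of [T],
    and in the limit to a Poisson number. *)
Definition lazy (h : R) T psi y := (1 - h) * psi y + h * T psi y.

Lemma linop_iter T k : linop T -> linop (iter k T).
Proof.
move=> Tlin; elim: k => [//|k IH] a b psi phi y /=.
by rewrite (_ : iter k T _ = fun z => a * iter k T psi z + b * iter k T phi z)//; apply/funext => z.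
Qed.

Lemma iter_lazy h T K psi y : linop T ->
  iter K (lazy h T) psi y = binsum K h (fun k => iter k T psi y).
Proof.
move=> Tlin; elim: K psi => [|K IH] psi.
  by rewrite /binsum big_ord1 /binw bin0 subn0 !expr0 !mul1r.
rewrite iterSr IH binsumS; congr binsum; apply/funext => k.
by rewrite /lazy (linop_iter T k Tlin) -iterSr.
Qed.

Lemma linop_lazy h T : linop T -> linop (lazy h T).
Proof. by move=> Tlin a b psi phi y; rewrite /lazy Tlin; ring. Qed.

Lemma posop_lazy h T : 0 <= h <= 1 -> posop T -> posop (lazy h T).
Proof.
move=> /andP[h0 h1] Tpos psi phi le_ y; rewrite /lazy lerD// ler_wpM2l ?subr_ge0//.
exact: Tpos.
Qed.

Definition unitop T := forall c y, T (fun=> c) y = c.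

Lemma iter_bounded T k psi (M : R) : posop T -> unitop T ->
  (forall y, `|psi y| <= M) -> forall y, `|iter k T psi y| <= M.
Proof.
move=> Tpos T1 bM; elim: k => [//|k IH] y /=; rewrite ler_norml.
rewrite -{1}[- M](T1 _ y) -{2}[M](T1 _ y) !Tpos// => z.
  by have := IH z; rewrite ler_norml => /andP[].
by have := IH z; rewrite ler_norml => /andP[].
Qed.

Definition poisop t T psi y : R := pois t (fun k => iter k T psi y).

Lemma poisop_cvg t T psi (M : R) y : 0 <= t -> linop T -> posop T -> unitop T ->
  (forall y, `|psi y| <= M) ->
  iter n.+1 (lazy (t / n.+1%:R) T) psi y @[n --> \oo] --> poisop t T psi y.
Proof.
move=> t0 Tlin Tpos T1 bM.
under eq_cvg do rewrite iter_lazy//.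
by apply: (binsum_cvg _ _ M) => // k; exact: iter_bounded.
Qed.
End LazyOperators.

(** * Sampling sets of species *)

(** The state of each species is a point of [X], which [sigma] moves when the
    species is in the sampled set.  The sets have law [q]. *)
Section Sampling.
Context {R : realType} {I : finType} {X : Type}.
Variables (sigma : X -> X) (q : {set I} -> R) (B : nat).
Hypotheses (q0 : forall A, 0 <= q A) (q1 : \sum_A q A = 1).
Hypothesis (qB : forall A, (B < #|A : {set I}|)%N -> q A = 0).

Definition hit (A : {set I}) (x : I -> X) i := if i \in A then sigma (x i) else x i.

Definition samp (psi : (I -> X) -> R) x : R := \sum_A q A * psi (hit A x).

Definition incl i : R := \sum_(A : {set I} | i \in A) q A.

Definition shft (f : X -> R) a := f (sigma a).

(** Functions of this form are stable under sampling, and sampling acts on them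
    species by species, although the species are not independent. *)
Definition addf (u : I -> X -> R) (x : I -> X) : R := \sum_i u i (x i).

Lemma linop_samp : linop samp.
Proof.
move=> a b psi phi y; rewrite /samp !mulr_sumr -big_split/=.
by apply: eq_bigr => A _; ring.
Qed.

Lemma posop_samp : posop samp.
Proof. by move=> psi phi le_ y; apply: ler_sum => A _; rewrite ler_wpM2l. Qed.

Lemma unitop_samp : unitop samp.
Proof. by move=> c y; rewrite /samp -mulr_suml q1 mul1r. Qed.

Lemma linop_shft : linop shft. Proof. by []. Qed.
Lemma posop_shft : posop shft. Proof. by move=> psi phi le_ y; exact: le_. Qed.
Lemma unitop_shft : unitop shft. Proof. by []. Qed.

Lemma incl_ge0 i : 0 <= incl i. Proof. exact: sumr_ge0. Qed.

Lemma incl_le1 i : incl i <= 1.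
Proof. by rewrite -q1 [leRHS](bigID (fun A : {set I} => i \in A))/= lerDl sumr_ge0. Qed.

(** Exchanging the sums over the sets and over their elements; with [d = 1] it
    gives the expected size of the sampled set. *)
Lemma incl_sum (d : I -> R) : \sum_A q A * (\sum_(i in A) d i) = \sum_i incl i * d i.
Proof.
under eq_bigr do rewrite mulr_sumr big_mkcond/=.
rewrite exchange_big/=; apply: eq_bigr => i _.
by rewrite /incl mulr_suml [RHS]big_mkcond.
Qed.

Lemma sum_incl_le : \sum_i incl i <= B%:R.
Proof.
have := incl_sum (fun=> 1); under [in X in _ = X]eq_bigr do rewrite mulr1.
move=> <-; rewrite -[leRHS]mul1r -[X in _ <= X * _]q1 mulr_suml; apply: ler_sum => A _.
rewrite sumr_const; have [AB|/qB ->] := leqP #|A| B; last by rewrite !mul0r.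
by rewrite ler_wpM2l// ler_nat.
Qed.

Lemma addf_hit u A x :
  addf u (hit A x) = addf u x + \sum_(i in A) (u i (sigma (x i)) - u i (x i)).
Proof.
rewrite /addf [\sum_(i in A) _]big_mkcond/= -big_split/=; apply: eq_bigr => i _.
by rewrite /hit; case: ifP => _; rewrite ?addr0// addrC subrK.
Qed.

Lemma lazy_samp_addf h u x :
  lazy h samp (addf u) x = addf (fun i => lazy (h * incl i) shft (u i)) x.
Proof.
rewrite /lazy /samp.
under eq_bigr do rewrite addf_hit mulrDr.
rewrite big_split/= -mulr_suml q1 mul1r incl_sum mulrDr addrA -mulrDl subrK mul1r.
rewrite /addf mulr_sumr -big_split/=; apply: eq_bigr => i _.
by rewrite /shft; ring.
Qed.

Lemma iter_lazy_samp_addf h K u x :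
  iter K (lazy h samp) (addf u) x =
  addf (fun i => iter K (lazy (h * incl i) shft) (u i)) x.
Proof.
elim: K u x => [//|K IH] u x; rewrite iterSr.
rewrite (_ : lazy h samp (addf u) = addf (fun i => lazy (h * incl i) shft (u i))); last first.
  by apply/funext => z; exact: lazy_samp_addf.
by rewrite IH; congr addf; apply/funext => i; rewrite -iterSr.
Qed.

Lemma sqr_sum_le (A : {set I}) (d : I -> R) :
  (\sum_(i in A) d i) ^+ 2 <= #|A|%:R * \sum_(i in A) d i ^+ 2.
Proof.
rewrite expr2 mulr_suml.
apply: (@le_trans _ _ (\sum_(i in A) \sum_(j in A) (d i ^+ 2 + d j ^+ 2) / 2)).
  apply: ler_sum => i _; rewrite mulr_sumr; apply: ler_sum => j _.
  have := sqr_ge0 (d i - d j); lra.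
under eq_bigr do rewrite -mulr_suml big_split/= sumr_const.
rewrite -mulr_suml big_split/= sumr_const -sumrMnl.
rewrite le_eqVlt; apply/orP; left; apply/eqP.
rewrite -mulr_natl mulr_natl -mulr2n -[X in X / _]mulr_natr mulfK; last by rewrite pnatr_eq0.
by rewrite [RHS]mulr_natl -sumrMnl.
Qed.

(** The left-hand side is at most [h] times the mean of the square of a sum over
    the sampled set, hence by Cauchy-Schwarz at most [h B] times the sum of
    [p_i d_i ^ 2], where [d_i] is the increment of the term of [i] and [p_i] its
    inclusion probability.  On the right-hand side the variance is
    [h p_i (1 - h p_i) d_i ^ 2], and [1 - h p_i] is at least [1/2]. *)
Lemma lazy_var_step h u x : 0 <= h <= 1/2 ->
  lazy h samp (fun y => addf u y ^+ 2) x - lazy h samp (addf u) x ^+ 2 <=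
  2 * B%:R * \sum_i (lazy (h * incl i) shft (fun a => u i a ^+ 2) (x i) -
                     lazy (h * incl i) shft (u i) (x i) ^+ 2).
Proof.
move=> /andP[h0 h1]; pose d i := u i (sigma (x i)) - u i (x i).
pose a := addf u x; pose D (A : {set I}) := \sum_(i in A) d i.
have sE : samp (addf u) x = a + \sum_A q A * D A.
  rewrite /samp; under eq_bigr do rewrite addf_hit mulrDr.
  by rewrite big_split/= -mulr_suml q1 mul1r.
have s2E : samp (fun y => addf u y ^+ 2) x =
    a ^+ 2 + 2 * a * (\sum_A q A * D A) + \sum_A q A * D A ^+ 2.
  rewrite /samp -[a ^+ 2]mul1r -[X in X * a ^+ 2]q1 mulr_suml mulr_sumr -!big_split/=.
  by apply: eq_bigr => A _; rewrite addf_hit -/(D A) -/a; ring.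
have -> : lazy h samp (fun y => addf u y ^+ 2) x - lazy h samp (addf u) x ^+ 2 =
    h * (\sum_A q A * D A ^+ 2) - (h * \sum_A q A * D A) ^+ 2.
  by rewrite /lazy sE s2E -/a; ring.
have L1 : \sum_A q A * D A ^+ 2 <= B%:R * \sum_i incl i * d i ^+ 2.
  rewrite -incl_sum mulr_sumr; apply: ler_sum => A _.
  have [AB|/qB ->] := leqP #|A| B; last by rewrite !mul0r mulr0.
  rewrite [leRHS]mulrCA ler_wpM2l// (le_trans (sqr_sum_le _ _))// ler_wpM2r ?ler_nat//.
  by apply: sumr_ge0 => i _; rewrite sqr_ge0.
apply: (@le_trans _ _ (h * (B%:R * \sum_i incl i * d i ^+ 2))).
  by rewrite lerBlDr (le_trans (ler_wpM2l h0 L1))// lerDl sqr_ge0.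
rewrite mulrCA (mulrC 2) -mulrA ler_wpM2l// !mulr_sumr; apply: ler_sum => i _.
rewrite /lazy /shft.
have -> : u i (sigma (x i)) = u i (x i) + d i by rewrite /d addrC subrK.
have p0 := incl_ge0 i; have p1 := incl_le1 i.
move: (u i (x i)) (d i) (incl i) p0 p1 => b e p p0 p1.
rewrite (_ : _ - _ = h * p * e ^+ 2 * (1 - h * p)); last by ring.
have hp : h * p <= 1/2 by nra.
have : 0 <= h * p * e ^+ 2 by rewrite mulr_ge0 ?sqr_ge0// mulr_ge0.
nra.
Qed.

(** Induction by the law of total variance: the mean of the conditional
    variance is bounded by the induction hypothesis, and the variance of the
    conditional mean, which is again of the form [addf w], by the case of one
    step. *)
Lemma lazy_var h u x K : 0 <= h <= 1/2 ->
  iter K (lazy h samp) (fun y => addf u y ^+ 2) x - iter K (lazy h samp) (addf u) x ^+ 2 <=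
  2 * B%:R * \sum_i (iter K (lazy (h * incl i) shft) (fun a => u i a ^+ 2) (x i) -
                     iter K (lazy (h * incl i) shft) (u i) (x i) ^+ 2).
Proof.
move=> h01; elim: K x => [|K IH] x.
  by rewrite /= subrr big1 ?mulr0// => i _; rewrite subrr.
set M := lazy h samp; pose b i := lazy (h * incl i) shft.
pose w i := iter K (b i) (u i).
have wE : iter K M (addf u) = addf w by apply/funext => y; exact: iter_lazy_samp_addf.
have /andP[h0 h1] := h01.
have Mlin : linop M by apply: linop_lazy; exact: linop_samp.
have Mpos : posop M.
  by apply: posop_lazy; [rewrite h0; lra|exact: posop_samp].
pose V i a := iter K (b i) (fun a => u i a ^+ 2) a - w i a ^+ 2.
have step1 : M (fun y => iter K M (fun y => addf u y ^+ 2) y - addf w y ^+ 2) x <=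
    M (addf (fun i a => 2 * B%:R * V i a)) x.
  apply: Mpos => y; rewrite /addf -mulr_sumr.
  by have := IH y; rewrite -/M wE.
have step2 := lazy_var_step h w x h01; rewrite -/M in step2.
have e1 : M (fun y => iter K M (fun y => addf u y ^+ 2) y - addf w y ^+ 2) x =
    M (iter K M (fun y => addf u y ^+ 2)) x - M (fun y => addf w y ^+ 2) x.
  have := Mlin 1 (-1) (iter K M (fun y => addf u y ^+ 2)) (fun y => addf w y ^+ 2) x.
  rewrite mul1r mulN1r => <-; congr M; apply/funext => y; ring.
rewrite e1 /M lazy_samp_addf -/M in step1.
rewrite !iterS -/M wE.
have -> : 2 * B%:R * (\sum_i (b i (iter K (b i) (fun a => u i a ^+ 2)) (x i) -
    b i (iter K (b i) (u i)) (x i) ^+ 2)) =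
  addf (fun i => b i (fun a => 2 * B%:R * V i a)) x +
  2 * B%:R * \sum_i (b i (fun a => w i a ^+ 2) (x i) - b i (w i) (x i) ^+ 2).
  rewrite /addf !mulr_sumr -big_split/=; apply: eq_bigr => i _.
  by rewrite /V /b /lazy /shft /w; ring.
rewrite /b in step1 step2 *; lra.
Qed.
End Sampling.

(** * Poisson numbers of samples *)
Section PoissonOperators.
Context {R : realType}.
Implicit Types (t M : R) (b : nat -> R).

Lemma pois_le t b b' M : 0 <= t -> (forall k, `|b k| <= M) -> (forall k, `|b' k| <= M) ->
  (forall k, b k <= b' k) -> pois t b <= pois t b'.
Proof.
move=> t0 bM bM' bb; rewrite /pois ler_wpM2l ?expR_ge0// egsum_le//; exact: expbd_bounded.
Qed.

Lemma pois_lin t b b' M a a' : (forall k, `|b k| <= M) -> (forall k, `|b' k| <= M) ->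
  pois t (fun k => a * b k + a' * b' k) = a * pois t b + a' * pois t b'.
Proof.
move=> /expbd_bounded eb /expbd_bounded eb'; rewrite /pois egsumD; try by expbd_tac.
rewrite !egsumZ; try by expbd_tac.
ring.
Qed.

Lemma pois_expr t (x : R) : pois t (fun k => x ^+ k) = expR (x * t - t).
Proof. by rewrite /pois egsum_expR -expRD addrC. Qed.

Lemma pois_cst t c : pois t (fun=> c) = c.
Proof.
rewrite /pois (_ : (fun=> c) = fun k => c * 1 ^+ k); last first.
  by apply/funext => k; rewrite expr1n mulr1.
rewrite egsumZ ?egsum_expR; last exact: expbdX.
by rewrite mul1r mulrCA -expRD addNr expR0 mulr1.
Qed.

Lemma pois_bounded t b M : 0 <= t -> (forall k, `|b k| <= M) -> `|pois t b| <= M.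
Proof.
move=> t0 bM; have M0 : 0 <= M := le_trans (normr_ge0 _) (bM 0%N).
rewrite ler_norml -{1}(pois_cst t (- M)) -{2}(pois_cst t M).
by rewrite !(pois_le _ _ _ M)// => k; rewrite ?normrN ?(ger0_norm M0)//;
  have := bM k; rewrite ler_norml => /andP[].
Qed.

Context {Y : Type}.
Implicit Types (T : (Y -> R) -> Y -> R) (psi phi : Y -> R).

Lemma poisop_le t T psi phi M : 0 <= t -> posop T -> unitop T ->
  (forall y, `|psi y| <= M) -> (forall y, `|phi y| <= M) ->
  (forall y, psi y <= phi y) -> forall y, poisop t T psi y <= poisop t T phi y.
Proof.
move=> t0 Tpos T1 bM bM' le_ y; apply: (pois_le _ _ _ M) => // k; try exact: iter_bounded.
by elim: k y => [//|k IH] y /=; exact: Tpos.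
Qed.

Lemma poisop_lin t T psi phi M a a' y : linop T -> posop T -> unitop T ->
  (forall y, `|psi y| <= M) -> (forall y, `|phi y| <= M) ->
  poisop t T (fun z => a * psi z + a' * phi z) y =
  a * poisop t T psi y + a' * poisop t T phi y.
Proof.
move=> Tlin Tpos T1 bM bM'.
rewrite /poisop -(pois_lin _ _ _ M) => [|k|k]; try exact: iter_bounded.
by congr pois; apply/funext => k; rewrite linop_iter.
Qed.

Lemma poisop_bounded t T psi M : 0 <= t -> posop T -> unitop T ->
  (forall y, `|psi y| <= M) -> forall y, `|poisop t T psi y| <= M.
Proof. by move=> t0 Tpos T1 bM y; apply: pois_bounded => // k; exact: iter_bounded. Qed.
End PoissonOperators.

Section PoissonSampling.
Context {R : realType} {I : finType} {X : Type}.
Variables (sigma : X -> X) (q : {set I} -> R) (B : nat).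
Hypotheses (q0 : forall A, 0 <= q A) (q1 : \sum_A q A = 1).
Hypothesis (qB : forall A : {set I}, (B < #|A|)%N -> q A = 0).
Variables (t : R) (u : I -> X -> R) (M : R).
Hypotheses (t0 : 0 <= t) (uM : forall i a, `|u i a| <= M).

Let S := samp sigma q.
Let Si i := poisop (t * incl q i) (shft sigma : (X -> R) -> X -> R).

Lemma addf_bounded x : `|addf u x| <= #|I|%:R * M.
Proof.
rewrite (le_trans (ler_norm_sum _ _ _))// (le_trans (ler_sum _ (fun i _ => uM i (x i))))//.
by rewrite sumr_const mulr_natl.
Qed.

Let tp0 i : 0 <= t * incl q i. Proof. by rewrite mulr_ge0// incl_ge0. Qed.

Let Si_cvg i (f : X -> R) M' a : (forall a, `|f a| <= M') ->
  iter n.+1 (lazy (t / n.+1%:R * incl q i) (shft sigma)) f a @[n --> \oo] --> Si i f a.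
Proof.
move=> fM; have := poisop_cvg _ _ f M' a (tp0 i) (linop_shft sigma) (posop_shft sigma) (unitop_shft sigma) fM.
rewrite (_ : (fun n => iter n.+1 (lazy (t * incl q i / n.+1%:R) (shft sigma)) f a) =
  fun n => iter n.+1 (lazy (t / n.+1%:R * incl q i) (shft sigma)) f a)//.
by apply/funext => n; rewrite mulrAC.
Qed.

(** The count of species [i] is a Poisson variable of parameter [t * incl i]:
    thinning is inherited from the lazy steps in the limit. *)
Lemma poisop_addf x : poisop t S (addf u) x = addf (fun i => Si i (u i)) x.
Proof.
have h := poisop_cvg _ _ (addf u) _ x t0 (linop_samp sigma q) (posop_samp sigma q q0)
  (unitop_samp sigma q q1) addf_bounded.
rewrite -(cvg_lim _ h)//; apply/cvg_lim => //.
under eq_cvg do rewrite iter_lazy_samp_addf//.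
rewrite /addf; apply: cvg_big => [|i _]; first exact: add_continuous.
exact: (Si_cvg i (u i) M).
Qed.

(** In the limit of lazy steps with [h = t / n]. *)
Lemma poisop_var x :
  poisop t S (fun y => addf u y ^+ 2) x - poisop t S (addf u) x ^+ 2 <=
  2 * B%:R * \sum_i (Si i (fun a => u i a ^+ 2) (x i) - Si i (u i) (x i) ^+ 2).
Proof.
have sqb (r N : R) : `|r| <= N -> `|r ^+ 2| <= N ^+ 2.
  by move=> rN; rewrite normrX lerXn2r ?nnegrE// (le_trans _ rN).
have h1 := poisop_cvg _ _ (addf u) _ x t0 (linop_samp sigma q) (posop_samp sigma q q0)
  (unitop_samp sigma q q1) addf_bounded.
have h2 := poisop_cvg _ _ (fun y => addf u y ^+ 2) _ x t0 (linop_samp sigma q) (posop_samp sigma q q0)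
  (unitop_samp sigma q q1) (fun y => sqb _ _ (addf_bounded y)).
have h3 : 2 * B%:R * \sum_i (
    iter n.+1 (lazy (t / n.+1%:R * incl q i) (shft sigma)) (fun a => u i a ^+ 2) (x i) -
    iter n.+1 (lazy (t / n.+1%:R * incl q i) (shft sigma)) (u i) (x i) ^+ 2) @[n --> \oo] -->
  2 * B%:R * \sum_i (Si i (fun a => u i a ^+ 2) (x i) - Si i (u i) (x i) ^+ 2).
  apply: cvgMl_tmp; apply: cvg_big => [|i _]; [exact: add_continuous|apply: cvgB].
    by apply: (Si_cvg _ _ (M ^+ 2)) => a; exact: sqb.
  rewrite expr2; under eq_cvg do rewrite expr2.
  by apply: cvgM; exact: (Si_cvg _ _ M).
have h4 := cvgB h2 (cvgM h1 h1).
rewrite [X in _ - X]expr2; apply: (ler_cvg_to (h4 _ _) h3).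
near=> n.
have n0 : 0 < n.+1%:R :> R by rewrite ltr0n.
have h01 : 0 <= t / n.+1%:R <= 1/2.
  rewrite divr_ge0//= ler_pdivrMr//.
  have : 2 * t < n.+1%:R by near: n; exact: near_natS.
  lra.
have := lazy_var sigma q B q0 q1 qB (t / n.+1%:R) u x n.+1 h01.
by rewrite [X in _ - X <= _]expr2.
Unshelve. all: by end_near. Qed.
End PoissonSampling.

(** The state of a species is the pair of its numbers of occurrences in the two
    expeditions. *)
Section TwoExpeditions.
Context {R : realType} {I : finType}.
Variables (q : {set I} -> R) (B : nat) (t t' : R) (u : I -> nat * nat -> R) (M : R).
Hypotheses (q0 : forall A, 0 <= q A) (q1 : \sum_A q A = 1).
Hypothesis (qB : forall A : {set I}, (B < #|A|)%N -> q A = 0).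
Hypotheses (t0 : 0 <= t) (t'0 : 0 <= t') (uM : forall i a, `|u i a| <= M).

Definition incr1 (a : nat * nat) := (a.1.+1, a.2).
Definition incr2 (a : nat * nat) := (a.1, a.2.+1).

Let S1 := poisop t (samp incr1 q).
Let S2 := poisop t' (samp incr2 q).
Definition expedition (s s' : R) (f : nat * nat -> R) a :=
  poisop s (shft incr1) (poisop s' (shft incr2) f) a.

Let s1 i := poisop (t * incl q i) (shft incr1 : (nat * nat -> R) -> _).
Let s2 i := poisop (t' * incl q i) (shft incr2 : (nat * nat -> R) -> _).

(** The law of total variance once more, over the two expeditions, with the
    variance of each species bounded by its second moment. *)
Lemma expedition_var x :
  S1 (S2 (fun y => addf u y ^+ 2)) x <=
  (\sum_i s1 i (s2 i (u i)) (x i)) ^+ 2 +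
  2 * B%:R * \sum_i s1 i (s2 i (fun a => u i a ^+ 2)) (x i).
Proof.
have sqb (r N : R) : `|r| <= N -> `|r ^+ 2| <= N ^+ 2.
  by move=> rN; rewrite normrX lerXn2r ?nnegrE// (le_trans _ rN).
have tp0 i : 0 <= t * incl q i by rewrite mulr_ge0// incl_ge0.
have tp0' i : 0 <= t' * incl q i by rewrite mulr_ge0// incl_ge0.
pose N := #|I|%:R * M.
pose w i := s2 i (u i); pose v i := s2 i (fun a => u i a ^+ 2).
have wM i a : `|w i a| <= M.
  by apply: poisop_bounded => //; exact: posop_shft.
have vM i a : `|v i a| <= M ^+ 2.
  by apply: poisop_bounded => //; [exact: posop_shft|move=> y; exact: sqb].
have pS := posop_samp incr1 q q0; have uS := unitop_samp incr1 q q1.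
have lS := linop_samp incr1 q.
have pS2 := posop_samp incr2 q q0; have uS2 := unitop_samp incr2 q q1.
pose g i a := 2 * B%:R * (v i a - w i a ^+ 2).
have gM i a : `|g i a| <= 2 * B%:R * (M ^+ 2 + M ^+ 2).
  rewrite /g normrM ger0_norm ?mulr_ge0// ler_wpM2l ?mulr_ge0//.
  by rewrite (le_trans (ler_normB _ _))// lerD ?vM ?sqb ?wM.
have zM y : `|addf u y ^+ 2| <= N ^+ 2 by apply: sqb; exact: addf_bounded.
have awM y : `|addf w y ^+ 2| <= N ^+ 2 by apply: sqb; exact: addf_bounded.
have agM y := addf_bounded g _ gM y.
set G0 := #|I|%:R * _ in agM.
pose K := N ^+ 2 + G0.
have G00 : 0 <= G0 by rewrite (le_trans _ (agM (fun=> (0, 0)%N))).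
have N0 : 0 <= N ^+ 2 by exact: sqr_ge0.
have step2 y : S2 (fun y => addf u y ^+ 2) y <= 1 * addf w y ^+ 2 + 1 * addf g y.
  have := poisop_var incr2 q B q0 q1 qB t' u M t'0 uM y.
  rewrite (poisop_addf incr2 q q0 q1 t' u M t'0 uM) /addf -/S2 -/(addf _ _).
  rewrite !mul1r -mulr_sumr -/(addf w y); rewrite /v /w /s2; lra.
have mono : S1 (S2 (fun y => addf u y ^+ 2)) x <=
    S1 (fun y => 1 * addf w y ^+ 2 + 1 * addf g y) x.
  apply: (poisop_le _ _ _ _ K) => // y.
    rewrite (@le_trans _ _ (N ^+ 2))//; last by rewrite /K; lra.
    exact: poisop_bounded.
  by rewrite !mul1r (le_trans (ler_normD _ _))// /K lerD.
apply: (le_trans mono); rewrite /S1 (poisop_lin _ _ _ _ K) => //; first last.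
- by move=> y; rewrite (le_trans (agM y))// /K; lra.
- by move=> y; rewrite (le_trans (awM y))// /K; lra.
rewrite !mul1r.
have := poisop_var incr1 q B q0 q1 qB t w M t0 wM x.
rewrite (poisop_addf incr1 q q0 q1 t w M t0 wM).
rewrite (poisop_addf incr1 q q0 q1 t g _ t0 gM).
have -> : addf (fun i => poisop (t * incl q i) (shft incr1) (g i)) x =
    2 * B%:R * \sum_i (s1 i (v i) (x i) - s1 i (fun a => w i a ^+ 2) (x i)).
  rewrite /addf mulr_sumr; apply: eq_bigr => i _.
  rewrite /g (_ : (fun a => _) = fun a => 2 * B%:R * v i a + (- (2 * B%:R)) * w i a ^+ 2); last first.
    by apply/funext => a; ring.
  rewrite (poisop_lin _ _ _ _ (M ^+ 2) _ _ _ (linop_shft incr1) (posop_shft incr1)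
    (unitop_shft incr1) (vM i) (fun a => sqb _ _ (wM i a))).
  by rewrite /s1; ring.
rewrite /addf -/s1.
set V1 := \sum_i (_ - _); set V2 := \sum_i (_ - _).
set W := \sum_i poisop _ _ _ _.
have : V1 + V2 <= \sum_i s1 i (v i) (x i).
  rewrite /V1 /V2 -big_split/=; apply: ler_sum => i _.
  by rewrite -/(s1 i); have := sqr_ge0 (s1 i (w i) (x i)); lra.
have B0 : 0 <= 2 * B%:R :> R by rewrite mulr_ge0.
move=> /(ler_wpM2l B0); rewrite mulrDr; rewrite /W -/s1; lra.
Qed.
End TwoExpeditions.

(** * The contribution of one species *)
Section SpeciesTerm.
Context {R : realType}.
Implicit Types (h : nat -> R) (a : nat * nat).

(** The term of a species in the estimator minus the indicator that the second
    expedition is the first one to see it. *)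
Definition gap h a : R := h a.1 - ((a.1 == 0%N) && (0 < a.2)%N)%:R.

Lemma gap_bounded h M : (forall k, `|h k| <= M) -> forall a, `|gap h a| <= M + 1.
Proof.
move=> hM a; rewrite /gap (le_trans (ler_normB _ _))// lerD// normr_nat.
by case: (_ && _).
Qed.

Lemma iter_shft {X : Type} (sigma : X -> X) (f : X -> R) k (a : X) :
  iter k (shft sigma) f a = f (iter k sigma a).
Proof. by elim: k a => [//|k IH] a; rewrite iterS /shft iterSr IH. Qed.

Lemma iter_incr1 k a : iter k incr1 a = ((a.1 + k)%N, a.2).
Proof.
by elim: k => [|k IH]; rewrite ?addn0 -?surjective_pairing// iterS IH /incr1/= addnS.
Qed.

Lemma iter_incr2 k a : iter k incr2 a = (a.1, (a.2 + k)%N).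
Proof.
by elim: k => [|k IH]; rewrite ?addn0 -?surjective_pairing// iterS IH /incr2/= addnS.
Qed.

Lemma expeditionE (s s' : R) (f : nat * nat -> R) :
  expedition s s' f (0, 0)%N = pois s (fun k => pois s' (fun l => f (k, l))).
Proof.
rewrite /expedition /poisop; congr pois; apply/funext => k.
rewrite iter_shft iter_incr1; congr pois; apply/funext => l.
by rewrite iter_shft iter_incr2.
Qed.

Lemma bool_bounded (b : bool) : `|b%:R| <= 1 :> R.
Proof. by rewrite normr_nat; case: b. Qed.

Lemma pois_pos (s : R) : pois s (fun l => (0 < l)%N%:R) = 1 - expR (- s).
Proof.
rewrite (_ : (fun l => _) = fun l => 1 * 1 ^+ l + (-1) * 0 ^+ l); last first.
  by apply/funext => -[|l]; rewrite !expr0n expr1n/= ?mulr1 ?mulr0 ?addr0// subrr.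
rewrite (pois_lin _ _ _ 1) => [|k|k]; last 2 first.
- by rewrite expr1n normr1.
- by rewrite expr0n; exact: bool_bounded.
by rewrite !pois_expr !mul1r subrr expR0 mul0r add0r mulN1r.
Qed.

(** The sum of [h k] over the Poisson weights is [expR (- s) * egsum h s], and
    the event that is subtracted has probability
    [expR (- s) * (1 - expR (- s'))]. *)
Lemma expedition_gap (s s' : R) h M : (forall k, `|h k| <= M) ->
  expedition s s' (gap h) (0, 0)%N = expR (- s) * (egsum h s - (1 - expR (- s'))).
Proof.
move=> hM; have M0 : 0 <= M := le_trans (normr_ge0 _) (hM 0%N).
have hM1 k : `|h k| <= M + 1 by rewrite (le_trans (hM k))// lerDl.
have bM (b : bool) : `|b%:R| <= M + 1 by rewrite (le_trans (bool_bounded b))// lerDr.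
rewrite expeditionE.
have -> : (fun k => pois s' (fun l => gap h (k, l))) =
    fun k => 1 * h k + (- (1 - expR (- s'))) * 0 ^+ k.
  apply/funext => k; rewrite -pois_pos /gap/=.
  rewrite (_ : (fun l => _) = fun l => h k * 1 + (- 0 ^+ k) * (0 < l)%N%:R); last first.
    apply/funext => l; rewrite expr0n mulr1; congr (_ + _).
    by case: (k == _); case: (0 < l)%N; rewrite ?mulr1 ?mulr0 ?oppr0 ?mul0r.
  rewrite (pois_lin _ _ _ 1) => [|j|j]; last 2 first.
  - by rewrite normr1.
  - exact: bool_bounded.
  by rewrite pois_cst; ring.
rewrite (pois_lin _ _ _ (M + 1)) => [|k|k]; last 2 first.
- exact: hM1.
- by rewrite expr0n.
by rewrite pois_expr mul0r add0r /pois; ring.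
Qed.

(** There is no cross term: the indicator is nonzero only if the first count is
    0, where [h] vanishes. *)
Lemma expedition_gap_sqr (s s' : R) h M : (forall k, `|h k| <= M) -> h 0%N = 0 ->
  expedition s s' (fun a => gap h a ^+ 2) (0, 0)%N =
  expR (- s) * (egsum (fun k => h k ^+ 2) s + (1 - expR (- s'))).
Proof.
move=> hM h0; have M0 : 0 <= M := le_trans (normr_ge0 _) (hM 0%N).
have hM1 k : `|h k ^+ 2| <= M ^+ 2 + 1.
  by rewrite normrX (@le_trans _ _ (M ^+ 2)) ?lerDl// lerXn2r ?nnegrE.
have bM (b : bool) : `|b%:R| <= M ^+ 2 + 1.
  by rewrite (le_trans (bool_bounded b))// lerDr sqr_ge0.
rewrite expeditionE.
have -> : (fun k => pois s' (fun l => gap h (k, l) ^+ 2)) =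
    fun k => 1 * h k ^+ 2 + (1 - expR (- s')) * 0 ^+ k.
  apply/funext => k; rewrite -pois_pos /gap/=.
  rewrite (_ : (fun l => _) = fun l => h k ^+ 2 * 1 + 0 ^+ k * (0 < l)%N%:R); last first.
    apply/funext => l; rewrite expr0n mulr1; case: k => [|k] /=.
      by rewrite h0 sub0r sqrrN expr0n add0r mul1r; case: (0 < l)%N; rewrite ?expr1n ?expr0n.
    by rewrite subr0 mul0r addr0.
  rewrite (pois_lin _ _ _ 1) => [|j|j]; last 2 first.
  - by rewrite normr1.
  - exact: bool_bounded.
  by rewrite pois_cst; ring.
rewrite (pois_lin _ _ _ (M ^+ 2 + 1)) => [|k|k]; last 2 first.
- exact: hM1.
- by rewrite expr0n.
by rewrite pois_expr mul0r add0r /pois; ring.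
Qed.
End SpeciesTerm.

(** * Truncated coefficients *)

(** With finitely many nonzero coefficients the term of a species is bounded,
    as needed for the limits above.  The bias then moves by a tail of an
    absolutely convergent series, and the second moment decreases. *)
Section Truncation.
Context {R : realType}.
Variables (H : nat -> R) (t : R).
Hypotheses (H0 : H 0%N = 0) (t0 : 0 < t).
Hypothesis (Hcvg : cvgn (series (fun k => H k ^+ 2 * t ^+ k / k`!%:R))).

Definition cutoff K k : R := if (k < K)%N then H k else 0.

Let a k : R := `|H k| * t ^+ k / k`!%:R.

Let e_ge0 k : 0 <= t ^+ k / k`!%:R. Proof. by rewrite divr_ge0// exprn_ge0// ltW. Qed.

Lemma abs_cvg : cvgn (series a).
Proof.
apply: (@series_le_cvg _ _ (fun k => H k ^+ 2 * t ^+ k / k`!%:R + exp_coeff t k)) => [k|k|k|].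
- by rewrite /a -mulrA mulr_ge0.
- have h : 0 <= H k ^+ 2 * (t ^+ k / k`!%:R) by rewrite mulr_ge0 ?sqr_ge0.
  by rewrite -mulrA addr_ge0// /exp_coeff/= e_ge0.
- have h : `|H k| <= H k ^+ 2 + 1.
    have := sqr_ge0 (`|H k| - 1); rewrite -[H k ^+ 2]real_normK ?num_real//.
    have := normr_ge0 (H k); nra.
  by have := ler_wpM2r (e_ge0 k) h; rewrite mulrDl mul1r !mulrA.
- by apply: is_cvg_seriesD => //; exact: is_cvg_series_exp_coeff.
Qed.

Definition tail K : R := limn (series a) - series a K.

Lemma tail_cvg : tail K @[K --> \oo] --> 0.
Proof.
rewrite -[X in _ --> X](subrr (limn (series a))); apply: cvgB; first exact: cvg_cst.
exact: abs_cvg.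
Qed.

(* The factor [p] is kept, as the sum over the species of the inclusion
   probabilities is all that is bounded. *)
Let powle p k : 0 <= p <= 1 -> (0 < k)%N -> (p * t) ^+ k <= p * t ^+ k.
Proof.
move=> /andP[p0 p1] k0; rewrite exprMn ler_wpM2r ?(exprn_ge0 _ (ltW t0))//.
by case: k k0 => // k _; rewrite exprS ler_piMr// exprn_ile1.
Qed.

Lemma egf_cutoff_dist p K : 0 <= p <= 1 ->
  `|egf H (p * t) - egsum (cutoff K) (p * t)| <= p * tail K.
Proof.
move=> p01; have /andP[p0 p1] := p01.
have ple k : `|H k / k`!%:R * (p * t) ^+ k| <= p * a k.
  rewrite normrM normrM normfV normr_nat [X in _ * X]ger0_norm ?exprn_ge0 ?mulr_ge0 ?(ltW t0)//.
  case: k => [|k]; first by rewrite H0 normr0 !mul0r /a H0 normr0 !mul0r mulr0.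
  rewrite /a [leRHS](_ : _ = `|H k.+1| / k.+1`!%:R * (p * t ^+ k.+1)); last by ring.
  by rewrite ler_wpM2l ?divr_ge0// powle.
have tr : egsum (cutoff K) (p * t) = \sum_(0 <= k < K) H k / k`!%:R * (p * t) ^+ k.
  rewrite /egsum; apply/cvg_lim => //; apply: cvg_near_cst; near=> n.
  have Kn : (K <= n)%N by near: n; exact: nbhs_infty_ge.
  rewrite /pseries /series/= (big_cat_nat _ Kn)//=.
  have -> : \sum_(K <= k < n) cutoff K k / k`!%:R * (p * t) ^+ k = 0.
    rewrite big_nat_cond big1// => k /andP[/andP[Kk _] _].
    by rewrite /cutoff ltnNge Kk/= !mul0r.
  rewrite addr0; apply: eq_big_nat => k /andP[_ kK]; by rewrite /cutoff kK.
have scvg : cvgn (series (fun k => H k / k`!%:R * (p * t) ^+ k)).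
  apply: normed_cvg; apply: (@series_le_cvg _ _ (fun k => p * a k)) => [k|k|k|].
  - exact: normr_ge0.
  - by rewrite mulr_ge0// /a -mulrA mulr_ge0.
  - exact: ple.
  - by apply: is_cvg_seriesZ; exact: abs_cvg.
have eE : egf H (p * t) = limn (series (fun k => H k / k`!%:R * (p * t) ^+ k)).
  rewrite /egf; congr (limn _); apply/funext => -[|n]; first by rewrite /series/= !big_geq.
  by rewrite /series/= [RHS]big_ltn// H0 !mul0r add0r.
have d : `|series (fun k => H k / k`!%:R * (p * t) ^+ k) n - egsum (cutoff K) (p * t)| @[n --> \oo] -->
   `|egf H (p * t) - egsum (cutoff K) (p * t)|.
  by apply: cvg_norm; apply: cvgB; [rewrite eE|exact: cvg_cst].
rewrite -(cvg_lim _ d)//; apply: limr_le; first by apply/cvg_ex; eexists; exact: d.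
near=> n; have Kn : (K <= n)%N by near: n; exact: nbhs_infty_ge.
rewrite tr {1}/series/= (big_cat_nat _ Kn)//= [X in X - _]addrC addrK.
rewrite (le_trans (ler_norm_sum _ _ _))// (le_trans (ler_sum _ (fun k _ => ple k)))//.
rewrite -mulr_sumr ler_wpM2l// /tail lerBrDl {1}/series/= -big_cat_nat//=.
apply: (nondecreasing_cvgn_le _ abs_cvg).
apply/nondecreasing_seqP => k; rewrite /series/= big_nat_recr//= lerDl.
by rewrite /a -mulrA mulr_ge0.
Unshelve. all: by end_near. Qed.

Lemma egsum_cutoff_sqr_le p K : 0 <= p <= 1 ->
  egsum (fun k => cutoff K k ^+ 2) (p * t) <= egf (fun k => H k ^+ 2) (p * t).
Proof.
move=> /andP[p0 p1]; have pt0 : 0 <= p * t by rewrite mulr_ge0// ltW.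
have eE : egf (fun k => H k ^+ 2) (p * t) =
    limn (series (fun k => H k ^+ 2 / k`!%:R * (p * t) ^+ k)).
  rewrite /egf; congr (limn _); apply/funext => -[|n]; first by rewrite /series/= !big_geq.
  by rewrite /series/= [RHS]big_ltn// H0 expr0n !mul0r add0r.
have scvg : cvgn (series (fun k => H k ^+ 2 / k`!%:R * (p * t) ^+ k)).
  apply: (@series_le_cvg _ _ (fun k => H k ^+ 2 * t ^+ k / k`!%:R)) => [k|k|k|//].
  - by rewrite mulr_ge0 ?exprn_ge0// divr_ge0 ?sqr_ge0.
  - by rewrite -mulrA mulr_ge0 ?sqr_ge0.
  - rewrite mulrAC ler_wpM2r// ler_wpM2l ?sqr_ge0// lerXn2r ?nnegrE//; first exact: ltW.
    by rewrite -[leRHS]mul1r ler_wpM2r// ltW.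
rewrite eE /egsum; apply: ler_lim => //.
  apply: (egsum_cvg (fun k => cutoff K k ^+ 2)).
  exists (\sum_(k < K) H k ^+ 2), 1 => k; rewrite expr1n mulr1 ger0_norm ?sqr_ge0// /cutoff.
  case: ltnP => kK; last by rewrite expr0n sumr_ge0// => i _; exact: sqr_ge0.
  by rewrite (bigD1 (Ordinal kK))//= lerDl sumr_ge0// => i _; exact: sqr_ge0.
apply: nearW => n; rewrite /pseries /series/=; apply: ler_sum => k _.
rewrite ler_wpM2r ?exprn_ge0// ler_wpM2r// /cutoff; case: ifP => // _.
by rewrite expr0n sqr_ge0.
Qed.

Lemma cutoff_bounded K : exists M, forall k, `|cutoff K k| <= M.
Proof.
exists (\sum_(k < K) `|H k|) => k; rewrite /cutoff.
case: ltnP => kK; last by rewrite normr0 sumr_ge0.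
by rewrite (bigD1 (Ordinal kK))//= lerDl sumr_ge0.
Qed.

Lemma cutoff0 K : cutoff K 0 = 0.
Proof. by rewrite /cutoff H0; case: ifP. Qed.

End Truncation.

(** * Second moment of the error for finitely many species *)
Section TruncatedRisk.
Context {R : realType} {I : finType}.
Variables (q : {set I} -> R) (B : nat) (r t : R) (H : nat -> R) (beta v : R).
Hypotheses (q0 : forall A, 0 <= q A) (q1 : \sum_A q A = 1).
Hypothesis (qB : forall A : {set I}, (B < #|A|)%N -> q A = 0).
Hypotheses (r0 : 0 < r) (t0 : 0 < t) (H0 : H 0%N = 0).
Hypothesis (Hcvg : cvgn (series (fun k => H k ^+ 2 * t ^+ k / k`!%:R))).
Hypothesis (Hbeta : forall p, 0 <= p <= 1 -> bias_fun r t H p <= beta).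
Hypothesis (Hv : forall p, 0 <= p <= 1 -> var_fun r t H p <= v).

Lemma cutoff_mean_le p K : 0 <= p <= 1 ->
  `|expR (- (t * p)) * (egsum (cutoff H K) (t * p) - (1 - expR (- (r * t * p))))| <=
  p * (beta + tail H t K).
Proof.
move=> p01; have /andP[p0 p1] := p01.
have [->|pn0] := eqVneq p 0.
  by rewrite !mulr0 mul0r oppr0 expR0 subrr subr0 egsum0 cutoff0// mulr0 normr0.
have p0' : 0 < p by rewrite lt_neqAle eq_sym pn0.
have := Hbeta p p01; rewrite /bias_fun (negbTE pn0) mulrAC ler_pdivrMr// => hb.
have hd := egf_cutoff_dist H t H0 t0 Hcvg p K p01.
rewrite (mulrC t p) (_ : r * t * p = r * p * t); last by ring.
set e := expR (- (p * t)) in hb *; set E := expR _ in hb *.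
have e0 : 0 <= e := expR_ge0 _.
have e1 : e <= 1 by rewrite expR_le1 oppr_le0 mulr_ge0// ltW.
rewrite normrM (ger0_norm e0).
rewrite (_ : _ - (1 - E) = - ((1 - E - egf H (p * t)) + (egf H (p * t) - egsum (cutoff H K) (p * t)))); last by ring.
rewrite normrN (le_trans (ler_wpM2l e0 (ler_normD _ _)))// mulrDr mulrDr lerD//.
  by rewrite [leRHS]mulrC.
by rewrite (le_trans _ hd)// ler_piMl.
Qed.

Lemma cutoff_sqr_le p K : 0 <= p <= 1 ->
  expR (- (t * p)) * (egsum (fun k => cutoff H K k ^+ 2) (t * p) + (1 - expR (- (r * t * p)))) <=
  p * v.
Proof.
move=> p01; have /andP[p0 p1] := p01.
have [->|pn0] := eqVneq p 0.
  by rewrite !mulr0 mul0r oppr0 expR0 subrr addr0 egsum0 cutoff0// expr0n mulr0.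
have p0' : 0 < p by rewrite lt_neqAle eq_sym pn0.
have := Hv p p01; rewrite /var_fun (negbTE pn0) mulrAC ler_pdivrMr// => hb.
have hd := egsum_cutoff_sqr_le H t H0 t0 Hcvg p K p01.
rewrite (mulrC t p) (_ : r * t * p = r * p * t); last by ring.
rewrite (mulrC p v) (le_trans _ hb)// ler_wpM2l ?expR_ge0//; lra.
Qed.

(** The mean and the second moment of the term of species [i] are [incl i] times
    quantities bounded by [beta + tail] and [v], and the [incl i] sum to at most
    [B]. *)
Lemma cutoff_risk_le K :
  poisop t (samp incr1 q) (poisop (r * t) (samp incr2 q)
    (fun y => addf (fun _ : I => gap (cutoff H K)) y ^+ 2)) (fun=> (0, 0)%N) <=
  (B%:R * (beta + tail H t K)) ^+ 2 + 2 * B%:R ^+ 2 * v.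
Proof.
have [M hM] := cutoff_bounded H K.
have rt0 : 0 <= r * t by rewrite mulr_ge0// ltW.
have v0 : 0 <= v.
  apply: le_trans (Hv 0 _); last by rewrite lexx ler01.
  by rewrite /var_fun eqxx mulr_ge0 ?addr_ge0 ?sqr_ge0// ltW.
apply: le_trans (expedition_var q B t (r * t) (fun _ : I => gap (cutoff H K)) (M + 1)
  q0 q1 qB (ltW t0) rt0 (fun _ => gap_bounded _ _ hM) _) _.
have p01 i : 0 <= incl q i <= 1 by rewrite incl_ge0// incl_le1.
have sum_le (c : R) : 0 <= c -> \sum_i incl q i * c <= B%:R * c.
  by move=> c0; rewrite -mulr_suml ler_wpM2r// sum_incl_le.
apply: lerD.
  have bt0 : 0 <= beta + tail H t K.
    have := cutoff_mean_le 1 K; rewrite mul1r ler01 lexx => /(_ isT).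
    exact: le_trans.
  rewrite -[leLHS]real_normK ?num_real// lerXn2r ?nnegrE ?mulr_ge0//.
  rewrite (le_trans (ler_norm_sum _ _ _))// (le_trans _ (sum_le _ bt0))//.
  apply: ler_sum => i _.
  have := expedition_gap (t * incl q i) (r * t * incl q i) _ _ hM.
  by rewrite /expedition => ->; rewrite cutoff_mean_le.
rewrite (_ : 2 * B%:R ^+ 2 * v = 2 * B%:R * (B%:R * v)); last by ring.
rewrite ler_wpM2l ?mulr_ge0// (le_trans _ (sum_le _ v0))//.
apply: ler_sum => i _.
have := expedition_gap_sqr (t * incl q i) (r * t * incl q i) _ _ hM (cutoff0 H H0 K).
by rewrite /expedition => ->; rewrite cutoff_sqr_le.
Qed.
End TruncatedRisk.

(** * The law of the observed species *)

(** Species are named by their codes in the countable type, and only the codes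
    below [K] are observed, which reduces to finitely many species. *)
Section Law.
Context {R : realType} {S : countType}.
Variables (mu : probability (subsets S) R) (K : nat).
Local Notation I := 'I_K.

Definition has_code (A : set S) (j : nat) := exists2 s : S, choice.pickle s = j & A s.

Definition obs (A : set S) : {set I} := [set j : I | `[< has_code A j >]]%SET.

Lemma measurable_cyl (s : S) : measurable ([set A : set S | A s] : set (subsets S)).
Proof. by apply: sub_sigma_algebra; exists s. Qed.

Lemma measurable_has_code j : measurable ([set A : set S | has_code A j] : set (subsets S)).
Proof.
rewrite (_ : mkset _ = \bigcup_(s in [set s : S | choice.pickle s = j]) [set A : set S | A s]); last first.
  by apply/seteqP; split => A /= [s]; exists s.
rewrite bigcup_mkcond; apply: countable_bigcupT_measurable; first exact: countableP.
by move=> s; case: ifP => _ //; exact: measurable_cyl.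
Qed.

Lemma measurable_obs (a : {set I}) : measurable ([set A : set S | obs A = a] : set (subsets S)).
Proof.
pose D (j : I) : set (subsets S) :=
  if j \in a then [set A : set S | has_code A j] else ~` [set A : set S | has_code A j].
rewrite (_ : mkset _ = \bigcap_(j in [set: I]) D j); last first.
  apply/seteqP; split => [A /= Aa j _|A /= DA].
    by rewrite /D -Aa inE; case: asboolP.
  apply/setP => j; have := DA j Logic.I; rewrite /D inE.
  by case: ifP => ja /= h; apply/asboolP.
apply: fin_bigcap_measurable; first exact: finite_finset.
move=> j _; rewrite /D; case: ifP => _; first exact: measurable_has_code.
by apply: measurableC; exact: measurable_has_code.
Qed.

Definition obs_pmf (a : {set I}) : R := fine (mu [set A : set S | obs A = a]).

Lemma obs_pmfE a : mu [set A : set S | obs A = a] = (obs_pmf a)%:E.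
Proof. by rewrite /obs_pmf fineK// fin_num_measure//; exact: measurable_obs. Qed.

Lemma obs_pmf_ge0 a : 0 <= obs_pmf a.
Proof. exact: fine_ge0. Qed.

Lemma obs_pmf_sum : \sum_a obs_pmf a = 1.
Proof.
have : mu [set: subsets S] = 1%E by exact: probability_setT.
rewrite (_ : setT = \bigcup_(a in [set` index_enum {set I}]) [set A : set S | obs A = a]); last first.
  by apply/seteqP; split => // A _; exists (obs A) => //=; rewrite mem_index_enum.
rewrite measure_fin_bigcup//; last 2 first.
- by move=> a b _ _ [A /= [<- <-]].
- by move=> a _; exact: measurable_obs.
rewrite -fsbig_seq ?index_enum_uniq//= => h; apply: EFin_inj; rewrite -h -sumEFin.
by apply: eq_bigr => a _; rewrite obs_pmfE.
Qed.

Lemma measurable_singleton (A : set S) : measurable ([set A] : set (subsets S)).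
Proof.
pose D (s : S) : set (subsets S) :=
  if `[< A s >] then [set A : set S | A s] else ~` [set A : set S | A s].
rewrite (_ : [set A] = ~` \bigcup_(s in [set: S]) ~` D s); last first.
  rewrite setC_bigcup; apply/seteqP; split => [_ -> s _|B DB].
    by rewrite setCK /D; case: asboolP.
  apply/funext => s; apply/propext; have := DB s Logic.I.
  by rewrite setCK /D; case: asboolP => /=; split.
apply: measurableC; apply: countable_bigcupT_measurable; first exact: countableP.
move=> s; apply: measurableC; rewrite /D; case: ifP => _; first exact: measurable_cyl.
by apply: measurableC; exact: measurable_cyl.
Qed.

Lemma finite_sets_bigcup : [set A : set S | finite_set A] =
  \bigcup_(F in [set: {fset S}]) [set [set` F]].
Proof.
apply/seteqP; split => [A /= fA|_ [F _ ->]]; last exact: finite_fset.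
by exists (fset_set A) => //=; rewrite fset_setK.
Qed.

Lemma measurable_finite_sets :
  measurable ([set A : set S | finite_set A] : set (subsets S)).
Proof.
rewrite finite_sets_bigcup; apply: countable_bigcupT_measurable; first exact: countableP.
by move=> F; exact: measurable_singleton.
Qed.

Lemma finite_sets_prob : finitely_supported mu ->
  mu (~` [set A : set S | finite_set A]) = 0%E.
Proof.
move=> mufin; apply: etrans (probability_setC mu measurable_finite_sets) _.
by rewrite [X in (_ - X)%E](mufin : _ = 1%E) subee.
Qed.

(** If more than [B] codes are observed then the set is infinite, or is one of
    the countably many finite sets that have more than [B] elements; both events
    are negligible. *)
Lemma obs_pmf_eq0 B : finitely_supported mu -> size_bounded mu B ->
  forall a : {set I}, (B < #|a|)%N -> obs_pmf a = 0.
Proof.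
move=> mufin muB a Ba; rewrite /obs_pmf measure_negligible//; first exact: measurable_obs.
pose N (k : nat) : set (subsets S) :=
  if (choice.unpickle k : option {fset S}) is Some F then
    if ([set` F] #<= `I_B)%card then set0 else [set [set` F]] else set0.
have neg : mu.-negligible ((~` [set A : set S | finite_set A] `|` \bigcup_k N k) : set (subsets S)).
  apply: negligibleU.
    apply/negligibleP; first by apply: measurableC; exact: measurable_finite_sets.
    exact: finite_sets_prob.
  apply: negligible_bigcup => k; rewrite /N; case: (choice.unpickle k) => [F|]; last exact: negligible_set0.
  case: ifPn => FB; first exact: negligible_set0.
  apply/negligibleP; first exact: measurable_singleton.
  exact: muB.
apply: negligibleS neg => A /= obsA.
have [fA|] := pselect (finite_set A); [right|by left].
exists (choice.pickle (fset_set A)) => //; rewrite /N choice.pickleK fset_setK//.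
case: ifPn => // AB; exfalso; move: Ba; rewrite ltnNge => /negP; apply.
apply: (@leq_trans #|` fset_set A|); last by apply: geq_card_fset_set.
rewrite -(size_map choice.pickle) cardE -(size_map val); apply: uniq_leq_size.
  by rewrite map_inj_uniq ?enum_uniq//; exact: val_inj.
move=> x /mapP[j]; rewrite mem_enum -obsA inE => /asboolP[s sj As] ->.
by apply/mapP; exists s => //; rewrite in_fset_set// inE.
Qed.

End Law.

(** * Expectation of a function of the counts *)

Lemma measurable_fun_countable (d : measure_display) (T : measurableType d)
    (R : realType) (C : countType) (g : T -> C) (F : C -> R) :
  (forall c, measurable [set w | g w = c]) -> measurable_fun setT (fun w => F (g w)).
Proof.
move=> mg _ Y mY; rewrite setTI.
rewrite (_ : _ @^-1` _ = \bigcup_(c in [set c | Y (F c)]) [set w | g w = c]); last first.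
  apply/seteqP; split => [w /= YF|w [c /= YF gc]]; first by exists (g w).
  by rewrite /= gc.
rewrite bigcup_mkcond; apply: countable_bigcupT_measurable; first exact: countableP.
by move=> c; case: ifP.
Qed.

Section PoissonSeries.
Context {R : realType}.

Lemma pois_series (t c : R) (b : nat -> R) (M : R) : 0 < t -> (forall k, `|b k| <= M) ->
  (\sum_(k <oo) (c * poisson_pmf t k * b k)%:E = (c * pois t b)%:E)%E.
Proof.
move=> t0 bM; apply/cvg_lim => //.
rewrite (_ : (fun n => _) = EFin \o (fun n =>
  (c * expR (- t)) * pseries (fun k => b k / k`!%:R) t n)); last first.
  apply/funext => n /=; rewrite sumEFin; congr EFin.
  rewrite /pseries /series/= mulr_sumr; apply: eq_bigr => k _.
  by rewrite /poisson_pmf t0; ring.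
apply: cvg_EFin; first by apply: nearW.
rewrite /pois mulrA; apply: cvgMl_tmp.
by apply: egsum_cvg; exact: expbd_bounded bM.
Qed.

Lemma pois_sum {T : Type} (t M : R) (r : seq T) (c : T -> R) (b : T -> nat -> R) :
  (forall a k, `|b a k| <= M) ->
  pois t (fun k => \sum_(a <- r) c a * b a k) = \sum_(a <- r) c a * pois t (b a).
Proof.
move=> bM; have eb a : expbd (b a) := expbd_bounded _ _ (bM a).
rewrite /pois; suff [_ ->] : expbd (fun k => \sum_(a <- r) c a * b a k) /\
    egsum (fun k => \sum_(a <- r) c a * b a k) t = \sum_(a <- r) c a * egsum (b a) t.
  by rewrite mulr_sumr; apply: eq_bigr => a _; rewrite mulrCA.
elim: r => [|a r [IH1 IH2]].
  split; first by exists 0, 0 => k; rewrite big_nil normr0 mul0r.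
  by rewrite big_nil (_ : (fun k => _) = fun k => 0 * 0 ^+ k) ?egsumZ ?mul0r//;
    [exact: expbdX|apply/funext => k; rewrite big_nil mul0r].
have -> : (fun k => \sum_(a0 <- a :: r) c a0 * b a0 k) =
    fun k => c a * b a k + \sum_(a0 <- r) c a0 * b a0 k.
  by apply/funext => k; rewrite big_cons.
have e1 := expbdZ _ (c a) (eb a); split; first exact: expbdD.
by rewrite big_cons egsumD// egsumZ// IH2.
Qed.
End PoissonSeries.

Section SampleEvents.
Context {S : countType} {R : realType} {d : measure_display}.
Context {Omega : measurableType d} (P : probability Omega R).
Variables (X : nat -> {RV P >-> subsets S}) (n m : {RV P >-> nat}).
Variables (mu : probability (subsets S) R) (t t' : R) (K : nat).
Hypothesis (smp : poissonized_sampling X n m mu t t').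
Hypotheses (t0 : 0 < t) (t'0 : 0 < t').
Local Notation I := 'I_K.
Implicit Types (s : seq {set I}) (k l : nat).

Let q := obs_pmf mu K.
Let set0I : {set I} := finset.set0.

(** The sizes of both expeditions are fixed and the first sampled sets are
    revealed.  Integrals over these events are computed by backward induction
    on the number of revealed sets. *)
Definition sample_event k l s : set Omega :=
  [set w | [/\ n w = k, m w = l &
    forall j, (j < size s)%N -> obs K (X j w : set S) = nth set0I s j]].

(* The same event as an intersection over the index type of the independent
   families. *)
Let ev k l s (i : (bool + nat)%type) : set Omega :=
  match i with
  | inl true => n @^-1` [set k]
  | inl false => m @^-1` [set l]
  | inr j => X j @^-1` [set B : set S | obs K B = nth set0I s j]
  end.

Let idx s : seq (bool + nat)%type := inl true :: inl false :: map inr (iota 0 (size s)).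

Let idx_uniq s : uniq (idx s).
Proof.
rewrite /= inE /= map_inj_uniq ?iota_uniq ?andbT; last by move=> ? ? [].
by apply/andP; split; apply/negP => /mapP[].
Qed.

Let sample_eventE k l s :
  sample_event k l s = \bigcap_(i in [set` seq_fset tt (idx s)]) ev k l s i.
Proof.
have memJ i : [set` seq_fset tt (idx s)] i <-> i \in idx s by rewrite /mkset seq_fsetE.
apply/seteqP; split => [w /= [nk ml Xs] i /memJ|w H].
  case: i => [[]|j] // /[!inE] /= /mapP[j' + [->]]; rewrite mem_iota add0n => /andP[_ js].
  exact: Xs.
split.
- by apply: (H (inl true)); apply/memJ; rewrite !inE.
- by apply: (H (inl false)); apply/memJ; rewrite !inE.
- move=> j js; apply: (H (inr j)); apply/memJ; rewrite !inE/=.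
  by apply/mapP; exists j => //; rewrite mem_iota.
Qed.

Let ev_measurable k l s i : measurable (ev k l s i).
Proof.
case: i => [[]|j] /=; rewrite -[X in measurable X]setTI.
- exact: (@measurable_funPT _ _ _ _ n).
- exact: (@measurable_funPT _ _ _ _ m).
- by apply: (@measurable_funPT _ _ _ _ (X j)) => //; exact: measurable_obs.
Qed.

Lemma measurable_sample_event k l s : measurable (sample_event k l s).
Proof.
rewrite sample_eventE; apply: fin_bigcap_measurable; first exact: finite_fset.
by move=> i _; exact: ev_measurable.
Qed.

Definition sample_weight k l s : R :=
  poisson_pmf t k * poisson_pmf t' l * \prod_(a <- s) q a.

Lemma sample_event_prob k l s : P (sample_event k l s) = (sample_weight k l s)%:E.
Proof.
rewrite sample_eventE (sampling_independent smp); last first.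
  move=> i _; case: i => [[]|j] /=.
  - by exists [set k] => //; rewrite setTI.
  - by exists [set l] => //; rewrite setTI.
  - by exists [set B : set S | obs K B = nth set0I s j]; rewrite ?setTI//; exact: measurable_obs.
rewrite (perm_big _ (seq_fset_perm _ _)) undup_id; last exact: idx_uniq.
rewrite /idx !big_cons big_map.
rewrite /sample_weight EFinM EFinM -muleA; congr (_ * (_ * _))%E.
- exact: (first_size_law smp).
- exact: (second_size_law smp).
rewrite (big_nth set0I) -prodEFin; rewrite /index_iota subn0; apply: eq_bigr => j _.
rewrite -obs_pmfE; exact: (sample_law smp j (measurable_obs K (nth set0I s j))).
Qed.

(** The counts of a species when the list [s] is cut at the end of the first
    expedition. *)
Definition tally k s (j : I) : nat * nat :=
  (count (fun a : {set I} => j \in a) (take k s),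
   count (fun a : {set I} => j \in a) (drop k s)).

Lemma tally_rcons1 k s a : (size s < k)%N -> tally k (rcons s a) = hit incr1 a (tally k s).
Proof.
move=> sk; apply/funext => j.
have sk1 : (size (rcons s a) <= k)%N by rewrite size_rcons.
rewrite /tally /hit /incr1 (take_oversize sk1) (take_oversize (ltnW sk)).
rewrite (drop_oversize sk1) (drop_oversize (ltnW sk)) -cats1 count_cat/= addn0.
by case: (j \in a); rewrite ?addn1 ?addn0.
Qed.

Lemma tally_rcons2 k s a : (k <= size s)%N -> tally k (rcons s a) = hit incr2 a (tally k s).
Proof.
move=> sk; apply/funext => j; rewrite /tally /hit /incr2 drop_rcons//.
rewrite -(cats1 s) -cats1 (takel_cat _ sk) count_cat/= addn0.
by case: (j \in a); rewrite ?addn1 ?addn0.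
Qed.

Definition counts (w : Omega) (j : I) : nat * nat :=
  ((\sum_(0 <= i < n w) (j \in obs K (X i w : set S)))%N,
   (\sum_(n w <= i < n w + m w) (j \in obs K (X i w : set S)))%N).

(* The counts are a function of a random element of a countable type, which
   makes every function of them measurable. *)
Let record (w : Omega) : seq {set I} :=
  [seq obs K (X i w : set S) | i <- iota 0 (n w + m w)].

Lemma counts_tally w : counts w = tally (n w) (record w).
Proof.
apply/funext => j; rewrite /counts /tally /record -map_take -map_drop.
rewrite take_iota drop_iota add0n (minn_idPl (leq_addr _ _)) addKn !count_map.
have cE (p : pred nat) r : count p r = (\sum_(i <- r) (p i : nat))%N.
  by rewrite -sum1_count big_mkcond; apply: eq_bigr => i _; case: (p i).
by rewrite !cE /index_iota subn0 addKn.
Qed.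

Let record_event k l s :
  [set w | (n w, m w, record w) = (k, l, s)] =
  if size s == (k + l)%N then sample_event k l s else set0.
Proof.
case: ifPn => [/eqP sE|sE]; apply/seteqP; split => w //=.
- move=> [nk ml rs]; split => // j js.
  by rewrite -rs (nth_map 0%N) ?size_iota ?nk ?ml -?sE// nth_iota ?add0n -?sE.
- move=> [nk ml Xs]; congr (_, _, _) => //.
  apply: (@eq_from_nth _ set0I); first by rewrite size_map size_iota nk ml sE.
  move=> j; rewrite size_map size_iota nk ml -sE => js.
  by rewrite (nth_map 0%N) ?size_iota ?nk ?ml -?sE// nth_iota ?add0n -?sE// Xs.
- by move=> [nk ml rs]; move: sE; rewrite -rs size_map size_iota nk ml eqxx.
Qed.

Lemma sample_event_counts k l s w : size s = (k + l)%N ->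
  sample_event k l s w -> counts w = tally k s.
Proof.
move=> sE ws; have [nk _ _] := ws; rewrite counts_tally nk; congr tally.
have := record_event k l s; rewrite sE eqxx => h.
have : [set w | (n w, m w, record w) = (k, l, s)] w by rewrite h.
by move=> [].
Qed.

Lemma measurable_counts (F : (I -> nat * nat) -> R) :
  measurable_fun setT (fun w => F (counts w)).
Proof.
pose G (c : nat * nat * seq {set I}) := F (tally c.1.1 c.2).
rewrite (_ : (fun w => _) = fun w => G (n w, m w, record w)); last first.
  by apply/funext => w; rewrite counts_tally.
apply: (measurable_fun_countable d Omega R _ (fun w => (n w, m w, record w)) G).
move=> -[[k l] s]; rewrite record_event.
by case: ifP => _ //; exact: measurable_sample_event.
Qed.

Lemma sample_event_rcons k l s : sample_event k l s =
  \big[setU/set0]_(a <- index_enum {set I}) sample_event k l (rcons s a).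
Proof.
rewrite -bigcup_seq; apply/seteqP; split => w /=.
  move=> [nk ml Xs]; exists (obs K (X (size s) w : set S)).
    by rewrite /= mem_index_enum.
  split => // j; rewrite size_rcons ltnS nth_rcons leq_eqVlt => /predU1P[->|js].
    by rewrite ltnn eqxx.
  by rewrite js Xs.
move=> [a _ [nk ml Xs]]; split => // j js.
by rewrite Xs ?size_rcons ?ltnS 1?ltnW// nth_rcons js.
Qed.

Lemma sample_event_disjoint k l s :
  trivIset setT (fun a => sample_event k l (rcons s a)).
Proof.
move=> a b _ _ [w [[_ _ wa] [_ _ wb]]].
have := wa (size s); have := wb (size s).
by rewrite !size_rcons ltnSn !nth_rcons ltnn eqxx => /(_ isT) <- /(_ isT) <-.
Qed.

Section Integral.
Variable F : (I -> nat * nat) -> R.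
Hypothesis F0 : forall x, 0 <= F x.

Let integral_rcons k l s :
  (\int[P]_(w in sample_event k l s) (F (counts w))%:E =
   \sum_a \int[P]_(w in sample_event k l (rcons s a)) (F (counts w))%:E)%E.
Proof.
rewrite {1}sample_event_rcons ge0_integral_bigsetU//.
- by move=> a; exact: measurable_sample_event.
- exact: index_enum_uniq.
- by apply: sub_trivIset (sample_event_disjoint k l s).
- apply/measurable_EFinP; apply: measurable_funS (measurable_counts F) => //.
- by move=> w _; rewrite lee_fin.
Qed.

Let weight_rcons k l s a : sample_weight k l (rcons s a) = sample_weight k l s * q a.
Proof. by rewrite /sample_weight -cats1 big_cat big_seq1 mulrA. Qed.

(* Revealing one more set of the second expedition applies one averaging
   operator; [e] sets are still hidden. *)
Let integral_second k l e s : (k <= size s)%N -> (size s + e = k + l)%N ->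
  (\int[P]_(w in sample_event k l s) (F (counts w))%:E =
   (sample_weight k l s * iter e (samp incr2 q) F (tally k s))%:E)%E.
Proof.
elim: e s => [|e IH] s sk sE.
  rewrite (eq_integral (cst (F (tally k s))%:E)); last first.
    move=> w; rewrite inE => ws; rewrite (sample_event_counts k l s)//; by rewrite -sE addn0.
  rewrite integral_cst; last exact: measurable_sample_event.
  by rewrite [X in (_ * X)%E](sample_event_prob k l s) -EFinM mulrC.
rewrite integral_rcons iterS {1}/samp mulr_sumr -sumEFin; apply: eq_bigr => a _.
rewrite IH ?size_rcons//; [|exact: ltnW|by rewrite addSnnS].
by rewrite weight_rcons tally_rcons2// mulrA.
Qed.

(* The same for the first expedition, once all of the second one is averaged. *)
Let integral_first k l e s : (size s + e = k)%N ->
  (\int[P]_(w in sample_event k l s) (F (counts w))%:E =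
   (sample_weight k l s *
    iter e (samp incr1 q) (iter l (samp incr2 q) F) (tally k s))%:E)%E.
Proof.
elim: e s => [|e IH] s sE.
  by rewrite (integral_second k l l)// -sE addn0.
rewrite integral_rcons iterS {1}/samp mulr_sumr -sumEFin; apply: eq_bigr => a _.
rewrite IH ?size_rcons ?addSnnS// weight_rcons tally_rcons1 ?mulrA//.
by rewrite -sE -addSnnS leq_addr.
Qed.

Variable M : R.
Hypothesis FM : forall x, `|F x| <= M.

Let iter_iter_bounded k l x :
  `|iter k (samp incr1 q) (iter l (samp incr2 q) F) x| <= M.
Proof.
have q0 := obs_pmf_ge0 mu K; have q1 := obs_pmf_sum mu K.
apply: iter_bounded => [||y]; [exact: posop_samp|exact: unitop_samp|].
apply: iter_bounded => //; [exact: posop_samp|exact: unitop_samp].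
Qed.

Let pois_iter k x :
  pois t' (fun l => iter k (samp incr1 q) (iter l (samp incr2 q) F) x) =
  iter k (samp incr1 q) (poisop t' (samp incr2 q) F) x.
Proof.
elim: k x => [//|k IH] x; rewrite iterS [RHS]/samp.
under [RHS]eq_bigr do rewrite -IH.
rewrite -(pois_sum _ M)// => a l; exact: iter_iter_bounded.
Qed.

Let integral_n k : (\int[P]_(w in n @^-1` [set k]) (F (counts w))%:E =
  (poisson_pmf t k * iter k (samp incr1 q) (poisop t' (samp incr2 q) F) (fun=> (0, 0)%N))%:E)%E.
Proof.
have -> : n @^-1` [set k] = \bigcup_l sample_event k l [::].
  apply/seteqP; split => [w /= nk|w [l _ [nk _ _]]//].
  by exists (m w) => //; split.
rewrite ge0_integral_bigcup//; first last.
- by move=> l l' _ _ [w [[_ <- _] [_ <- _]]].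
- by move=> w _; rewrite lee_fin.
- by apply/measurable_EFinP; apply: measurable_funS (measurable_counts F).
- by move=> l; exact: measurable_sample_event.
rewrite -pois_iter -(pois_series _ _ _ M)//.
congr (limn _); apply/funext => N; apply: eq_bigr => l _; rewrite (integral_first k l k)// /sample_weight big_nil mulr1.
by rewrite (_ : tally k [::] = fun=> (0, 0)%N)//; apply/funext => j.
Qed.

(** Summing over the sizes of the two expeditions gives the Poisson averages. *)
Lemma integral_counts : (\int[P]_w (F (counts w))%:E =
  (poisop t (samp incr1 q) (poisop t' (samp incr2 q) F) (fun=> (0, 0)%N))%:E)%E.
Proof.
have q0 := obs_pmf_ge0 mu K; have q1 := obs_pmf_sum mu K.
rewrite (_ : setT = \bigcup_k n @^-1` [set k]); last first.
  by apply/seteqP; split => // w _; exists (n w).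
rewrite ge0_integral_bigcup//; first last.
- by move=> l l' _ _ [w [<- <-]].
- by move=> w _; rewrite lee_fin.
- by apply/measurable_EFinP; apply: measurable_funS (measurable_counts F).
- move=> k; rewrite -[X in measurable X]setTI; exact: (@measurable_funPT _ _ _ _ n).
rewrite /poisop -[X in (X)%:E]mul1r -(pois_series _ _ _ M)//; last first.
  move=> k; apply: iter_bounded; [exact: posop_samp|exact: unitop_samp|].
  move=> y; apply: poisop_bounded => //; [exact: ltW|exact: posop_samp|exact: unitop_samp].
by congr (limn _); apply/funext => N; apply: eq_bigr => k _; rewrite integral_n mul1r.
Qed.
End Integral.
End SampleEvents.

(** * Convergence of the truncated error *)
Section CodedSpecies.
Context {S : countType}.

Definition species K : seq S := pmap (fun j => choice.pickle_inv j) (iota 0 K).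

Lemma species_uniq K : uniq (species K).
Proof.
rewrite /species (@pmap_uniq _ _ _ choice.pickle) ?iota_uniq//.
exact: choice.pickle_invK.
Qed.

Lemma mem_species K (s : S) : (s \in species K) = (choice.pickle s < K)%N.
Proof.
rewrite /species mem_pmap; apply/mapP/idP => [[j]|sK].
  rewrite mem_iota add0n => /andP[_ jK] js.
  by have := choice.pickle_invK (T := S) j; rewrite -js /= => ->.
by exists (choice.pickle s); rewrite ?mem_iota// choice.pickleK_inv.
Qed.

Lemma mem_obs K (A : set S) (j : 'I_K) :
  (j \in obs K A) = if choice.pickle_inv j is Some s then `[< A s >] else false.
Proof.
rewrite inE; apply/asboolP/idP => [[s <- As]|]; first by rewrite choice.pickleK_inv; apply/asboolP.
have := choice.pickle_invK (T := S) j; case: choice.pickle_inv => // s /= sj /asboolP As.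
by exists s.
Qed.

Lemma card_fset_set_seq {R : realType} (A : set S) (r : seq S) : uniq r ->
  (forall s, A s -> s \in r) ->
  (#|` fset_set A|)%:R = \sum_(s <- r) `[< A s >]%:R :> R.
Proof.
move=> ur Ar.
have fA : finite_set A.
  by apply: (sub_finite_set _ (finite_seq r)) => s /Ar.
rewrite -natr_sum; congr (_%:R).
rewrite (_ : (\sum_(s <- r) `[< A s >])%N = count (fun s => `[< A s >]) r); last first.
  by rewrite -sum1_count [RHS]big_mkcond/=; apply: eq_bigr => s _; case: asbool.
rewrite -size_filter; apply: perm_size; apply: uniq_perm; rewrite ?filter_uniq//.
move=> s; rewrite in_fset_set// mem_filter; apply/idP/andP => [|[/asboolP As _]].
  by rewrite inE => As; split => //; exact: Ar.
by rewrite inE.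
Qed.
End CodedSpecies.

Lemma le_limn_einf {R : realType} (u v : (\bar R)^nat) (b : \bar R) :
  (forall k, (u k <= v k)%E) -> v @ \oo --> b -> (limn_einf u <= b)%E.
Proof.
move=> uv vb; rewrite -(cvg_limn_einf_sup vb).1 !limn_einf_lim.
apply: lee_lim; [exact: is_cvg_einfs|exact: is_cvg_einfs|apply: nearW => k].
apply: le_ereal_inf_tmp => _ [p /= kp <-]; apply: le_trans (uv p).
by apply: ereal_inf_lbound; exists p.
Qed.

Section Pathwise.
Context {S : countType} {R : realType} {d : measure_display}.
Context {Omega : measurableType d} (P : probability Omega R).
Variables (X : nat -> {RV P >-> subsets S}) (n m : {RV P >-> nat}).
Variable (H : nat -> R).
Hypothesis H0 : H 0%N = 0.

(** A truncation of the squared error to a function of finitely many counts. *)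
Definition partial_error K (w : Omega) : R :=
  addf (fun _ : 'I_K => gap (cutoff H K)) (counts P X n m K w) ^+ 2.

Lemma counts_species K w (j : 'I_K) : counts P X n m K w j =
  if choice.pickle_inv j is Some s then (N1 X n w s, N2 X n m w s) else (0, 0)%N.
Proof.
rewrite /counts; under eq_bigr do rewrite mem_obs.
under [X in (_, X)]eq_bigr do rewrite mem_obs.
by case: choice.pickle_inv => [s|] //=; rewrite !big1.
Qed.

Lemma addf_species K (G : nat * nat -> R) w : G (0, 0)%N = 0 ->
  addf (fun _ : 'I_K => G) (counts P X n m K w) =
  \sum_(s <- species (S := S) K) G (N1 X n w s, N2 X n m w s).
Proof.
move=> G0; rewrite /addf /species big_pmap.
rewrite -[K in iota 0 K]subn0 -/(index_iota 0 K) big_mkord.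
apply: eq_bigr => j _; rewrite counts_species.
by case: choice.pickle_inv.
Qed.

(** Only finitely many species are seen and their counts are at most the size of
    the first expedition, so a large [K] truncates nothing. *)
Lemma partial_error_eventually w : (forall i, finite_set (X i w : set S)) ->
  \forall K \near \oo, partial_error K w = sq_error X n m H w.
Proof.
move=> finX; pose N := (n w + m w)%N.
have [K0 HK0] : exists K0, forall i, (i < N)%N -> forall s, (X i w : set S) s -> (choice.pickle s < K0)%N.
  elim: N => [|N [K0 IH]]; first by exists 0%N.
  exists (maxn K0 (\max_(s <- fset_set (X N w : set S)) (choice.pickle s).+1)) => i.
  rewrite ltnS leq_eqVlt => /predU1P[->|iN] s Xs; last first.
    by rewrite (leq_trans (IH i iN s Xs))// leq_maxl.
  rewrite (leq_trans _ (leq_maxr _ _))//.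
  by apply: (@leq_bigmax_seq _ _ _ (fun s => (choice.pickle s).+1)) => //; rewrite in_fset_set// inE.
near=> K.
have K0K : (K0 <= K)%N by near: K; exact: nbhs_infty_ge.
have nK : (n w < K)%N by near: K; exact: nbhs_infty_gt.
have unseen0 s : s \notin species K -> N1 X n w s = 0%N /\ N2 X n m w s = 0%N.
  rewrite mem_species => sK; rewrite /N1 /N2 /occurrences !big_nat.
  by split; rewrite big1// => i /andP[_ iN]; case: asboolP => // Xs; exfalso;
    move: sK => /negP; apply; apply: leq_trans K0K; apply: (HK0 i) => //;
    rewrite /N// (leq_trans iN)// leq_addr.
have N1n s : (N1 X n w s <= n w)%N.
  rewrite /N1 /occurrences (@leq_trans (\sum_(0 <= i < n w) 1)%N)//.
    by apply: leq_sum => i _; case: asbool.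
  by rewrite sum_nat_const_nat muln1 subn0.
rewrite /partial_error addf_species; last by rewrite /gap/= cutoff0// subr0.
rewrite /sq_error -normrX ger0_norm ?sqr_ge0//; congr (_ ^+ 2).
have -> : linear_estimator X n H w = \sum_(s <- species K) H (N1 X n w s).
  rewrite /linear_estimator (fsbigTE (seq_fset tt (species K))); last first.
    by move=> s; rewrite seq_fsetE => /unseen0[-> _].
  by rewrite (perm_big _ (seq_fset_perm _ _)) undup_id// species_uniq.
rewrite /unseen /seen_total /seen_first !(card_fset_set_seq _ (species K)) ?species_uniq//.
- rewrite -!sumrB; apply: eq_big_seq => s _; rewrite /gap /= /cutoff.
  rewrite (leq_ltn_trans (N1n s) nK); congr (_ - _).
  case: (N1 X n w s) => [|a] /=; last by rewrite !asboolT// subrr.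
  rewrite add0n [X in _ - X](_ : _ = 0) ?subr0; last by rewrite asboolF.
  by case: (N2 X n m w s) => [|b] /=; [rewrite asboolF|rewrite asboolT].
- move=> s /= sN; apply: contraT => /unseen0[n0 _]; by move: sN; rewrite n0.
- by move=> s /= sN; apply: contraT => /unseen0[n0 n1]; move: sN; rewrite n0 n1.
Unshelve. all: by end_near. Qed.
End Pathwise.

(** * The risk of a linear estimator *)

Import HBNNSimple.

Section IntegralUpperBound.
Context {R : realType} {d : measure_display} {T : measurableType d}.
Variable (mu : {measure set T -> \bar R}).

(** The squared error is measurable only up to a negligible set.  Still, the
    integral of a nonnegative function is a supremum over the simple functions
    below it, and to these, which are measurable, the comparison almost
    everywhere applies. *)
Lemma ae_le_integral_majorant (f g : T -> \bar R) (E : set T) :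
  (forall x, 0 <= f x)%E -> (forall x, 0 <= g x)%E -> measurable_fun setT g ->
  mu.-negligible (~` E) -> (forall x, E x -> (f x <= g x)%E) ->
  (\int[mu]_x f x <= \int[mu]_x g x)%E.
Proof.
move=> f0 g0 mg nE fg; rewrite ge0_integralTE//.
apply: ub_ereal_sup => _ [h /= hf <-].
have -> : sintegral mu h = (\int[mu]_x (h x)%:E)%E by rewrite integral_nnsfun// patch_setT.
apply: ae_ge0_le_integral => //.
- by move=> x _; rewrite lee_fin.
- exact/measurable_EFinP.
- apply: negligibleS nE => x /= nP Ex; apply: nP => _.
  exact: le_trans (hf x) (fg x Ex).
Qed.
End IntegralUpperBound.

Section Risk.
Context {S : countType} {R : realType} {d : measure_display}.
Context {Omega : measurableType d} (P : probability Omega R).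
Variables (X : nat -> {RV P >-> subsets S}) (n m : {RV P >-> nat}).
Variables (mu : probability (subsets S) R) (B : nat) (r t : R) (H : nat -> R) (beta v : R).
Hypotheses (smp : poissonized_sampling X n m mu t (r * t)).
Hypotheses (mufin : finitely_supported mu) (muB : size_bounded mu B).
Hypotheses (r0 : 0 < r) (t0 : 0 < t) (H0 : H 0%N = 0).
Hypothesis (Hcvg : cvgn (series (fun k => H k ^+ 2 * t ^+ k / k`!%:R))).
Hypothesis (Hbeta : forall p, 0 <= p <= 1 -> bias_fun r t H p <= beta).
Hypothesis (Hv : forall p, 0 <= p <= 1 -> var_fun r t H p <= v).

Lemma integral_partial_error K : (\int[P]_w (partial_error P X n m H K w)%:E <=
  ((B%:R * (beta + tail H t K)) ^+ 2 + 2 * B%:R ^+ 2 * v)%:E)%E.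
Proof.
have rt0 : 0 < r * t by rewrite mulr_gt0.
have [M hM] := cutoff_bounded H K.
pose F (x : 'I_K -> nat * nat) := addf (fun _ : 'I_K => gap (cutoff H K)) x ^+ 2.
have F0 x : 0 <= F x by exact: sqr_ge0.
have FM x : `|F x| <= (#|'I_K|%:R * (M + 1)) ^+ 2.
  rewrite /F normrX lerXn2r ?nnegrE//.
    rewrite (le_trans (normr_ge0 (addf (fun _ : 'I_K => gap (cutoff H K)) x)))//.
    by apply: addf_bounded => i a; exact: gap_bounded.
  by apply: addf_bounded => i a; exact: gap_bounded.
rewrite (integral_counts P X n m mu t (r * t) K smp t0 rt0 F F0 _ FM) lee_fin.
apply: cutoff_risk_le => //.
- exact: obs_pmf_ge0.
- exact: obs_pmf_sum.
- exact: obs_pmf_eq0.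
Qed.

Lemma finite_samples_ae :
  P.-negligible (~` [set w | forall i, finite_set (X i w : set S)]).
Proof.
rewrite (_ : ~` _ = \bigcup_i (X i @^-1` (~` [set A : set S | finite_set A]))); last first.
  apply/seteqP; split => [w /= /existsNP[i Xi]|w [i _ /= Xi] h]; first by exists i.
  exact: Xi.
apply: negligible_bigcup => i; apply/negligibleP.
  rewrite -[X in measurable X]setTI; apply: (@measurable_funPT _ _ _ _ (X i)) => //.
  by apply: measurableC; exact: measurable_finite_sets.
rewrite -[LHS]/(distribution P (X i) _) (sample_law smp).
  exact: finite_sets_prob.
by apply: measurableC; exact: measurable_finite_sets.
Qed.

Lemma measurable_partial_error K : measurable_fun setT (fun w => (partial_error P X n m H K w)%:E).
Proof.
apply/measurable_EFinP.
exact: (measurable_counts P X n m K (fun x => addf (fun _ : 'I_K => gap (cutoff H K)) x ^+ 2)).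
Qed.

(** Fatou's lemma applied to the truncated errors, which almost surely converge
    to the squared error. *)
Lemma risk_le : ('E_P[sq_error X n m H] <= ((B%:R * beta) ^+ 2 + 2 * B%:R ^+ 2 * v)%:E)%E.
Proof.
pose f K w := (partial_error P X n m H K w)%:E.
pose g w := limn_einf (f ^~ w).
have f0 K w : (0 <= f K w)%E by rewrite lee_fin sqr_ge0.
have mf K : measurable_fun setT (f K) by exact: measurable_partial_error.
have mg : measurable_fun setT g.
  apply: (@emeasurable_fun_cvg _ _ _ _ (fun K w => einfs (f ^~ w) K)) => [K|w _].
    exact: measurable_fun_einfs.
  by rewrite /g limn_einf_lim; exact: is_cvg_einfs.
have g0 w : (0 <= g w)%E.
  rewrite /g limn_einf_lim; apply: lime_ge; first exact: is_cvg_einfs.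
  by apply: nearW => K; apply: le_ereal_inf_tmp => _ [p /= _ <-]; exact: f0.
rewrite unlock; apply: (@le_trans _ _ (\int[P]_w g w)%E).
  apply: (ae_le_integral_majorant _ _ _ [set w | forall i, finite_set (X i w : set S)]) => //.
  - by move=> w; rewrite lee_fin exprn_ge0.
  - exact: finite_samples_ae.
  - move=> w finX; rewrite /g.
    have h : f ^~ w @ \oo --> (sq_error X n m H w)%:E.
      apply: cvg_near_cst.
      have := partial_error_eventually P X n m H H0 w finX.
      by apply: filterS => K; rewrite /f => ->.
    by rewrite (cvg_limn_einf_sup h).1.
apply: le_trans (fatou _ measurableT mf (fun K w _ => f0 K w)) _.
apply: (le_limn_einf _ _ _ integral_partial_error).
apply: cvg_EFin; first by apply: nearW.
apply: cvgD; last exact: cvg_cst.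
have h : B%:R * (beta + tail H t K) @[K --> \oo] --> B%:R * beta.
  apply: cvgMl_tmp; rewrite -[X in _ --> X]addr0; apply: cvgD; first exact: cvg_cst.
  exact: tail_cvg.
rewrite expr2; under eq_cvg do rewrite expr2.
exact: cvgM.
Qed.
End Risk.

(** * From the functional to the normalized risk *)
Section RiskFunctional.
Context {R : realType}.

Lemma eseries_fin_cvg (a : nat -> R) : (forall k, 0 <= a k) -> a 0%N = 0 ->
  (\sum_(1 <= i <oo) (a i)%:E != +oo)%E -> cvgn (series a).
Proof.
move=> a0 a00 afin; pose s := (\sum_(1 <= i <oo) (a i)%:E)%E.
have s0 : (0 <= s)%E by apply: nneseries_ge0 => k _ _; rewrite lee_fin.
have sfin : s \is a fin_num by rewrite ge0_fin_numE// ltey.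
apply: nondecreasing_is_cvgn.
  by apply/nondecreasing_seqP => k; rewrite /series/= big_nat_recr//= lerDl.
exists (fine s) => _ [k _ <-]; rewrite -lee_fin fineK//.
have := @nneseries_lim_ge R (fun i => (a i)%:E) xpredT 1 k (fun n _ _ => a0 n).
rewrite sumEFin; apply: le_trans; rewrite lee_fin /series/=.
by case: k => [|k]; [rewrite !big_geq|rewrite [leLHS]big_ltn// a00 add0r].
Qed.

Lemma normalized_risk_le (B : nat) (r t g : R) (H : nat -> R) : 0 < r -> 0 < t ->
  H 0%N = 0 -> (G r t H <= g%:E)%E ->
  (normalized_risk B r t H <= (2 * B%:R ^+ 2 * g / (r ^+ 2 * t ^+ 2))%:E)%E.
Proof.
move=> r0 t0 H0; rewrite /G; case: ifPn => [_|Hfin]; first by rewrite leye_eq.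
have a0 k : 0 <= H k ^+ 2 * t ^+ k / k`!%:R.
  by rewrite divr_ge0// mulr_ge0 ?sqr_ge0// exprn_ge0// ltW.
have Hcvg : cvgn (series (fun k => H k ^+ 2 * t ^+ k / k`!%:R)).
  by apply: eseries_fin_cvg => //; rewrite H0 expr0n/= !mul0r.
rewrite /Yb /Yv; set sb := ereal_sup _; set sv := ereal_sup _ => Gg.
have in01 : (0 : R) \in `[0, 1] by rewrite in_itv/= lexx ler01.
have sb0 : (0 <= sb)%E.
  apply: (@le_trans _ _ (bias_fun r t H 0)%:E); last by apply: ereal_sup_ubound; exists 0.
  by rewrite lee_fin /bias_fun eqxx mulr_ge0// ltW.
have sv0 : (0 <= sv)%E.
  apply: (@le_trans _ _ (var_fun r t H 0)%:E); last by apply: ereal_sup_ubound; exists 0.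
  by rewrite lee_fin /var_fun eqxx mulr_ge0 ?addr_ge0 ?sqr_ge0// ltW.
have sb2 : (sb ^+ 2 <= g%:E)%E by apply: le_trans Gg; rewrite leeDl.
have svg : (sv <= g%:E)%E.
  by apply: le_trans Gg; rewrite leeDr// expe2 mule_ge0.
have sbfin : sb \is a fin_num.
  rewrite ge0_fin_numE// ltey; apply/eqP => sby; move: sb2.
  by rewrite sby expe2 mulyy leye_eq.
have svfin : sv \is a fin_num by rewrite ge0_fin_numE// (le_lt_trans svg)// ltry.
have Gfin : fine sb ^+ 2 + fine sv <= g.
  by rewrite -lee_fin EFinD fineK// expr2 EFinM fineK// -expe2.
apply: ub_ereal_sup => x [S [mu [dd [Om [P [X [n [m [mufin muB smp xE]]]]]]]]]; rewrite xE.
have hb p : 0 <= p <= 1 -> bias_fun r t H p <= fine sb.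
  move=> p01; rewrite -lee_fin fineK//; apply: ereal_sup_ubound; exists p => //; rewrite /= in_itv.
have hv p : 0 <= p <= 1 -> var_fun r t H p <= fine sv.
  move=> p01; rewrite -lee_fin fineK//; apply: ereal_sup_ubound; exists p => //; rewrite /= in_itv.
have risk := risk_le P X n m mu B r t H (fine sb) (fine sv) smp mufin muB r0 t0 H0 Hcvg hb hv.
have i0 : 0 <= (r ^+ 2 * t ^+ 2)^-1 by rewrite invr_ge0 mulr_ge0 ?sqr_ge0.
apply: (@le_trans _ _ (((B%:R * fine sb) ^+ 2 + 2 * B%:R ^+ 2 * fine sv)%:E * ((r ^+ 2 * t ^+ 2)^-1)%:E)%E).
  by apply: lee_wpmul2r.
rewrite -EFinM lee_fin ler_wpM2r// exprMn.
have fsv : 0 <= fine sv by exact: fine_ge0.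
have : B%:R ^+ 2 * (fine sb ^+ 2 + fine sv) <= B%:R ^+ 2 * g by rewrite ler_wpM2l// sqr_ge0.
have : 0 <= B%:R ^+ 2 * fine sb ^+ 2 by rewrite mulr_ge0 ?sqr_ge0.
lra.
Qed.
End RiskFunctional.

(** * The rate *)
Section Asymptotics.
Context {R : realType}.
Variable (r : R).
Hypothesis (hr : 1 < r).

Let th : R := (1 + r)^-1.
Let kap : R := (r - 1) * r / (1 + r) ^+ 2.

(** The three terms bound the squared bias, the part [r / t] of the variance and
    the part due to the coefficients. *)
Definition rate_cst : R := (4 * r ^+ 2 / kap) ^+ 2 * 4 + r * (2 / (1 - 2 * th) ^+ 2) +
  224 * (r * geo2 r / kap) ^+ 2.

(** With [c = ln t - ln (ln t) / 2], the factor [expR (- (c / (1 + r)))] squared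
    is the rate times [ln t ^+ 2], and [expR c * Num.sqrt c <= t].  The threshold
    [expR 4] makes [c] at least [ln t / 2], so that negative powers of [c] can be
    replaced by those of [ln t]. *)
Lemma G_rate (t : R) : expR 4 <= t -> let c := ln t - ln (ln t) / 2 in
  ((t * Hbias r c) ^+ 2 + t * (r + Hamp r c ^+ 2)) / t ^+ 2 <=
  rate_cst * ln t `^ (- 2 + (1 + r)^-1) * t `^ (- (2 / (1 + r))) /\ 1 <= c.
Proof.
move=> t4 c; have r1 := hr; have t0 : 0 < t := lt_le_trans (expR_gt0 4) t4.
pose L := ln t; pose l := ln L.
have tE : t = expR L by rewrite lnK// posrE.
have L4 : 4 <= L by rewrite -ler_expR -tE.
have L0 : 0 < L by lra.
have LE : L = expR l by rewrite lnK// posrE.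
have l0 : 0 <= l by rewrite ln_ge0//; lra.
have lL : l <= L by rewrite LE; have := expR_ge1Dx l; lra.
have cE : c = L - l / 2 by [].
have c1 : 1 <= c by lra.
split => //.
have k0 : 0 < kap by rewrite divr_gt0 ?exprn_gt0 ?mulr_gt0//; lra.
have th0 : 0 < th by rewrite invr_gt0; lra.
have th1 : 2 * th < 1 by rewrite /th ltr_pdivrMr ?mul1r; lra.
pose T := expR ((- 2 + th) * l - 2 * th * L).
have -> : rate_cst * ln t `^ (- 2 + (1 + r)^-1) * t `^ (- (2 / (1 + r))) = rate_cst * T.
  rewrite -mulrA; congr (_ * _); rewrite /powR !gt_eqF// -expRD; congr expR.
  by rewrite -/L -/l -/th; ring.
have pE : plim r c = expR (c * th) * kap by [].
have eT : expR (- (c * th)) ^+ 2 = T * L ^+ 2.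
  rewrite [in RHS]LE -!expRM_natl -expRD; congr expR; rewrite cE; by field.
have c2 : (c ^+ 2)^-1 <= 4 / L ^+ 2.
  rewrite -[leRHS]invrK lef_pV2 ?posrE ?invr_gt0 ?divr_gt0 ?exprn_gt0//; last by lra.
  by rewrite invf_div ler_pdivrMr//; nra.
have T0 : 0 < T := expR_gt0 _.
have b1 : Hbias r c ^+ 2 <= (4 * r ^+ 2 / kap) ^+ 2 * 4 * T.
  have -> : Hbias r c ^+ 2 = (4 * r ^+ 2 / kap) ^+ 2 * (expR (- (c * th)) ^+ 2 * (c ^+ 2)^-1).
    rewrite /Hbias pE expRN; field; rewrite !gt_eqF ?expR_gt0//; lra.
  rewrite -[leRHS]mulrA ler_wpM2l ?sqr_ge0// eT.
  rewrite (le_trans (ler_wpM2l _ c2))//; first by rewrite mulr_ge0 ?sqr_ge0// ltW.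
  by rewrite le_eqVlt; apply/orP; left; apply/eqP; field; lra.
have b2 : Hamp r c ^+ 2 / t <= 224 * (r * geo2 r / kap) ^+ 2 * T.
  have c0 : 0 < c by lra.
  have -> : Hamp r c ^+ 2 / t = (r * geo2 r / kap) ^+ 2 *
      (56 * (expR (- (l / 2)) * Num.sqrt c) * (expR (- (c * th)) ^+ 2 * (c ^+ 2)^-1)).
    have lE : expR (- (l / 2)) = expR c / t by rewrite tE -expRN -expRD; congr expR; rewrite cE; ring.
    rewrite lE /Hamp pE expRN.
    have -> : (r * lagb_amp c * geo2 r / (expR (c * th) * kap)) ^+ 2 =
        (r * geo2 r / kap) ^+ 2 * (expR (c * th))^-1 ^+ 2 * lagb_amp c ^+ 2.
      by field; rewrite !gt_eqF ?expR_gt0.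
    rewrite /lagb_amp sqr_sqrtr; last first.
      apply: divr_ge0; [apply: mulr_ge0; [apply: mulr_ge0 => //; exact: expR_ge0|exact: sqrtr_ge0]|exact: sqr_ge0].
    by field; rewrite !gt_eqF ?expR_gt0.
  have u1 : expR (- (l / 2)) * Num.sqrt c <= 1.
    rewrite [leRHS](_ : _ = expR (- (l / 2)) * expR (l / 2)); last by rewrite -expRD addNr expR0.
    rewrite ler_wpM2l ?expR_ge0// -(sqr_sqrtr (ltW c0)) sqrtr_sqr ger0_norm ?sqrtr_ge0//.
    rewrite -(@ler_pXn2r _ 2) ?nnegrE ?sqrtr_ge0 ?expR_ge0// sqr_sqrtr ?(ltW c0)//.
    rewrite -expRM_natl (_ : 2%:R * (l / 2) = l); last by field.
    by rewrite -LE; lra.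
  rewrite [leRHS](_ : _ = (r * geo2 r / kap) ^+ 2 * (56 * 1 * (T * 4))); last by ring.
  rewrite ler_wpM2l ?sqr_ge0//; apply: ler_pM.
  - by rewrite mulr_ge0// mulr_ge0 ?expR_ge0 ?sqrtr_ge0.
  - by rewrite mulr_ge0 ?sqr_ge0// invr_ge0 sqr_ge0.
  - by rewrite ler_wpM2l.
  rewrite eT (le_trans (ler_wpM2l _ c2))//; first by rewrite mulr_ge0 ?sqr_ge0// ltW.
  by rewrite le_eqVlt; apply/orP; left; apply/eqP; field; lra.
(* The quotient of [t^-1] and the rate is at most [ln t ^+ 2] over the power
   [1 - 2 / (1 + r)] of [t], and this power, an exponential in [ln t], exceeds
   the quadratic term of the exponential series. *)
have b3 : r / t <= r * (2 / (1 - 2 * th) ^+ 2) * T.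
  have q0 : 0 < 1 - 2 * th by lra.
  have -> : r / t = r * expR (- L) by rewrite tE expRN.
  rewrite -mulrA ler_wpM2l//; first by lra.
  have -> : T = expR (- L) * (expR (th * l) * expR ((1 - 2 * th) * L)) / L ^+ 2.
    by rewrite [in RHS]LE -expRM_natl -expRN -!expRD -LE; congr expR; ring.
  rewrite [leRHS](_ : _ = expR (- L) * (expR (th * l) * (expR ((1 - 2 * th) * L) / (((1 - 2 * th) * L) ^+ 2 / 2)))); last first.
    by field; lra.
  rewrite -[leLHS]mulr1 ler_wpM2l ?expR_ge0// -[leLHS]mulr1; apply: ler_pM => //.
    by rewrite -expR0 ler_expR mulr_ge0// ltW.
  have x0 : 0 <= (1 - 2 * th) * L by rewrite mulr_ge0// ltW.
  rewrite ler_pdivlMr ?mul1r; last by rewrite divr_gt0// exprn_gt0// mulr_gt0.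
  have := @expR_ge1Dxn R ((1 - 2 * th) * L) 1 x0; rewrite (_ : 2`!%:R = 2)//; lra.
have -> : ((t * Hbias r c) ^+ 2 + t * (r + Hamp r c ^+ 2)) / t ^+ 2 =
    Hbias r c ^+ 2 + (r / t + Hamp r c ^+ 2 / t).
  by field; lra.
rewrite /rate_cst; lra.
Qed.
End Asymptotics.

Theorem corollary24 (R : realType) (r : R) (hr : 1 < r) :
  exists C : R, \forall t \near +oo,
    forall (B : nat) (H : nat -> R), (1 <= B)%N -> is_minimizer r t H ->
      (normalized_risk B r t H <=
        (C * B%:R ^+ 2 * ln t `^ (- 2 + (1 + r)^-1) * t `^ (- (2 / (1 + r))))%:E)%E.
Proof.
exists (2 / r ^+ 2 * rate_cst r); near=> t => B H _ [H0 Hmin].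
have t4 : expR 4 <= t by near: t; exact: nbhs_pinfty_ge.
have t0 : 0 < t := lt_le_trans (expR_gt0 4) t4.
have r0 : 0 < r by rewrite (lt_trans ltr01).
have [rate c1] := G_rate r hr t t4; set c := ln t - _ in rate c1.
have HG := le_trans (Hmin (Hopt r c)) (G_Hopt_le r c t hr c1 t0).
apply: le_trans (normalized_risk_le B r t _ H r0 t0 H0 HG) _.
rewrite lee_fin; set g := _ + _ in rate *.
have -> : 2 * B%:R ^+ 2 * g / (r ^+ 2 * t ^+ 2) = 2 / r ^+ 2 * B%:R ^+ 2 * (g / t ^+ 2).
  by field; rewrite !gt_eqF.
rewrite (le_trans (ler_wpM2l _ rate))//.
  by rewrite mulr_ge0 ?sqr_ge0// divr_ge0 ?sqr_ge0.
by rewrite le_eqVlt; apply/orP; left; apply/eqP; ring.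
Unshelve. all: by end_near. Qed.
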